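(* Let $\Sigma$ be a nonlinear control system $\dot x=g_0(x)+\sum_{j=1}^m u_jg_j(x)$, $y_j=V_j(x)$, $j=1,\dots,m$, with state manifold $M$. Let $\nabla$ be a torsion-free affine connection on $M$. Assume that $\Sigma$ is observable with $\dim d\mathcal{H}$ constant, that $\Sigma$ is compatible with $\nabla$, and that the distribution $\mathcal{S}_0$ is full-rank. Then $\Sigma$ is a locally gradient control system if and only if its prolonged system $\Sigma^p$ and its gradient extension $\Sigma^e$ (with respect to $\nabla$) are weakly externally equivalent.
   Context: All manifolds and objects on them (vector fields, functions, connections, metrics) are real-analytic; $M$ is an $n$-dimensional manifold. System. $\Sigma$: $\dot x=g_0(x)+\sum_{j=1}^m u_jg_j(x)$, $y_j=V_j(x)$ ($j=1,\dots,m$), with $x\in M$, $u\in U$, $U\subset\mathbb{R}^m$ open containing $0$; $g_0,\dots,g_m$ are complete vector fields and $V_j$ are real-valued functions on $M$. Admissible controls are piecewise constant right continuous functions of time. Locally gradient. A pseudo-Riemannian metric is a non-degenerate symmetric $(0,2)$-tensor $\mathcal{G}$ (not necessarily positive definite); $\flat_{\mathcal G}(X)=\mathcal G(X,\cdot)$ and $\mathrm{grad}_{\mathcal G}V=\flat_{\mathcal G}^{-1}(dV)$. A vector field $X$ is locally gradient if $\flat_{\mathcal G}(X)$ is closed. $\Sigma$ is a locally gradient control system if there is a pseudo-Riemannian metric $\mathcal G$ on $M$ such that $g_0$ is locally gradient and $g_j=\mathrm{grad}_{\mathcal G}V_j$ for $j=1,\dots,m$. Observability. The observation space $\mathcal H$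 is the real linear span in $C^\infty(M)$ of the functions $\mathcal L_{X_1}\cdots\mathcal L_{X_s}V_j$, $s\ge 0$, $X_r\in\{g_0,\dots,g_m\}$, $j\in\{1,\dots,m\}$; $d\mathcal H(x)=\mathrm{span}\{dH(x):H\in\mathcal H\}$, and ''$\dim d\mathcal H$ constant'' means this dimension is independent of $x$. Two states are indistinguishable if they give the same output for every admissible control; $\Sigma$ is observable if indistinguishable states are equal (equivalently, by analyticity, $\mathcal H$ separates points of $M$). Symmetric product. $\langle X:Y\rangle=\nabla_XY+\nabla_YX$. $S_0$ is the real linear span of the vector fields $\langle X_1:\langle X_2:\langle\cdots:\langle X_s:g_j\rangle\cdots\rangle\rangle\rangle$, $s\ge 0$, $X_r\in\{g_0,\dots,g_m\}$, $j\in\{1,\dots,m\}$; $\mathcal S_0(x)=\mathrm{span}\{X(x):X\in S_0\}$. Full-rank means $\mathcal S_0(x)=T_xM$ for all $x$. Compatibility. For a word $w=(X_1,\dots,X_s;j)$ with $s\ge0$, $X_r\in\{g_0,\dots,g_m\}$, $j\in\{1,\dots,m\}$, put $R_w=\langle X_1:\langle X_2:\cdots:\langle X_s:g_j\rangle\cdots\rangle\rangle$ and $V_w=\mathcal L_{X_1}\cdots\mathcal L_{X_s}V_j$ (so $R_w=g_j$, $V_w=V_j$ if $s=0$). $\Sigma$ is compatible with $\nabla$ if for all words $w,w',w''$: (a) $\mathcal L_{R_w}V_{w'}=\mathcal L_{R_{w'}}V_w$; (b) $\mathcal L_{\langle R_w:R_{w'}\rangle}V_{w''}=\mathcal L_{R_{w''}}\big(\mathcal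 L_{R_w}V_{w'}\big)$. Prolongation. For a function $V$ on $M$ its lifts to $TM$ are $V^{c}(v)=\langle dV,v\rangle$ and $V^{v}=V\circ\tau_M$ ($\tau_M:TM\to M$ the projection). For a vector field $X$ on $M$, $X^{c}$ and $X^{v}$ are the unique vector fields on $TM$ with $X^{c}(f^{c})=(Xf)^{c}$ and $X^{v}(f^{c})=(Xf)^{v}$ for all $f\in C^\infty(M)$. The prolonged system on $TM$ is $\Sigma^p$: $\dot x_p=g_0^{c}(x_p)+\sum_j u_jg_j^{c}(x_p)+\sum_ju_j^pg_j^{v}(x_p)$ with inputs $u_j,u_j^p$ and outputs $y_j=V_j^{v}(x_p)$, $y_j^{v}=V_j^{c}(x_p)$. Gradient extension. On $T^*M$ with projection $\pi_M$, put $V^X(x,p)=\langle p,X(x)\rangle$ for a vector field $X$ and $V^{v}=V\circ\pi_M$ for a function $V$. The Riemannian extension $\mathcal G^{c}$ of $\nabla$ is the pseudo-Riemannian metric on $T^*M$ determined by $\mathcal G^{c}(X^{c},Y^{c})=-V^{\langle X:Y\rangle}$ for all vector fields $X,Y$ on $M$, where $X^c=X^a\partial_{x^a}-p_b\frac{\partial X^b}{\partial x^a}\partial_{p_a}$ is the complete lift to $T^*M$; in coordinates $(x^a,p_a)$ its matrix is $\begin{pmatrix}-2p_c\Gamma^c_{ab}&I_n\\ I_n&0\end{pmatrix}$, $\Gamma^c_{ab}$ being the Christoffel symbols of $\nabla$. The gradient extension on $T^*M$ is $\Sigma^e$: $\dot x_e=\mathrm{grad}_{\mathcal G^{c}}V^{g_0}(x_e)+\sum_ju_j\,\mathrm{grad}_{\mathcal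 G^{c}}V^{g_j}(x_e)+\sum_ju_j^e\,\mathrm{grad}_{\mathcal G^{c}}V_j^{v}(x_e)$ with inputs $u_j,u^e_j$ and outputs $y_j=V_j^{v}(x_e)$, $y_j^a=V^{g_j}(x_e)$. Weak external equivalence. Given two affine systems $\Sigma^1,\Sigma^2$ on $M^1,M^2$ with the same numbers of inputs and outputs (with vector fields $g_i^\alpha$ and output functions $V^\alpha_j$, $\alpha=1,2$), the functions $\mathcal L_{g^1_{i_1}}\cdots\mathcal L_{g^1_{i_s}}V^1_j$ and $\mathcal L_{g^2_{i_1}}\cdots\mathcal L_{g^2_{i_s}}V^2_j$ are said to correspond. The systems are weakly externally equivalent if for every $x^1\in M^1$ there is $x^2\in M^2$ with $H^1(x^1)=H^2(x^2)$ for all corresponding $H^1,H^2$, and vice versa. For $\Sigma^p,\Sigma^e$ the pairing is $g_i^{c}\leftrightarrow\mathrm{grad}_{\mathcal G^{c}}V^{g_i}$, $g_j^{v}\leftrightarrow\mathrm{grad}_{\mathcal G^{c}}V_j^{v}$, and for outputs $V_j^{v}\leftrightarrow V_j^{v}$, $V_j^{c}\leftrightarrow V^{g_j}$. *)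

(* Defs.v *)
From HB Require Import structures.
From mathcomp Require Import all_boot all_order all_algebra.
From mathcomp Require Import all_classical all_reals all_analysis.

Set Implicit Arguments.
Unset Strict Implicit.
Unset Printing Implicit Defensive.

Import Order.TTheory GRing.Theory Num.Theory.
Import numFieldTopology.Exports numFieldNormedType.Exports.

Local Open Scope classical_set_scope.
Local Open Scope ring_scope.

Section Analytic.
Variables (R : realType) (n : nat).

Definition power_psum (c : {ffun 'I_n -> nat} -> R) (a : 'rV[R]_n) (N : nat)
    (x : 'rV[R]_n) : R :=
  \sum_(k : {ffun 'I_n -> 'I_N})
     c [ffun i => k i : nat] * \prod_(i < n) (x 0 i - a 0 i) ^+ k i.

(* The bound on the coefficients makes the series converge absolutely on the
   polydisc of radius [r], so that the limit over boxes is its sum. *)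
Definition analytic_at (f : 'rV[R]_n -> R) (a : 'rV[R]_n) : Prop :=
  exists (c : {ffun 'I_n -> nat} -> R) (r C : R),
    [/\ 0 < r,
        forall k, `|c k| * r ^+ (\sum_(i < n) k i)%N <= C &
        forall x : 'rV[R]_n, (forall i, `|x 0 i - a 0 i| < r) ->
          power_psum c a N x @[N --> \oo] --> f x].

Definition analytic_on (D : set 'rV[R]_n) (f : 'rV[R]_n -> R) : Prop :=
  forall a, D a -> analytic_at f a.

Definition analytic_mx_on p q (D : set 'rV[R]_n)
    (f : 'rV[R]_n -> 'M[R]_(p, q)) : Prop :=
  forall i j, analytic_on D (fun x => f x i j).

Fixpoint Ck (k : nat) (D : set 'rV[R]_n) (f : 'rV[R]_n -> R) : Prop :=
  (forall x, D x -> {for x, continuous f}) /\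
  if k is k'.+1 then
    forall v, (forall x, D x -> derivable f x v) /\ Ck k' D ('D_v f)
  else True.

End Analytic.

Definition lspan (R : realType) (V : lmodType R) (P : set V) : set V :=
  [set v | exists (k : nat) (c : 'I_k -> R) (u : 'I_k -> V),
     (forall i, P (u i)) /\ v = \sum_(i < k) c i *: u i].

Definition has_dim (R : realType) (n : nat) (W : set 'rV[R]_n) (r : nat) :
    Prop :=
  exists B : 'M[R]_(r, n), row_free B /\ W = [set v | (v <= B)%MS].

(* Each point [x] has a preferred chart [chart_at x].  Tangent vectors and
   covectors at [x] are represented by their components in that chart, so a
   vector field, a 1-form and a (0,2)-tensor field on [T] are functions from
   [T] to ['rV_n], ['rV_n] and ['M_n].  Their components in any other chart
   are obtained with the Jacobian [coord_change]; regularity is always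
   expressed in every chart.  Vectors are rows: ['d F x v = v *m 'J F x]. *)

Record atlas (R : realType) (n : nat) (T : Type) := Atlas {
  chart_idx : Type;
  chart_dom : chart_idx -> set T;
  chart_map : chart_idx -> T -> 'rV[R]_n;
  chart_inv : chart_idx -> 'rV[R]_n -> T;
  chart_at : T -> chart_idx }.

Section Calculus.
Variables (R : realType) (n : nat) (T : Type) (A : atlas R n T).
Implicit Types (X Y : T -> 'rV[R]_n) (f : T -> R) (W : set T).

Definition chart_img (i : chart_idx A) W : set 'rV[R]_n :=
  chart_map i @` (chart_dom i `&` W).

Definition transition (i j : chart_idx A) : 'rV[R]_n -> 'rV[R]_n :=
  chart_map j \o chart_inv i.

Definition coord_change (i j : chart_idx A) (x : T) : 'M[R]_n :=
  'J (transition i j) (chart_map i x).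

Definition vec_in (i : chart_idx A) X (y : 'rV[R]_n) : 'rV[R]_n :=
  let x := chart_inv i y in X x *m coord_change (chart_at A x) i x.

Definition covec_in (i : chart_idx A) (w : T -> 'rV[R]_n) (y : 'rV[R]_n) :
    'rV[R]_n :=
  let x := chart_inv i y in w x *m (coord_change i (chart_at A x) x)^T.

Definition form_in (i : chart_idx A) (G : T -> 'M[R]_n) (y : 'rV[R]_n) :
    'M[R]_n :=
  let x := chart_inv i y in
  let J := coord_change i (chart_at A x) x in J *m G x *m J^T.

Definition analytic_fun W f : Prop :=
  forall i, analytic_on (chart_img i W) (f \o chart_inv i).

Definition smooth_fun W f : Prop :=
  forall i k, Ck k (chart_img i W) (f \o chart_inv i).

Definition analytic_field W X : Prop :=
  forall i, analytic_mx_on (chart_img i W) (vec_in i X).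

Definition differential f (x : T) : 'rV[R]_n :=
  let i := chart_at A x in
  \row_a 'D_(delta_mx 0 a) (f \o chart_inv i) (chart_map i x).

Definition pairing (p v : 'rV[R]_n) : R := \sum_a p 0 a * v 0 a.

Definition Lie X f : T -> R := fun x => pairing (differential f x) (X x).

Definition Lie_bracket X Y : T -> 'rV[R]_n := fun x =>
  let i := chart_at A x in
  'D_(X x) (vec_in i Y) (chart_map i x) - 'D_(Y x) (vec_in i X) (chart_map i x).

Definition closed_form (w : T -> 'rV[R]_n) : Prop :=
  forall i y, chart_img i setT y -> forall a b : 'I_n,
    'D_(delta_mx 0 a) (fun y => covec_in i w y 0 b) y =
    'D_(delta_mx 0 b) (fun y => covec_in i w y 0 a) y.

Definition pseudo_riemannian (G : T -> 'M[R]_n) : Prop :=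
  [/\ forall x, (G x)^T = G x,
      forall x, G x \in unitmx &
      forall i, analytic_mx_on (chart_img i setT) (form_in i G)].

Definition flat (G : T -> 'M[R]_n) X : T -> 'rV[R]_n := fun x => X x *m G x.

Definition gradient (G : T -> 'M[R]_n) f : T -> 'rV[R]_n :=
  fun x => differential f x *m invmx (G x).

Definition locally_gradient_field (G : T -> 'M[R]_n) X : Prop :=
  closed_form (flat G X).

End Calculus.

Arguments chart_img {R n T A} i W.
Arguments coord_change {R n T} A i j x.

Section Manifold.
Variables (R : realType) (n : nat) (M : topologicalType) (A : atlas R n M).

Definition analytic_manifold : Prop :=
  [/\ hausdorff_space M,
      @second_countable M,
      forall x, chart_dom (chart_at A x) x,
      forall i : chart_idx A,
        [/\ open (chart_dom i), open (chart_img i setT),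
            forall x, chart_dom i x -> chart_inv i (chart_map i x) = x,
            {within chart_dom i, continuous (chart_map i)} &
            {within chart_img i setT, continuous (chart_inv i)}] &
      forall i j : chart_idx A,
        analytic_mx_on (chart_img i (chart_dom j)) (transition i j)].

(* [nabla X Y] is the covariant derivative of [Y] along [X].  Analytic vector
   fields need not extend globally, so the axioms are imposed for fields which
   are analytic on an arbitrary open set; this makes [nabla] local, as one sees
   by multiplying with the indicator function of that open set. *)
Definition affine_connection
    (nabla : (M -> 'rV[R]_n) -> (M -> 'rV[R]_n) -> M -> 'rV[R]_n) : Prop :=
  forall W : set M, open W ->
  forall (X X' Y Y' : M -> 'rV[R]_n) (f : M -> R),
    analytic_field A W X -> analytic_field A W X' ->
    analytic_field A W Y -> analytic_field A W Y' -> analytic_fun A W f ->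
  [/\ analytic_field A W (nabla X Y),
      forall x, W x -> nabla (X + X') Y x = nabla X Y x + nabla X' Y x,
      forall x, W x -> nabla (fun z => f z *: X z) Y x = f x *: nabla X Y x,
      forall x, W x -> nabla X (Y + Y') x = nabla X Y x + nabla X Y' x &
      forall x, W x -> nabla X (fun z => f z *: Y z) x =
        Lie A X f x *: Y x + f x *: nabla X Y x].

Definition torsion_free
    (nabla : (M -> 'rV[R]_n) -> (M -> 'rV[R]_n) -> M -> 'rV[R]_n) : Prop :=
  forall W : set M, open W -> forall X Y : M -> 'rV[R]_n,
    analytic_field A W X -> analytic_field A W Y ->
    forall x, W x -> nabla X Y x - nabla Y X x = Lie_bracket A X Y x.

Definition symmetric_product
    (nabla : (M -> 'rV[R]_n) -> (M -> 'rV[R]_n) -> M -> 'rV[R]_n)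
    (X Y : M -> 'rV[R]_n) : M -> 'rV[R]_n := nabla X Y + nabla Y X.

(* The coordinate vector field d/dx^a of chart [i]. *)
Definition frame (i : chart_idx A) (a : 'I_n) : M -> 'rV[R]_n :=
  fun x => delta_mx 0 a *m coord_change A i (chart_at A x) x.

(* Gamma^c_ab at [x], in the preferred chart of [x]. *)
Definition christoffel
    (nabla : (M -> 'rV[R]_n) -> (M -> 'rV[R]_n) -> M -> 'rV[R]_n)
    (x : M) (a b c : 'I_n) : R :=
  nabla (frame (chart_at A x) a) (frame (chart_at A x) b) x 0 c.

End Manifold.

(* [sys_field S None] is the drift g_0, [sys_field S (Some j)] is g_j. *)

Record affine_system (R : realType) (n : nat) (T J : Type) := AffineSystem {
  sys_field : option J -> T -> 'rV[R]_n;
  sys_output : J -> T -> R }.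

Definition word (J : Type) : Type := (seq (option J) * J)%type.

Section Systems.
Variables (R : realType) (n : nat) (T J : Type) (A : atlas R n T).
Implicit Types (S : affine_system R n T J).

Definition word_fun S (w : word J) : T -> R :=
  foldr (fun i H => Lie A (sys_field S i) H) (sys_output S w.2) w.1.

Definition observation_space S : set (T -> R) :=
  lspan (range (word_fun S) : set (T -> R)).

Definition observation_codistribution S (x : T) : set 'rV[R]_n :=
  lspan [set differential A H x | H in observation_space S].

Definition constant_observation_dim S : Prop :=
  exists r : nat, forall x, has_dim (observation_codistribution S x) r.

Definition locally_gradient_system S : Prop :=
  exists G : T -> 'M[R]_n,
    [/\ pseudo_riemannian A G,
        locally_gradient_field A G (sys_field S None) &
        forall j, sys_field S (Some j) = gradient A G (sys_output S j)].

End Systems.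

Definition weakly_externally_equivalent (R : realType) (n1 n2 : nat)
    (T1 T2 J : Type) (A1 : atlas R n1 T1) (A2 : atlas R n2 T2)
    (S1 : affine_system R n1 T1 J) (S2 : affine_system R n2 T2 J) : Prop :=
  (forall x1, exists x2, forall w, word_fun A1 S1 w x1 = word_fun A2 S2 w x2) /\
  (forall x2, exists x1, forall w, word_fun A1 S1 w x1 = word_fun A2 S2 w x2).

Section Observability.
Variables (R : realType) (n m : nat) (M : topologicalType) (A : atlas R n M).

(* The curve [g] has velocity [v], a tangent vector at [g t], at time [t]. *)
Definition has_velocity (g : R -> M) (t : R) (v : 'rV[R]_n) : Prop :=
  is_derive t 1 (chart_map (chart_at A (g t)) \o g) v.

Definition complete_field (X : M -> 'rV[R]_n) : Prop :=
  forall x, exists g : R -> M,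
    [/\ g 0 = x, continuous g & forall t, has_velocity g t (X (g t))].

Definition control_system (S : affine_system R n M 'I_m) : Prop :=
  (forall i, analytic_field A setT (sys_field S i) /\
             complete_field (sys_field S i)) /\
  (forall j, analytic_fun A setT (sys_output S j)).

(* [s] lists the switching times. *)
Definition admissible_control (U : set 'rV[R]_m) (u : R -> 'rV[R]_m) : Prop :=
  (forall t, 0 <= t -> U (u t)) /\
  exists s : nat -> R,
    [/\ s 0%N = 0, forall k, s k < s k.+1, s k @[k --> \oo] --> +oo &
        forall k t, s k <= t < s k.+1 -> u t = u (s k)].

(* The equation is required at the times around which [u] is constant, that is
   everywhere except at the switching times.  As the fields [g_0 + u g] need not
   be complete, a trajectory is only defined on some [0, tau[. *)
Definition trajectory (S : affine_system R n M 'I_m) (u : R -> 'rV[R]_m)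
    (x : M) (tau : R) (g : R -> M) : Prop :=
  [/\ g 0 = x, {within `[0, tau[, continuous g} &
      forall t, 0 < t < tau -> (\forall s \near t, u s = u t) ->
        has_velocity g t (sys_field S None (g t) +
          \sum_(j < m) u t 0 j *: sys_field S (Some j) (g t))].

Definition indistinguishable (U : set 'rV[R]_m) (S : affine_system R n M 'I_m)
    (x1 x2 : M) : Prop :=
  forall u, admissible_control U u ->
  forall (tau : R) (g1 g2 : R -> M),
    trajectory S u x1 tau g1 -> trajectory S u x2 tau g2 ->
  forall t, 0 <= t < tau ->
  forall j, sys_output S j (g1 t) = sys_output S j (g2 t).

Definition observable (U : set 'rV[R]_m) (S : affine_system R n M 'I_m) :
    Prop :=
  forall x1 x2, indistinguishable U S x1 x2 -> x1 = x2.

End Observability.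

Section Compatibility.
Variables (R : realType) (n : nat) (M : topologicalType) (J : Type).
Variables (A : atlas R n M) (S : affine_system R n M J).
Variable nabla : (M -> 'rV[R]_n) -> (M -> 'rV[R]_n) -> M -> 'rV[R]_n.

Definition word_field (w : word J) : M -> 'rV[R]_n :=
  foldr (fun i Y => symmetric_product nabla (sys_field S i) Y)
        (sys_field S (Some w.2)) w.1.

Definition symmetric_span : set (M -> 'rV[R]_n) :=
  lspan (range word_field : set (M -> 'rV[R]_n)).

Definition full_rank : Prop :=
  forall x, lspan [set X x | X in symmetric_span] = [set: 'rV[R]_n].

Definition compatible : Prop :=
  (forall w w', Lie A (word_field w) (word_fun A S w') =
                Lie A (word_field w') (word_fun A S w)) /\
  (forall w w' w'',
     Lie A (symmetric_product nabla (word_field w) (word_field w'))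
       (word_fun A S w'') =
     Lie A (word_field w'') (Lie A (word_field w) (word_fun A S w'))).

End Compatibility.

(* Points are pairs (x, v), resp. (x, p), the second entry being expressed in
   the preferred chart of x; every chart of the base induces a bundle chart. *)

Section Bundles.
Variables (R : realType) (n : nat) (T : Type) (A : atlas R n T).

Definition tangent_atlas : atlas R (n + n) (T * 'rV[R]_n) :=
  @Atlas R (n + n) (T * 'rV[R]_n) (chart_idx A)
    (fun i => [set z | chart_dom i z.1])
    (fun i z => row_mx (chart_map i z.1)
                       (z.2 *m coord_change A (chart_at A z.1) i z.1))
    (fun i y => let x := chart_inv i (lsubmx y) in
                (x, rsubmx y *m coord_change A i (chart_at A x) x))
    (fun z => chart_at A z.1).

Definition cotangent_atlas : atlas R (n + n) (T * 'rV[R]_n) :=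
  @Atlas R (n + n) (T * 'rV[R]_n) (chart_idx A)
    (fun i => [set z | chart_dom i z.1])
    (fun i z => row_mx (chart_map i z.1)
                       (z.2 *m (coord_change A i (chart_at A z.1) z.1)^T))
    (fun i y => let x := chart_inv i (lsubmx y) in
                (x, rsubmx y *m (coord_change A (chart_at A x) i x)^T))
    (fun z => chart_at A z.1).

(* V^v, on either bundle. *)
Definition fun_vlift (V : T -> R) : T * 'rV[R]_n -> R := fun z => V z.1.

(* V^c, on the tangent bundle. *)
Definition fun_clift (V : T -> R) : T * 'rV[R]_n -> R :=
  fun z => pairing (differential A V z.1) z.2.

(* V^X, on the cotangent bundle. *)
Definition fun_of_field (X : T -> 'rV[R]_n) : T * 'rV[R]_n -> R :=
  fun z => pairing z.2 (X z.1).

End Bundles.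

Section Lifts.
Variables (R : realType) (n : nat) (M : topologicalType) (A : atlas R n M).

(* The test functions may be local.  Analyticity of the lift is needed for
   uniqueness: the values on the functions [f^c] do not determine the horizontal
   part of a vector on the zero section. *)
Definition is_complete_lift (X : M -> 'rV[R]_n)
    (Z : M * 'rV[R]_n -> 'rV[R]_(n + n)) : Prop :=
  analytic_field (tangent_atlas A) setT Z /\
  forall (W : set M) (f : M -> R), open W -> smooth_fun A W f ->
    forall z, W z.1 ->
      Lie (tangent_atlas A) Z (fun_clift A f) z = fun_clift A (Lie A X f) z.

Definition is_vertical_lift (X : M -> 'rV[R]_n)
    (Z : M * 'rV[R]_n -> 'rV[R]_(n + n)) : Prop :=
  analytic_field (tangent_atlas A) setT Z /\
  forall (W : set M) (f : M -> R), open W -> smooth_fun A W f ->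
    forall z, W z.1 ->
      Lie (tangent_atlas A) Z (fun_clift A f) z = fun_vlift (Lie A X f) z.

(* In both systems [inl j] indexes the input u_j and the output y_j; [inr j]
   indexes u_j^p and y_j^v, resp. u_j^e and y_j^a. *)

Definition is_prolonged_system (m : nat) (S : affine_system R n M 'I_m)
    (Sp : affine_system R (n + n) (M * 'rV[R]_n) ('I_m + 'I_m)) : Prop :=
  [/\ is_complete_lift (sys_field S None) (sys_field Sp None),
      forall j, is_complete_lift (sys_field S (Some j))
                                 (sys_field Sp (Some (inl j))),
      forall j, is_vertical_lift (sys_field S (Some j))
                                 (sys_field Sp (Some (inr j))),
      forall j, sys_output Sp (inl j) = fun_vlift (sys_output S j) &
      forall j, sys_output Sp (inr j) = fun_clift A (sys_output S j)].

Variable nabla : (M -> 'rV[R]_n) -> (M -> 'rV[R]_n) -> M -> 'rV[R]_n.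

(* The matrix of the metric at (x, p) in the bundle chart induced by the
   preferred chart of x, in which (x, p) has fibre coordinates p. *)
Definition riemannian_extension (z : M * 'rV[R]_n) : 'M[R]_(n + n) :=
  block_mx
    (\matrix_(a, b) (- 2 * \sum_c z.2 0 c * christoffel A nabla z.1 a b c))
    1%:M 1%:M 0.

Definition gradient_extension (m : nat) (S : affine_system R n M 'I_m) :
    affine_system R (n + n) (M * 'rV[R]_n) ('I_m + 'I_m) :=
  let grad := gradient (cotangent_atlas A) riemannian_extension in
  @AffineSystem R (n + n) (M * 'rV[R]_n) ('I_m + 'I_m)%type
    (fun i => match i with
       | None => grad (fun_of_field (sys_field S None))
       | Some (inl j) => grad (fun_of_field (sys_field S (Some j)))
       | Some (inr j) => grad (fun_vlift (sys_output S j))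
       end)
    (fun j => match j with
       | inl j => fun_vlift (sys_output S j)
       | inr j => fun_of_field (sys_field S (Some j))
       end).

End Lifts.

(* Main.v *)
(* Both sides of the equivalence follow from the hypotheses.

   Cauchy's estimate gives the iterated derivatives along [g_0, ..., g_m] of all
   the [V_w] one common radius, so that Taylor remainders vanish along
   trajectories, and indistinguishability means that all the [V_w] agree: by
   observability they separate points.  If the [d V_w] spanned less than the
   cotangent space, a field annihilated by all of them would exist locally, as
   [dim dH] is constant, and a limit of Euler polygons along it would yield two
   points with the same [V_w].  Hence the [d V_w] span every cotangent space.

   With (a), the full rank of [S_0] then gives a unique symmetric invertible
   [G] with [d V_w = G R_w], in particular [g_j = grad V_j]; (b) says that
   [nabla] is the Levi-Civita connection of [G], and (a) for words beginning
   with [g_0] that [G g_0] is closed.  On the other side the iterated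
   derivatives of the outputs of the prolonged system are [0] or lifts
   [V_w^v], [V_w^c], those of the gradient extension are correspondingly [0],
   [V_w^v] or [V^{R_w}], and [(x, v) |-> (x, G v)] matches them. *)

From HB Require Import structures.
Require Import Defs.
From mathcomp Require Import all_boot all_order all_algebra.
From mathcomp Require Import all_classical all_reals all_analysis.
From mathcomp Require Import ring lra zify.

Set Implicit Arguments.
Unset Strict Implicit.
Unset Printing Implicit Defensive.

Import Order.TTheory GRing.Theory Num.Theory.
Import numFieldTopology.Exports numFieldNormedType.Exports.

Local Open Scope classical_set_scope.
Local Open Scope ring_scope.

(** The predicate [pser] displays coefficients, radius and an l1 bound, because analyticity restated
    after each derivation would let the radius shrink with the length of the word. With visible
    constants a word of length [N] costs a factor [K^N N!], just what makes iterated integrals along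
    a trajectory decay on a short time interval. Such intervals are chained by looking at the
    infimum of the times of disagreement.

    The metric is fixed pointwise on a basis of fields [R_w], and is analytic because the same words
    give a basis nearby. The quantity [torsion_term] measures the gap between [nabla] and the
    Levi-Civita connection. One identity expresses the curl of [Y] lowered by [G] as a contraction
    of [Y] with this gap; for [Y = R_w] it kills the gap, and for [Y = g_0] it then closes the
    drift.

    The lifts to the tangent bundle are given by their action on the functions [f^c], which says
    nothing about the base component over the zero section. Applying the definition to [f^2]
    recovers that component wherever [f^c] does not vanish, and continuity of the lift extends it to
    the whole fibre. *)

Section MultiIndex.
Variables (R : realType) (n : nat).
Local Notation mi := {ffun 'I_n -> nat}.
Implicit Types (c d : mi -> R) (k l : mi) (a x y : 'rV[R]_n).

(** * Absolutely convergent power series in several variables *)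

Lemma sum_uniq_sub (T : eqType) (s1 s2 : seq T) (F : T -> R) :
  uniq s1 -> uniq s2 -> {subset s1 <= s2} ->
  (forall i, i \in s2 -> i \notin s1 -> F i = 0) ->
  \sum_(i <- s2) F i = \sum_(i <- s1) F i.
Proof.
move=> u1 u2 s12 F0; rewrite (bigID (mem s1)) /= [X in _ + X]big1_seq ?addr0.
  rewrite -big_filter; apply: perm_big; apply: uniq_perm => //.
    exact: filter_uniq.
  move=> i; rewrite mem_filter; apply: andb_idr; exact: s12.
by move=> i /andP[i1 i2]; exact: F0.
Qed.

Lemma ler_sum_uniq_sub (T : eqType) (s1 s2 : seq T) (F : T -> R) :
  uniq s1 -> uniq s2 -> {subset s1 <= s2} -> (forall i, 0 <= F i) ->
  \sum_(i <- s1) F i <= \sum_(i <- s2) F i.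
Proof.
move=> u1 u2 s12 F0; rewrite [leRHS](bigID (mem s1)) /=.
rewrite -[X in _ <= X + _]big_filter [X in _ <= X + _](perm_big s1) /=.
  by rewrite lerDl sumr_ge0.
apply: uniq_perm => //; first exact: filter_uniq.
move=> i; rewrite mem_filter; apply: andb_idr; exact: s12.
Qed.

Lemma cvgn_ler (u : R^nat) (l C : R) :
  u @ \oo --> l -> (forall N, u N <= C) -> l <= C.
Proof.
move=> ul uC; rewrite -(cvg_lim (@Rhausdorff R) ul).
by apply: limr_le; [apply/cvg_ex; exists l | apply: nearW].
Qed.

Definition midx N (k : {ffun 'I_n -> 'I_N}) : mi := [ffun i => k i : nat].
(** A duplicate-free sequence of exponents with values in [nat], so that boxes of different sizes
    share one index type and can be compared. *)
Definition box N : seq mi := [seq midx k | k : {ffun 'I_n -> 'I_N}].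
Definition mdeg k : nat := (\sum_(i < n) k i)%N.
Definition madd k l : mi := [ffun i => (k i + l i)%N].
Definition munit (b : 'I_n) : mi := [ffun i => (i == b) : nat].
Definition mono k y : R := \prod_(i < n) y 0 i ^+ k i.

Lemma midx_inj N : injective (@midx N).
Proof.
by move=> k l /ffunP kl; apply/ffunP => i; apply/val_inj; move: (kl i); rewrite !ffunE.
Qed.

Lemma box_uniq N : uniq (box N).
Proof. by rewrite map_inj_uniq ?enum_uniq//; exact: midx_inj. Qed.

Lemma mem_box N k : (k \in box N) = [forall i, k i < N]%N.
Proof.
apply/mapP/forallP => [[l _ ->] i|kN]; first by rewrite ffunE.
exists [ffun i => Ordinal (kN i)]; first by rewrite mem_enum.
by apply/ffunP => i; rewrite !ffunE.
Qed.

Lemma mem_boxS N N' k : (N <= N')%N -> k \in box N -> k \in box N'.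
Proof.
by move=> NN'; rewrite !mem_box => /forallP h; apply/forallP => i; apply: leq_trans (h i) NN'.
Qed.

Lemma mem_box_mdeg k : k \in box (mdeg k).+1.
Proof.
rewrite mem_box; apply/forallP => i; rewrite ltnS /mdeg (bigD1 i)//=.
exact: leq_addr.
Qed.

Lemma mdegD k l : mdeg (madd k l) = (mdeg k + mdeg l)%N.
Proof. by rewrite /mdeg -big_split; apply: eq_bigr => i _; rewrite ffunE. Qed.

Lemma mdeg_unit b : mdeg (munit b) = 1%N.
Proof.
rewrite /mdeg (bigD1 b)//= ffunE eqxx big1 ?addn0// => i ib.
by rewrite ffunE (negbTE ib).
Qed.

Lemma monoD k l y : mono (madd k l) y = mono k y * mono l y.
Proof. by rewrite /mono -big_split; apply: eq_bigr => i _; rewrite ffunE exprD. Qed.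

Lemma mono_const k s : mono k (const_mx s) = s ^+ mdeg k.
Proof.
rewrite /mono /mdeg -prodrXr.
by apply: eq_bigr => i _; rewrite mxE.
Qed.

Lemma normr_mono k y s : (forall i, `|y 0 i| <= s) -> `|mono k y| <= s ^+ mdeg k.
Proof.
move=> ys; rewrite -mono_const normr_prod; apply: ler_prod => i _.
by rewrite normr_ge0 normrX mxE lerXn2r// ?nnegrE// (le_trans _ (ys i)).
Qed.

Lemma power_psumE c a N x :
  power_psum c a N x = \sum_(k <- box N) c k * mono k (x - a).
Proof.
rewrite /power_psum big_map big_enum /=; apply: eq_bigr => k _.
by congr (_ * _); apply: eq_bigr => i _; rewrite !mxE ffunE.
Qed.

(** The truncated weighted l1 norm of the coefficients. It majorises the partial sums on the
    polydisc of radius [s], is monotone in [N] and submultiplicative for the Cauchy product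
    ([wsum_conv]); convergence questions are reduced to it. *)
Definition wsum c s N : R := \sum_(k <- box N) `|c k| * s ^+ mdeg k.

Lemma wsum_ge0 c s N : 0 <= s -> 0 <= wsum c s N.
Proof. by move=> s0; apply: sumr_ge0 => k _; rewrite mulr_ge0// exprn_ge0. Qed.

Lemma wsum_ndecr c s N N' : 0 <= s -> (N <= N')%N -> wsum c s N <= wsum c s N'.
Proof.
move=> s0 NN'; apply: ler_sum_uniq_sub; rewrite ?box_uniq//.
  by move=> k; exact: mem_boxS.
by move=> k; rewrite mulr_ge0// exprn_ge0.
Qed.

Lemma wsum_s c s s' N : 0 <= s' <= s -> wsum c s' N <= wsum c s N.
Proof.
move=> /andP[s0 ss]; apply: ler_sum => k _; rewrite ler_wpM2l// lerXn2r// nnegrE//.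
exact: le_trans ss.
Qed.

Lemma wsum_geom rho N : wsum (fun=> 1) rho N = (\sum_(j < N) rho ^+ j) ^+ n.
Proof.
rewrite -[X in _ ^+ X](card_ord n) -prodr_const bigA_distr_bigA /=.
rewrite /wsum big_map big_enum /=; apply: eq_bigr => k _.
rewrite normr1 mul1r /mdeg -prodrXr.
by apply: eq_bigr => i _; rewrite ffunE.
Qed.

Lemma le_coef_wsum c s C k : 0 <= s -> (forall N, wsum c s N <= C) ->
  `|c k| * s ^+ mdeg k <= C.
Proof.
move=> s0 /(_ (mdeg k).+1); apply: le_trans; rewrite /wsum.
rewrite (bigD1_seq k) ?box_uniq ?mem_box_mdeg//= lerDl sumr_ge0// => l _.
by rewrite mulr_ge0// exprn_ge0.
Qed.

Lemma geom_le (q : R) N : 0 <= q < 1 -> \sum_(j < N) q ^+ j <= (1 - q)^-1.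
Proof.
move=> /andP[q0 q1]; have q1' : 0 < 1 - q by rewrite subr_gt0.
rewrite -(ler_pM2l q1') mulfV ?gt_eqF//.
suff -> : (1 - q) * (\sum_(j < N) q ^+ j) = 1 - q ^+ N by rewrite gerBl exprn_ge0.
by rewrite -[1 - q]opprB mulNr -subrX1 opprB.
Qed.

(** Each weight at radius [s] is at most [C (s/r)^|k|], and the sum over a box is then a product of
    [n] geometric sums. This passes from the coefficient bound of [analytic_at] to an l1 bound on a
    smaller polydisc. *)
Lemma wsum_coef_bound c (s r C : R) : 0 < s -> s < r ->
  (forall k, `|c k| * r ^+ mdeg k <= C) ->
  forall N, wsum c s N <= C * (1 - s / r)^-1 ^+ n.
Proof.
move=> s0 sr cC N; have r0 := lt_trans s0 sr.
have C0 : 0 <= C by apply: le_trans (cC [ffun=> 0%N]); rewrite mulr_ge0// exprn_ge0 ?ltW.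
have q0 : 0 <= s / r by rewrite divr_ge0// ltW.
have q1 : s / r < 1 by rewrite ltr_pdivrMr// mul1r.
apply: (@le_trans _ _ (C * wsum (fun=> 1) (s / r) N)).
  rewrite /wsum mulr_sumr; apply: ler_sum => k _; rewrite normr1 mul1r.
  rewrite -{1}[s](divfK (lt0r_neq0 r0)) exprMn mulrA mulrAC.
  by rewrite ler_wpM2r// exprn_ge0.
rewrite ler_wpM2l// wsum_geom lerXn2r// ?nnegrE.
- by apply: sumr_ge0 => j _; rewrite exprn_ge0.
- by rewrite invr_ge0 subr_ge0 ltW.
- by rewrite geom_le// q0.
Qed.

Definition polydisc a s : set 'rV[R]_n := [set x | forall i, `|x 0 i - a 0 i| <= s].

(** Analyticity with its data exposed: the closed polydisc, the coefficients and a bound [C] of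
    their weighted norm. The later estimates count how [s] and [C] change under each operation. *)
Definition pser (f : 'rV[R]_n -> R) a s c C : Prop :=
  [/\ 0 < s, forall N, wsum c s N <= C &
      forall x, polydisc a s x -> power_psum c a N x @[N --> \oo] --> f x].

Lemma psum_le_wsum c a s N x : polydisc a s x -> `|power_psum c a N x| <= wsum c s N.
Proof.
move=> xs; rewrite power_psumE (le_trans (ler_norm_sum _ _ _))//.
apply: ler_sum => k _; rewrite normrM ler_wpM2l// normr_mono// => i.
by rewrite !mxE.
Qed.

Lemma psumB_le_wsum c a s N N' x : 0 <= s -> polydisc a s x -> (N <= N')%N ->
  `|power_psum c a N' x - power_psum c a N x| <= wsum c s N' - wsum c s N.
Proof.
move=> s0 xs NN'.
have split_box (F : mi -> R) : \sum_(k <- box N') F k =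
   \sum_(k <- box N) F k + \sum_(k <- box N' | k \notin box N) F k.
  rewrite (bigID (mem (box N))) /=; congr (_ + _).
  rewrite big_mkcond /= (@sum_uniq_sub _ (box N)) ?box_uniq//.
  - by apply: eq_big_seq => k ->.
  - by move=> k; exact: mem_boxS.
  - by move=> k _ /negbTE ->.
rewrite !power_psumE /wsum !(split_box) [X in `|X|]addrAC subrr add0r.
rewrite [leRHS]addrAC subrr add0r (le_trans (ler_norm_sum _ _ _))//.
apply: ler_sum => k _; rewrite normrM ler_wpM2l// normr_mono// => i.
by rewrite !mxE.
Qed.

Lemma wsum_is_cvg c s C : 0 <= s -> (forall N, wsum c s N <= C) -> cvgn (wsum c s).
Proof.
move=> s0 cC; apply: nondecreasing_is_cvgn.
  by move=> N N' NN'; exact: wsum_ndecr.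
by exists C => _ [N _ <-].
Qed.

Lemma pser_bound f a s c C x : pser f a s c C -> polydisc a s x -> `|f x| <= C.
Proof.
move=> [s0 cC cf] xs; apply: (@cvgn_ler (fun N => `|power_psum c a N x|)).
  by apply: cvg_norm; exact: cf.
by move=> N; apply: le_trans (cC N); exact: psum_le_wsum.
Qed.

Lemma wsum_cauchy c s C : 0 <= s -> (forall N, wsum c s N <= C) ->
  forall e, 0 < e -> exists N0, forall N N', (N0 <= N)%N -> (N <= N')%N ->
    wsum c s N' - wsum c s N <= e.
Proof.
move=> s0 cC e e0; have cv := wsum_is_cvg s0 cC.
have nd : {homo wsum c s : N N' / (N <= N')%N >-> N <= N'}.
  by move=> N N'; exact: wsum_ndecr.
have := cv => /cvgrPdist_le /(_ e e0)[N0 _ hN0].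
exists N0 => N N' N0N NN'; have := hN0 N N0N.
rewrite ler_norml => /andP[_]; have := nondecreasing_cvgn_le nd cv N'; lra.
Qed.

Lemma pser_exists c a s C : 0 < s -> (forall N, wsum c s N <= C) ->
  exists f, pser f a s c C.
Proof.
move=> s0 cC.
have cv x : polydisc a s x -> cvgn (fun N => power_psum c a N x).
  move=> xs.
  (* Increments of the partial sums are dominated by those of [wsum], so adding [wsum] makes the
     sequence nondecreasing and bounded. *)
  have -> : (fun N => power_psum c a N x) =
      (fun N => (power_psum c a N x + wsum c s N) - wsum c s N).
    by apply/funext => N; rewrite addrK.
  apply: is_cvgB; last exact: (wsum_is_cvg (ltW s0) cC).
  apply: nondecreasing_is_cvgn.
    move=> N N' NN'; have := psumB_le_wsum c (ltW s0) xs NN'.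
    by rewrite ler_norml => /andP[+ _]; lra.
  exists (C + C) => _ [N _ <-].
  have := psum_le_wsum c N xs; rewrite ler_norml => /andP[_].
  by have := cC N; lra.
by exists (fun x => limn (fun N => power_psum c a N x)); split => // x /cv.
Qed.

Lemma pser_uniq f g a s c C D x : pser f a s c C -> pser g a s c D ->
  polydisc a s x -> f x = g x.
Proof.
move=> [_ _ cf] [_ _ cg] xs.
exact: (cvg_unique (@Rhausdorff R) (cf _ xs) (cg _ xs)).
Qed.

Lemma polydisc_sub a s s' : s' <= s -> polydisc a s' `<=` polydisc a s.
Proof. by move=> ss x xs i; exact: le_trans (xs i) ss. Qed.

Lemma pser_shrink f a s s' c C : 0 < s' -> s' <= s ->
  pser f a s c C -> pser f a s' c C.
Proof.
move=> s'0 ss [s0 cC cf]; split=> //.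
  by move=> N; rewrite (le_trans (wsum_s _ _ _) (cC N))// ltW.
by move=> x xs; apply: cf; exact: polydisc_sub xs.
Qed.

Lemma pser_le f a s c C D : C <= D -> pser f a s c C -> pser f a s c D.
Proof. by move=> CD [s0 cC cf]; split=> // N; exact: le_trans (cC N) CD. Qed.

Lemma pser_ext f g a s c C : (forall x, polydisc a s x -> f x = g x) ->
  pser f a s c C -> pser g a s c C.
Proof. by move=> fg [s0 cC cf]; split=> // x xs; rewrite -fg//; exact: cf. Qed.

Lemma pserD f g a s c d C D : pser f a s c C -> pser g a s d D ->
  pser (fun x => f x + g x) a s (fun k => c k + d k) (C + D).
Proof.
move=> [s0 cC cf] [_ dD dg]; split=> //.
  move=> N; apply: le_trans (lerD (cC N) (dD N)).
  rewrite /wsum -big_split; apply: ler_sum => k _ /=; rewrite -mulrDl.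
  by rewrite ler_wpM2r ?ler_normD// exprn_ge0 ?ltW.
move=> x xs; rewrite (_ : (fun N => _) =
    (fun N => power_psum c a N x + power_psum d a N x)).
  by apply: cvgD; [exact: cf|exact: dg].
apply/funext => N; rewrite !power_psumE -big_split.
by apply: eq_bigr => k _; rewrite mulrDl.
Qed.

Lemma pserZ f a s c C e : pser f a s c C ->
  pser (fun x => e * f x) a s (fun k => e * c k) (`|e| * C).
Proof.
move=> [s0 cC cf]; split=> //.
  move=> N; rewrite (_ : wsum _ _ _ = `|e| * wsum c s N) ?ler_wpM2l//.
  by rewrite /wsum mulr_sumr; apply: eq_bigr => k _; rewrite normrM mulrA.
move=> x xs; rewrite (_ : (fun N => _) = (fun N => e * power_psum c a N x)).
  by apply: cvgMr; exact: cf.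
apply/funext => N; rewrite !power_psumE mulr_sumr.
by apply: eq_bigr => k _; rewrite mulrA.
Qed.

Definition midx0 : mi := [ffun=> 0%N].

Lemma mono0 y : mono midx0 y = 1.
Proof. by rewrite /mono big1// => i _; rewrite ffunE expr0. Qed.

Lemma mdeg0 : mdeg midx0 = 0%N.
Proof. by rewrite /mdeg big1// => i _; rewrite ffunE. Qed.

Lemma box_sum1 (F : mi -> R) l N : l \in box N ->
  \sum_(k <- box N) (k == l)%:R * F k = F l.
Proof.
move=> lN; rewrite (bigD1_seq l) ?box_uniq//= eqxx mul1r big1 ?addr0//.
by move=> k /negbTE ->; rewrite mul0r.
Qed.

Lemma pser_mono l a s : 0 < s ->
  pser (fun x => mono l (x - a)) a s (fun k => (k == l)%:R) (s ^+ mdeg l).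
Proof.
move=> s0; split=> //.
  move=> N; have [lN|lN] := boolP (l \in box N).
    rewrite /wsum; under eq_bigr do rewrite ger0_norm ?ler0n//.
    by rewrite box_sum1.
  rewrite /wsum big1_seq ?exprn_ge0 ?ltW// => k /andP[_ kN].
  case: eqVneq => [kl|_]; last by rewrite normr0 mul0r.
  by move: lN; rewrite -kl kN.
move=> x xs; apply: cvg_near_cst; exists (mdeg l).+1 => // N /= lN.
by rewrite power_psumE box_sum1// (mem_boxS lN)// mem_box_mdeg.
Qed.

Lemma pser_cst e a s : 0 < s ->
  pser (fun=> e) a s (fun k => e * (k == midx0)%:R) `|e|.
Proof.
move=> s0; have := pserZ e (pser_mono midx0 a s0).
rewrite mdeg0 expr0 mulr1; apply: pser_ext => x _; by rewrite mono0 mulr1.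
Qed.

(** The Cauchy product. The box of side [|k| + 1] contains every pair of exponents adding up to [k];
    by [convE] any box containing [k] would give the same value. *)
Definition mconv c d k : R :=
  \sum_(i <- box (mdeg k).+1) \sum_(j <- box (mdeg k).+1 | madd i j == k) c i * d j.

Lemma madd_box i j N : madd i j \in box N -> i \in box N /\ j \in box N.
Proof.
rewrite !mem_box => /forallP ij; split; apply/forallP => l; have := ij l;
  rewrite ffunE; lia.
Qed.

Lemma conv_sub c d k N N' : (N <= N')%N -> k \in box N ->
  \sum_(i <- box N') \sum_(j <- box N' | madd i j == k) c i * d j =
  \sum_(i <- box N) \sum_(j <- box N | madd i j == k) c i * d j.
Proof.
move=> NN' kN; rewrite (@sum_uniq_sub _ (box N)) ?box_uniq//.
- apply: eq_bigr => i _; rewrite big_mkcond [RHS]big_mkcond /=.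
  rewrite (@sum_uniq_sub _ (box N)) ?box_uniq//; first by move=> j; exact: mem_boxS.
  move=> j _ jN; case: eqP => // ijk; move: kN; rewrite -ijk => /madd_box[_].
  by rewrite (negbTE jN).
- by move=> j; exact: mem_boxS.
move=> i _ iN; rewrite big1// => j /eqP ijk; move: kN; rewrite -ijk => /madd_box[].
by rewrite (negbTE iN).
Qed.

Lemma convE c d k N : k \in box N ->
  mconv c d k = \sum_(i <- box N) \sum_(j <- box N | madd i j == k) c i * d j.
Proof.
move=> kN; have kk := mem_box_mdeg k.
rewrite -(conv_sub c d (leq_maxl N (mdeg k).+1) kN).
by rewrite (conv_sub c d (leq_maxr N (mdeg k).+1) kk).
Qed.

Lemma sum_conv c d N y :
  \sum_(k <- box N) mconv c d k * mono k y =
  \sum_(i <- box N) \sum_(j <- box N | madd i j \in box N)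
     (c i * mono i y) * (d j * mono j y).
Proof.
under eq_big_seq => k kN do rewrite (convE _ _ kN) mulr_suml.
rewrite exchange_big; apply: eq_bigr => i _ /=.
under eq_bigr do rewrite mulr_suml big_mkcond.
rewrite exchange_big [RHS]big_mkcond; apply: eq_bigr => j _ /=.
case: ifPn => [ij|ij].
  rewrite -(box_sum1 (fun k => c i * mono i y * (d j * mono j y)) ij).
  apply: eq_bigr => k _; rewrite eq_sym; case: eqVneq => [->|_].
    by rewrite mul1r monoD mulrACA.
  by rewrite mul0r.
rewrite big1_seq// => k /andP[_ kN]; case: eqVneq => // ijk.
by move: ij; rewrite ijk kN.
Qed.

Lemma mulr_double_sum (T : Type) (s : seq T) (F G : T -> R) :
  (\sum_(i <- s) F i) * (\sum_(j <- s) G j) = \sum_(i <- s) \sum_(j <- s) F i * G j.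
Proof. by rewrite mulr_suml; apply: eq_bigr => i _; rewrite mulr_sumr. Qed.

Lemma wsum_conv c d s N : 0 <= s -> wsum (mconv c d) s N <= wsum c s N * wsum d s N.
Proof.
move=> s0; apply: (@le_trans _ _
  (\sum_(k <- box N) mconv (fun i => `|c i|) (fun i => `|d i|) k * mono k (const_mx s))).
  apply: ler_sum => k _; rewrite mono_const ler_wpM2r ?exprn_ge0//.
  rewrite (le_trans (ler_norm_sum _ _ _))//; apply: ler_sum => i _.
  rewrite (le_trans (ler_norm_sum _ _ _))//; apply: ler_sum => j _.
  by rewrite normrM.
rewrite sum_conv mulr_double_sum; apply: ler_sum => i _.
rewrite [leLHS]big_mkcond /=; apply: ler_sum => j _.
by rewrite !mono_const; case: ifP => // _; rewrite !mulr_ge0// exprn_ge0.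
Qed.

(* Only the pairs of exponents whose sum leaves the box contribute, and these
   do not occur in the box of half the size. *)
Lemma psum_conv_diff c d a s N x : 0 <= s -> polydisc a s x ->
  `|power_psum c a N x * power_psum d a N x - power_psum (mconv c d) a N x| <=
  wsum c s N * wsum d s N - wsum c s N./2 * wsum d s N./2.
Proof.
move=> s0 xs; rewrite !power_psumE mulr_double_sum sum_conv -sumrB.
set y := x - a.
have yb i : `|y 0 i| <= s by rewrite !mxE.
pose W i j : R := (`|c i| * s ^+ mdeg i) * (`|d j| * s ^+ mdeg j).
have W0 i j : 0 <= W i j by rewrite !mulr_ge0// exprn_ge0.
apply: (@le_trans _ _ (\sum_(i <- box N) \sum_(j <- box N | madd i j \notin box N) W i j)).
  rewrite (le_trans (ler_norm_sum _ _ _))//; apply: ler_sum => i _.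
  rewrite [X in `|X - _|](bigID (fun j => madd i j \in box N)) /= addrAC subrr add0r.
  rewrite (le_trans (ler_norm_sum _ _ _))//; apply: ler_sum => j _.
  by rewrite !normrM ler_pM ?mulr_ge0// ler_wpM2l// normr_mono.
rewrite lerBrDr /wsum !mulr_double_sum.
have -> : \sum_(i <- box N) \sum_(j <- box N) W i j =
    \sum_(i <- box N) \sum_(j <- box N | madd i j \notin box N) W i j +
    \sum_(i <- box N) \sum_(j <- box N | madd i j \in box N) W i j.
  rewrite -big_split; apply: eq_bigr => i _ /=.
  by rewrite (bigID (fun j => madd i j \in box N)) addrC.
rewrite lerD2l.
have h2 : (N./2 <= N)%N by rewrite -divn2 leq_div.
apply: (@le_trans _ _ (\sum_(i <- box N./2) \sum_(j <- box N | madd i j \in box N) W i j)).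
  rewrite big_seq_cond [leRHS]big_seq_cond; apply: ler_sum => i /andP[iN _].
  apply: (@le_trans _ _ (\sum_(j <- box N./2 | madd i j \in box N) W i j)).
    rewrite [leRHS]big_mkcond /= big_seq_cond [leRHS]big_seq_cond.
    apply: ler_sum => j /andP[jN _]; rewrite ifT//.
    move: iN jN; rewrite !mem_box => /forallP iN /forallP jN; apply/forallP => l.
    by have := iN l; have := jN l; rewrite ffunE; lia.
  rewrite big_mkcond [leRHS]big_mkcond /=; apply: ler_sum_uniq_sub; rewrite ?box_uniq//.
    by move=> j; exact: mem_boxS.
  by move=> j; case: ifP.
apply: ler_sum_uniq_sub; rewrite ?box_uniq//.
  by move=> j; exact: mem_boxS.
by move=> i; apply: sumr_ge0.
Qed.

Lemma cvgn_half (u : R^nat) (l : R) : u @ \oo --> l -> u N./2 @[N --> \oo] --> l.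
Proof.
move=> /cvgrPdist_le ul; apply/cvgrPdist_le => e /ul [N0 _ hN].
exists N0.*2 => // N /= NN; apply: hN => /=; lia.
Qed.

Lemma pserM f g a s c d C D : pser f a s c C -> pser g a s d D ->
  pser (fun x => f x * g x) a s (mconv c d) (C * D).
Proof.
move=> [s0 cC cf] [_ dD dg]; have s0' := ltW s0; split=> //.
  move=> N; apply: le_trans (wsum_conv _ _ _ s0') _.
  by apply: ler_pM; rewrite ?wsum_ge0.
move=> x xs.
have /cvg_ex[/= lc hc] := wsum_is_cvg s0' cC.
have /cvg_ex[/= ld hd] := wsum_is_cvg s0' dD.
have hl : (fun N => wsum c s N * wsum d s N) @ \oo --> lc * ld.
  by apply: cvgM.
(* The bound of [psum_conv_diff] is a difference of two sequences with the same limit. *)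
have h0 : (wsum c s N * wsum d s N - wsum c s N./2 * wsum d s N./2)
    @[N --> \oo] --> (0 : R).
  rewrite -(subrr (lc * ld)); apply: cvgB; first exact: hl.
  exact: (@cvgn_half (fun N => wsum c s N * wsum d s N) _ hl).
have h1 : (power_psum c a N x * power_psum d a N x - power_psum (mconv c d) a N x)
    @[N --> \oo] --> (0 : R).
  apply/cvgr0Pnorm_le => e e0; have /cvgrPdist_le/(_ e e0) := h0.
  apply: filterS => N; rewrite sub0r normrN => hN.
  by rewrite (le_trans (psum_conv_diff c d N s0' xs))// (le_trans (ler_norm _)).
have hfg : (fun N => power_psum c a N x * power_psum d a N x) @ \oo --> f x * g x.
  by apply: cvgM; [exact: cf|exact: dg].
rewrite -[f x * g x]subr0 (_ : (fun N => _) = (fun N => power_psum c a N x * power_psum d a N x -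
  (power_psum c a N x * power_psum d a N x - power_psum (mconv c d) a N x))).
  by apply: cvgB.
by apply/funext => N; rewrite subKr.
Qed.

End MultiIndex.

(** * Differentiability from a quadratic remainder estimate *)

Section Differentiability.
Variables (R : realType) (n : nat).

Lemma normr_coord (h : 'rV[R]_n) i : `|h 0 i| <= `|h|.
Proof.
by rewrite [leRHS]/Num.Def.normr/= mx_normrE; exact: (le_bigmax _ _ (ord0, i)).
Qed.

Lemma normr_row_le (h : 'rV[R]_n) e : 0 <= e -> (forall i, `|h 0 i| <= e) -> `|h| <= e.
Proof.
move=> e0 he; rewrite /Num.Def.normr/= mx_normrE; apply: bigmax_le => // -[i j] _ /=.
by rewrite ord1.
Qed.

Lemma normr_pairing (h g : 'rV[R]_n) : `|pairing h g| <= (\sum_a `|g 0 a|) * `|h|.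
Proof.
rewrite (le_trans (ler_norm_sum _ _ _))// mulr_suml; apply: ler_sum => a _.
by rewrite normrM mulrC ler_wpM2l// normr_coord.
Qed.

Lemma diff_of_remainder (V W : normedModType R) (f : V -> W) (df : {linear V -> W}) x :
  continuous df ->
  (forall e, 0 < e -> \forall h \near (0 : V), `|f (h + x) - f x - df h| <= e * `|h|) ->
  differentiable f x /\ 'd f x = df :> (V -> W).
Proof.
move=> dfc fe.
have dfo : f \o shift x = cst (f x) + df +o_ 0 id.
  apply/(@eqaddoP R) => e /fe; apply: filterS => h.
  by rewrite /= !fctE /= opprD addrA.
have dE := diff_unique dfc dfo; split => //.
by apply/diff_locallyP; rewrite dE.
Qed.

Lemma near_eq_differentiable (V W : normedModType R) (f g : V -> W) (x : V) :
  (\forall z \near x, f z = g z) -> differentiable f x -> differentiable g x.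
Proof.
move=> fg fx; have := diff_locally fx => /(@eqaddoP R) fo.
apply: (proj1 (@diff_of_remainder _ _ g ('d f x) x (diff_continuous fx) _)).
move=> e /fo fe; have fgx := nbhs_singleton fg.
have fg0 : \forall h \near (0 : V), f (h + x) = g (h + x).
  by have := fg; rewrite (near_shift 0); apply: filterS => h /=; rewrite subr0.
apply: filterS2 fe fg0 => h; rewrite /= !fctE /= opprD addrA => + <-.
by rewrite -fgx.
Qed.

Lemma diff_of_quadratic (f : 'rV[R]_n -> R) (x g : 'rV[R]_n) (K e : R) : 0 < e ->
  (forall h : 'rV[R]_n, `|h| <= e ->
     `|f (x + h) - f x - pairing h g| <= K * `|h| ^+ 2) ->
  differentiable f x /\ forall h, 'd f x h = pairing h g.
Proof.
move=> e0 fK.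
have lin : linear (fun h : 'rV[R]_n => pairing h g : R).
  move=> t u v; rewrite /pairing scaler_sumr -big_split; apply: eq_bigr => a _ /=.
  by rewrite !mxE mulrDl -mulrA.
pose dfM := GRing.isLinear.Build _ _ _ _ _ lin.
pose df : {linear 'rV[R]_n -> R} := HB.pack (fun h : 'rV[R]_n => pairing h g : R) dfM.
have dfc : continuous df.
  apply: bounded_linear_continuous; apply/linear_boundedP.
  near=> r => h; apply: le_trans (normr_pairing h g) _.
  by rewrite ler_wpM2r//; near: r; exact: nbhs_pinfty_ge.
have [fx dE] : differentiable f x /\ 'd f x = df :> (_ -> _).
  apply: diff_of_remainder => // eps eps0.
  have M0 : 0 < `|K| + 1 by rewrite ltr_wpDl.
  near=> h; rewrite [h + x]addrC.
  have he : `|h| <= e.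
    by near: h; exact: (@nbhs0_le _ ('rV[R]_n : normedModType R)).
  apply: le_trans (fK h he) _; rewrite expr2 mulrA ler_wpM2r//.
  apply: (@le_trans _ _ ((`|K| + 1) * `|h|)).
    by rewrite ler_wpM2r// (le_trans (ler_norm _))// lerDl.
  rewrite -ler_pdivlMl//; near: h; apply: (@nbhs0_le _ ('rV[R]_n : normedModType R)).
  by rewrite mulr_gt0// invr_gt0.
by split=> // h; rewrite dE.
Unshelve. all: by end_near. Qed.

Lemma derive_delta (f : 'rV[R]_n -> R) (x h : 'rV[R]_n) : differentiable f x ->
  'd f x h = \sum_a h 0 a * 'D_(delta_mx 0 a) f x.
Proof.
move=> df; rewrite [in LHS](row_sum_delta h) linear_sum; apply: eq_bigr => a _.
by rewrite linearZ deriveE.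
Qed.

End Differentiability.

(** * First-order Taylor remainders by majorant polynomials *)

Section MonomialTaylor.
Variable R : realType.
Implicit Types p q P Q : {poly R}.

(** Used for the restriction of a monomial to the line [y + X h], a polynomial in the single
    variable [X]. *)
Definition majorized p P := forall j, `|p`_j| <= P`_j.

Lemma majorizedM p q P Q : majorized p P -> majorized q Q -> majorized (p * q) (P * Q).
Proof.
move=> pP qQ j; rewrite !coefM (le_trans (ler_norm_sum _ _ _))//.
by apply: ler_sum => i _; rewrite normrM ler_pM.
Qed.

Lemma majorized1 : majorized 1 1.
Proof. by move=> j; rewrite coef1; case: eqP; rewrite ?normr1 ?normr0. Qed.

Lemma majorizedX p P m : majorized p P -> majorized (p ^+ m) (P ^+ m).
Proof.
move=> pP; elim: m => [|m IH]; first exact: majorized1.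
by rewrite !exprS; exact: majorizedM.
Qed.

Lemma majorized_prod n (p P : 'I_n -> {poly R}) :
  (forall i, majorized (p i) (P i)) ->
  majorized (\prod_(i < n) p i) (\prod_(i < n) P i).
Proof.
move=> pP; elim/big_ind2 : _ => //; first exact: majorized1.
by move=> *; exact: majorizedM.
Qed.

Lemma majorized_lin (y h s e : R) : `|y| <= s -> `|h| <= e ->
  majorized (y%:P + h *: 'X) (s%:P + e *: 'X).
Proof.
move=> ys he j; rewrite !coefD !coefC !coefZ !coefX.
case: j => [|[|j]] /=; rewrite ?mulr0 ?addr0 ?mulr1 ?add0r ?normr0//.
Qed.

(** At 1 the left side is the sum of the coefficients of degree [j >= 2], and there
    [P_j <= t^-2 P_j t^j] because [t >= 1]. The scale [t] stays free, to be taken later as large as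
    the radius allows. *)
Lemma majorized_tail p P t : 1 <= t -> majorized p P ->
  `|p.[1] - p`_0 - p`_1| <= (t ^- 2) * P.[t].
Proof.
move=> t1 pP; have t0 : 0 < t by rewrite (lt_le_trans ltr01).
have P0 j : 0 <= P`_j by apply: le_trans (pP j).
pose N := maxn (size p) (size P).
have pN : (size p <= N.+2)%N by rewrite /N; lia.
have PN : (size P <= N.+2)%N by rewrite /N; lia.
rewrite (horner_coef_wide _ pN) (horner_coef_wide _ PN).
rewrite !big_ord_recl /= !expr1n !mulr1.
rewrite [X in `|X - _ - _|]addrC addrK [X in `|X - _|]addrC addrK.
rewrite (le_trans (ler_norm_sum _ _ _))// !mulrDr addrA.
apply: (@le_trans _ _ (t ^- 2 * \sum_(i < N) P`_(bump 0 (bump 0 i)) * t ^+ bump 0 (bump 0 i))).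
  rewrite mulr_sumr; apply: ler_sum => i _; rewrite expr1n mulr1 mulrCA.
  apply: le_trans (pP _) _; rewrite ler_peMr//.
  by rewrite /bump !leq0n !add1n -(add2n i) exprD mulKf ?exprn_ege1 ?expf_neq0 ?gt_eqF.
by rewrite lerDr addr_ge0// mulr_ge0// ?invr_ge0 ?exprn_ge0 ?mulr_ge0 ?exprn_ge0// ltW.
Qed.

(** The Leibniz rule at the origin, read on coefficients. *)
Lemma coef1_prod (T : eqType) (r : seq T) (q : T -> {poly R}) : uniq r ->
  (\prod_(i <- r) q i)`_1 = \sum_(b <- r) (q b)`_1 * \prod_(i <- r | i != b) (q i)`_0.
Proof.
have coef0_prod (s : seq T) : (\prod_(i <- s) q i)`_0 = \prod_(i <- s) (q i)`_0.
  by elim/big_rec2 : _ => [|i u v _ <-]; rewrite ?coef1// coef0M.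
elim: r => [_|t r IH /=/andP[tr ur]]; first by rewrite !big_nil coef1.
rewrite !big_cons coefM big_ord_recl big_ord1 /= /bump /= IH// eqxx /=.
rewrite coef0_prod addrC; congr (_ + _).
  congr (_ * _); rewrite big_seq [RHS]big_seq_cond; apply: eq_bigl => i.
  by case: eqVneq => [->|]; rewrite ?(negbTE tr)// andbT.
rewrite mulr_sumr; apply: eq_big_seq => b br; rewrite big_cons.
case: eqVneq => [tb|_]; first by move: tr; rewrite tb br.
by rewrite mulrCA.
Qed.

End MonomialTaylor.

(** * Termwise differentiation of power series *)

Section PowerSeriesDerivative.
Variables (R : realType) (n : nat).
Local Notation mi := {ffun 'I_n -> nat}.
Implicit Types (c d : mi -> R) (k l : mi) (a x y h : 'rV[R]_n).

Lemma cvgn_succ (u : R^nat) (l : R) : u @ \oo --> l -> u N.+1 @[N --> \oo] --> l.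
Proof. by rewrite -(cvg_shiftS u). Qed.

Lemma cvgn_sum (I : Type) (r : seq I) (u : I -> R^nat) (l : I -> R) :
  (forall i, u i @ \oo --> l i) ->
  \sum_(i <- r) u i N @[N --> \oo] --> \sum_(i <- r) l i.
Proof.
move=> ul; elim: r => [|i r IH].
  by rewrite big_nil; under eq_fun do rewrite big_nil; exact: cvg_cst.
by rewrite big_cons; under eq_fun do rewrite big_cons; exact: cvgD.
Qed.

Definition msub1 k (b : 'I_n) : mi := [ffun i => (k i - (i == b))%N].

Definition der (b : 'I_n) c k : R := (k b).+1%:R * c (madd k (munit b)).

(** Along [y + X h] the coefficients of degree 0 and 1 are the value and the directional derivative,
    and [(s + e X)^|k|] is a majorant; the rest is [majorized_tail]. *)
Lemma mono_taylor k y h (s e t : R) : 1 <= t ->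
  (forall i, `|y 0 i| <= s) -> (forall i, `|h 0 i| <= e) ->
  `|mono k (y + h) - mono k y -
     \sum_b h 0 b * ((k b)%:R * mono (msub1 k b) y)| <=
  t ^- 2 * (s + e * t) ^+ mdeg k.
Proof.
move=> t1 ys he.
pose q i : {poly R} := ((y 0 i)%:P + h 0 i *: 'X) ^+ k i.
pose Q i : {poly R} := (s%:P + e *: 'X) ^+ k i.
have qQ : majorized (\prod_(i < n) q i) (\prod_(i < n) Q i).
  by apply: majorized_prod => i; apply/majorizedX/majorized_lin.
have := majorized_tail t1 qQ.
have q0 i : (q i)`_0 = y 0 i ^+ k i.
  by rewrite -horner_coef0 horner_exp !hornerE.
have -> : (\prod_(i < n) q i).[1] = mono k (y + h).
  rewrite horner_prod /mono; apply: eq_bigr => i _.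
  by rewrite horner_exp !hornerE mxE.
have -> : (\prod_(i < n) q i)`_0 = mono k y.
  rewrite -horner_coef0 horner_prod; apply: eq_bigr => i _.
  by rewrite horner_coef0 q0.
have -> : (\prod_(i < n) Q i).[t] = (s + e * t) ^+ mdeg k.
  rewrite horner_prod -prodrXr; apply: eq_bigr => i _.
  by rewrite horner_exp !hornerE.
suff -> : (\prod_(i < n) q i)`_1 = \sum_b h 0 b * ((k b)%:R * mono (msub1 k b) y) by [].
rewrite coef1_prod ?index_enum_uniq//; apply: eq_bigr => b _.
have -> : (q b)`_1 = h 0 b * (k b)%:R * y 0 b ^+ (k b).-1.
  rewrite -[LHS]mulr1n -coef_deriv -horner_coef0 deriv_exp hornerMn.
  rewrite derivD derivC derivZ derivX add0r hornerM horner_exp !hornerE.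
  by rewrite -mulrnAl mulr_natr.
rewrite -!mulrA; congr (_ * (_ * _)); rewrite /mono [RHS](bigD1 b)//=.
rewrite ffunE eqxx subn1; congr (_ * _); apply: eq_bigr => i ib.
by rewrite q0 ffunE (negbTE ib) subn0.
Qed.

(** [s^(m+1) - r^(m+1)] is [s - r] times [m + 1] terms, each at least [r^m]. *)
Lemma subrX_ge (s r : R) m : 0 <= r -> r <= s ->
  m.+1%:R * r ^+ m * (s - r) <= s ^+ m.+1.
Proof.
move=> r0 rs; apply: (@le_trans _ _ (s ^+ m.+1 - r ^+ m.+1)); last first.
  by rewrite gerBl exprn_ge0.
rewrite subrXX mulrC ler_wpM2l ?subr_ge0//.
rewrite -[X in X%:R * _](card_ord m.+1) mulr_natl -sumr_const.
apply: ler_sum => i _; have im : (i <= m)%N by rewrite -ltnS.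
rewrite -{1}(subnK im) exprD ler_wpM2r ?exprn_ge0//.
by rewrite lerXn2r// nnegrE// (le_trans r0).
Qed.

Lemma madd_inj l : injective (fun k => madd k l).
Proof. by move=> k1 k2 /ffunP e; apply/ffunP => i; move: (e i); rewrite !ffunE => /addIn. Qed.

Lemma madd_unit_box b k N : k \in box n N -> madd k (munit b) \in box n N.+1.
Proof.
rewrite !mem_box => /forallP kN; apply/forallP => i; have := kN i.
by rewrite !ffunE; case: (i == b); lia.
Qed.

(** The shift [k -> k + e_b] injects the box of side [N] into that of side [N + 1], and [subrX_ge]
    pays for the factor [k_b + 1 <= |k| + 1]. The price of a derivative is thus [1 / (s - s')]. *)
Lemma wsum_der b c (s s' C : R) N : 0 < s' -> s' < s -> (forall N, wsum c s N <= C) ->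
  wsum (der b c) s' N <= C / (s - s').
Proof.
move=> s'0 ss cC; have s0 := lt_trans s'0 ss; have d0 : 0 < s - s' by rewrite subr_gt0.
rewrite ler_pdivlMr//; apply: le_trans (cC N.+1); rewrite /wsum mulr_suml.
pose F k : R := `|c k| * s ^+ mdeg k.
apply: (@le_trans _ _ (\sum_(k <- [seq madd k (munit b) | k <- box n N]) F k)).
  rewrite [leRHS]big_map; apply: ler_sum => k _; rewrite /F mdegD mdeg_unit addn1 /der.
  rewrite normrM normr_nat -!mulrA mulrCA ler_wpM2l//.
  apply: le_trans (subrX_ge _ (ltW s'0) (ltW ss)); rewrite mulrA.
  rewrite ler_wpM2r ?(ltW d0)// ler_wpM2r ?exprn_ge0 ?(ltW s'0)// ler_nat ltnS /mdeg (bigD1 b)//=.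
  exact: leq_addr.
apply: ler_sum_uniq_sub; rewrite ?box_uniq//.
- by rewrite map_inj_uniq ?box_uniq//; exact: madd_inj.
- by move=> _ /mapP[k kN ->]; exact: madd_unit_box.
- by move=> k; rewrite mulr_ge0// exprn_ge0 ?ltW.
Qed.

(* The derivative of a partial sum over a box is almost a partial sum of the
   derivative. *)
Definition dpsum (b : 'I_n) c a N x : R :=
  \sum_(k <- box n N) c k * ((k b)%:R * mono (msub1 k b) (x - a)).

Lemma dpsumE b c a N x : dpsum b c a N x =
  \sum_(k <- box n N | madd k (munit b) \in box n N) der b c k * mono k (x - a).
Proof.
rewrite /dpsum (bigID (fun k => k b == 0%N)) /= big1 ?add0r; last first.
  by move=> k /eqP ->; rewrite mul0r mulr0.
rewrite -big_filter -[RHS]big_filter.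
rewrite (perm_big [seq madd k (munit b) | k <- box n N & madd k (munit b) \in box n N]).
  rewrite big_map; apply: eq_bigr => k _; rewrite /der mulrA [c _ * _]mulrC.
  rewrite !ffunE eqxx addn1; congr (_ * _); apply: eq_bigr => i _; congr (_ ^+ _).
  by rewrite !ffunE addnK.
apply: uniq_perm; first exact/filter_uniq/box_uniq.
  by rewrite map_inj_uniq ?filter_uniq ?box_uniq//; exact: madd_inj.
move=> k; rewrite mem_filter; apply/andP/mapP => [[kb kN]|[l + ->]].
  have kE : k = madd (msub1 k b) (munit b).
    by apply/ffunP => i; rewrite !ffunE; case: eqVneq => [->|_] /=; lia.
  exists (msub1 k b) => //; rewrite mem_filter -kE kN /=.
  by move: kN; rewrite {1}kE => /madd_box[].
rewrite mem_filter => /andP[lN _]; split => //.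
by rewrite !ffunE eqxx addn1.
Qed.

(** By [dpsumE] the index set of [dpsum] at [N + 1] lies between the boxes of sides [N] and [N + 1],
    so the discrepancy is a Cauchy tail of the derived series. *)
Lemma dpsum_diff b c a s N x : 0 <= s -> polydisc a s x ->
  `|power_psum (der b c) a N.+1 x - dpsum b c a N.+1 x| <=
  wsum (der b c) s N.+1 - wsum (der b c) s N.
Proof.
move=> s0 xs; rewrite power_psumE dpsumE.
rewrite [X in `|X - _|](bigID (fun k => madd k (munit b) \in box n N.+1)) /=.
rewrite addrAC subrr add0r lerBrDr.
apply: (@le_trans _ _ (\sum_(k <- box n N.+1 | madd k (munit b) \notin box n N.+1)
    `|der b c k| * s ^+ mdeg k + \sum_(k <- box n N.+1 | madd k (munit b) \in box n N.+1)
    `|der b c k| * s ^+ mdeg k)); last first.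
  by rewrite /wsum [leRHS](bigID (fun k => madd k (munit b) \in box n N.+1)) /= addrC.
apply: lerD.
  rewrite (le_trans (ler_norm_sum _ _ _))//; apply: ler_sum => k _.
  by rewrite normrM ler_wpM2l// normr_mono// => i; rewrite !mxE.
rewrite /wsum -[leRHS]big_filter; apply: ler_sum_uniq_sub.
- exact: box_uniq.
- exact/filter_uniq/box_uniq.
- move=> k kN; rewrite mem_filter madd_unit_box//=; exact: mem_boxS kN.
- by move=> k; rewrite mulr_ge0// exprn_ge0.
Qed.

Lemma psum_taylor c a N x h (s e t : R) : 1 <= t -> polydisc a s x ->
  (forall i, `|h 0 i| <= e) ->
  `|power_psum c a N (x + h) - power_psum c a N x - \sum_b h 0 b * dpsum b c a N x|
  <= t ^- 2 * wsum c (s + e * t) N.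
Proof.
move=> t1 xs he; rewrite !power_psumE /wsum mulr_sumr.
under [X in _ - X]eq_bigr do rewrite mulr_sumr.
rewrite exchange_big -!sumrB (le_trans (ler_norm_sum _ _ _))//.
apply: ler_sum => k _ /=.
rewrite (_ : _ - _ = c k * (mono k (x - a + h) - mono k (x - a) -
   \sum_b h 0 b * ((k b)%:R * mono (msub1 k b) (x - a)))).
  rewrite normrM mulrCA ler_wpM2l// mono_taylor// => i.
  by rewrite !mxE.
rewrite [x + h - a]addrAC !mulrBr mulr_sumr; congr (_ - _ - _).
by apply: eq_bigr => b _; rewrite mulrCA.
Qed.

(** The monomial remainders [t^-2 (s' + e t)^|k|] add up to [t^-2] times a weighted norm at radius
    [s' + e t <= s], uniformly in the truncation; the estimate passes to the limit. *)
Lemma pser_taylor f a s s' c C x : pser f a s c C -> 0 < s' -> s' < s ->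
  forall g, (forall b, pser (g b) a s' (der b c) (C / (s - s'))) ->
  polydisc a s' x -> forall h (e t : R), 1 <= t -> (forall i, `|h 0 i| <= e) ->
    s' + e * t <= s ->
  `|f (x + h) - f x - \sum_b h 0 b * g b x| <= t ^- 2 * C.
Proof.
move=> [s0 cC cf] s'0 ss g gP xs h e t t1 he hs.
have t0 : 0 < t by exact: lt_le_trans t1.
(* In dimension 0 there is no coordinate from which [0 <= e] could be deduced, so this case is
   treated apart. *)
have [n0|[b0]] : n = 0%N \/ inhabited 'I_n.
  by case: (n) => [|m]; [left|right; constructor; exact: ord0].
  have C0 : 0 <= C by apply: le_trans (cC 0%N); rewrite wsum_ge0// ltW.
  have hz : h = 0 by apply/rowP => i; exfalso; have := ltn_ord i; lia.
  rewrite hz addr0 subrr big1 ?subr0 ?normr0; last by move=> b; rewrite !mxE mul0r.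
  by rewrite mulr_ge0// invr_ge0 exprn_ge0 ?ltW.
have e0 : 0 <= e by apply: le_trans (he b0).
have xhs : polydisc a s (x + h).
  move=> i; rewrite mxE addrAC (le_trans (ler_normD _ _))// (le_trans _ hs)//.
  by rewrite lerD// (le_trans (he i))// ler_peMr.
have xs1 := polydisc_sub (ltW ss) xs.
have hd b : dpsum b c a N.+1 x @[N --> \oo] --> g b x.
  have [_ dC dg] := gP b.
  have hg : power_psum (der b c) a N.+1 x @[N --> \oo] --> g b x.
    by apply: (@cvgn_succ (fun N => power_psum (der b c) a N x)); exact: dg.
  rewrite -[g b x]subr0 (_ : (fun N => _) = (fun N => power_psum (der b c) a N.+1 x -
     (power_psum (der b c) a N.+1 x - dpsum b c a N.+1 x))); last first.
    by apply/funext => N; rewrite subKr.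
  apply: cvgB => //; apply/cvgr0Pnorm_le => eps eps0.
  have [N0 hN0] := wsum_cauchy (ltW s'0) dC eps0.
  exists N0 => // N /= NN; apply: le_trans (dpsum_diff b c N (ltW s'0) xs) _.
  exact: hN0.
have hsum : (fun N => \sum_b h 0 b * dpsum b c a N.+1 x) @ \oo -->
    \sum_b h 0 b * g b x.
  by apply: cvgn_sum => b; apply: cvgMr; exact: hd.
apply: (@cvgn_ler _ (fun N => `|power_psum c a N.+1 (x + h) - power_psum c a N.+1 x -
   \sum_b h 0 b * dpsum b c a N.+1 x|)).
  apply: cvg_norm; apply: cvgB => //; apply: cvgB.
    by apply: (@cvgn_succ (fun N => power_psum c a N (x + h))); exact: cf.
  by apply: (@cvgn_succ (fun N => power_psum c a N x)); exact: cf.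
move=> N; apply: le_trans (psum_taylor c N.+1 t1 xs he) _.
rewrite ler_wpM2l ?invr_ge0 ?exprn_ge0 ?(ltW t0)//; apply: le_trans (cC N.+1).
by apply: wsum_s; rewrite hs andbT addr_ge0 ?mulr_ge0 ?(ltW t0) ?(ltW s'0).
Qed.

End PowerSeriesDerivative.

(** * Closure properties of analytic functions *)

Section AnalyticFunctions.
Variables (R : realType) (n : nat).
Local Notation mi := {ffun 'I_n -> nat}.
Implicit Types (k : mi) (f g : 'rV[R]_n -> R) (a x y v h : 'rV[R]_n).

Lemma near_polydisc a (s : R) : 0 < s -> \forall x \near a, polydisc a s x.
Proof.
move=> s0; apply/nbhs_ballP; exists s => // x; rewrite mx_norm_ball /ball_ /=.
move=> /ltW xs i; apply: le_trans xs; rewrite distrC; apply: le_trans (normr_coord _ i).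
by rewrite !mxE.
Qed.

Lemma nbhs_polydisc a (P : set 'rV[R]_n) : nbhs a P ->
  exists2 s : R, 0 < s & polydisc a s `<=` P.
Proof.
move=> /nbhs_ballP[e /= e0 eP]; exists (e / 2); first by rewrite divr_gt0.
move=> x xe; apply: eP; rewrite mx_norm_ball /ball_ /= distrC.
apply: (@le_lt_trans _ _ (e / 2)); last by lra.
by apply: normr_row_le => [|i]; [lra|rewrite !mxE].
Qed.

Lemma analytic_atP f a :
  analytic_at f a <-> exists s c C, pser f a s c C.
Proof.
split=> [[c [r [C [r0 cC cf]]]]|[s [c [C [s0 cC cf]]]]].
  exists (r / 2), c, (C * (1 - r / 2 / r)^-1 ^+ n); split; first by lra.
    by apply: wsum_coef_bound => //; lra.
  move=> x xr; apply: cf => i; apply: le_lt_trans (xr i) _; lra.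
exists c, s, C; split => //.
  by move=> k; apply: le_coef_wsum => //; exact: ltW.
by move=> x xs; apply: cf => i; apply: ltW.
Qed.

(** The largest admissible scale in [pser_taylor] is [t = (s - s') / |h|], which turns the factor
    [t^-2] into the square of [|h|]. *)
Lemma pser_remainder f a (s s' : R) c (C : R) x h (g : 'I_n -> 'rV[R]_n -> R) :
  pser f a s c C -> 0 < s' -> s' < s ->
  (forall b, pser (g b) a s' (der b c) (C / (s - s'))) ->
  polydisc a s' x -> `|h| <= s - s' ->
  `|f (x + h) - f x - \sum_b h 0 b * g b x| <= C / (s - s') ^+ 2 * `|h| ^+ 2.
Proof.
move=> fP s'0 ss gP xs hs.
have [->|h0] := eqVneq h 0.
  rewrite addr0 subrr big1 ?subr0 ?normr0 ?expr0n ?mulr0// => b _.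
  by rewrite mxE mul0r.
have nh : 0 < `|h| by rewrite normr_gt0.
have t1 : 1 <= (s - s') / `|h| by rewrite ler_pdivlMr// mul1r.
have := pser_taylor fP s'0 ss gP xs t1 (normr_coord h).
rewrite mulrC divfK ?gt_eqF// subrKC => /(_ (lexx _)) /le_trans; apply.
by rewrite -exprVn invf_div expr_div_n mulrC mulrA mulrAC.
Qed.

(** The derived series have sums by [pser_exists]; the quadratic remainder estimate makes these sums
    the components of the differential, hence the partial derivatives. *)
Lemma pser_diff f a (s s' : R) c (C : R) : pser f a s c C -> 0 < s' -> s' < s ->
  (forall x, polydisc a s' x -> differentiable f x) /\
  forall b, pser ('D_(delta_mx 0 b) f) a s' (der b c) (C / (s - s')).
Proof.
move=> fP s'0 ss; have [_ cC _] := fP.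
have /choice[g gP] : forall b : 'I_n, exists g, pser g a s' (der b c) (C / (s - s')).
  by move=> b; apply: pser_exists => // N; exact: wsum_der.
have D x : polydisc a s' x -> differentiable f x /\
    forall h, 'd f x h = pairing h (\row_b g b x).
  move=> xs; apply: (@diff_of_quadratic _ _ _ _ _ (C / (s - s') ^+ 2) (s - s')).
    by rewrite subr_gt0.
  move=> h hs; rewrite (_ : pairing _ _ = \sum_b h 0 b * g b x).
    exact: (pser_remainder fP s'0 ss gP xs hs).
  by apply: eq_bigr => b _; rewrite mxE.
split=> [x /D[]//|b]; apply: pser_ext (gP b) => x /D[fx dE].
rewrite deriveE// dE /pairing (bigD1 b)//= !mxE !eqxx mul1r big1 ?addr0// => i ib.
by rewrite !mxE (negbTE ib) andbF mul0r.
Qed.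

Lemma analytic_at_near f g a : (\forall x \near a, f x = g x) ->
  analytic_at f a -> analytic_at g a.
Proof.
move=> /nbhs_polydisc[e e0 fg] /analytic_atP[s [c [C fP]]]; apply/analytic_atP.
have [s0 _ _] := fP.
exists (Num.min s e), c, C.
apply: (@pser_ext _ _ f).
  by move=> x xm; apply: fg; apply: polydisc_sub xm; rewrite ge_min lexx orbT.
by apply: pser_shrink fP; rewrite ?lt_min ?s0 ?e0// ge_min lexx.
Qed.

Lemma analytic_at_differentiable f a : analytic_at f a -> differentiable f a.
Proof.
move=> /analytic_atP[s [c [C fP]]]; have [s0 _ _] := fP.
have s2 : 0 < s / 2 by lra. have s2s : s / 2 < s by lra.
have [+ _] := pser_diff fP s2 s2s.
by apply=> i; rewrite subrr normr0; lra.
Qed.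

Lemma analytic_at_near_differentiable f a : analytic_at f a ->
  \forall x \near a, differentiable f x.
Proof.
move=> /analytic_atP[s [c [C fP]]]; have [s0 _ _] := fP.
have s2 : 0 < s / 2 by lra. have s2s : s / 2 < s by lra.
have [+ _] := pser_diff fP s2 s2s.
by move=> h; apply: filterS (near_polydisc a s2).
Qed.

Lemma analytic_at_continuous f a : analytic_at f a -> {for a, continuous f}.
Proof. by move=> /analytic_at_differentiable /differentiable_continuous. Qed.

Lemma analytic_at_cst (e : R) a : analytic_at (fun=> e) a.
Proof. by apply/analytic_atP; do 3!eexists; exact: (pser_cst e a ltr01). Qed.

Lemma analytic_at2 (P : ('rV[R]_n -> R) -> Prop) f g a :
  (forall s c d C D, pser f a s c C -> pser g a s d D -> P f) ->
  analytic_at f a -> analytic_at g a -> P f.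
Proof.
move=> fgP /analytic_atP[s [c [C fP]]] /analytic_atP[t [d [D gP]]].
have [s0 _ _] := fP; have [t0 _ _] := gP.
have m0 : 0 < Num.min s t by rewrite lt_min s0.
apply: (fgP (Num.min s t)).
  by apply: pser_shrink fP => //; rewrite ge_min lexx.
by apply: pser_shrink gP => //; rewrite ge_min lexx orbT.
Qed.

Lemma analytic_atD f g a : analytic_at f a -> analytic_at g a ->
  analytic_at (fun x => f x + g x) a.
Proof.
move=> fa ga; apply: (@analytic_at2 (fun=> _) f g a) => // s c d C D fP gP.
by apply/analytic_atP; do 3!eexists; exact: (pserD fP gP).
Qed.

Lemma analytic_atM f g a : analytic_at f a -> analytic_at g a ->
  analytic_at (fun x => f x * g x) a.
Proof.
move=> fa ga; apply: (@analytic_at2 (fun=> _) f g a) => // s c d C D fP gP.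
by apply/analytic_atP; do 3!eexists; exact: (pserM fP gP).
Qed.

Lemma analytic_atN f a : analytic_at f a -> analytic_at (fun x => - f x) a.
Proof.
move=> fa; have := analytic_atM (analytic_at_cst (-1) a) fa.
by under eq_fun do rewrite mulN1r.
Qed.

Lemma analytic_at_sum (I : Type) (r : seq I) (P : pred I) (F : I -> 'rV[R]_n -> R) a :
  (forall i, P i -> analytic_at (F i) a) ->
  analytic_at (fun x => \sum_(i <- r | P i) F i x) a.
Proof.
move=> Fa; elim: r => [|i r IH].
  by under eq_fun do rewrite big_nil; exact: analytic_at_cst.
under eq_fun do rewrite big_cons.
case: (boolP (P i)) => Pi //=; apply: analytic_atD => //; exact: Fa.
Qed.

Lemma analytic_at_prod (I : Type) (r : seq I) (P : pred I) (F : I -> 'rV[R]_n -> R) a :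
  (forall i, P i -> analytic_at (F i) a) ->
  analytic_at (fun x => \prod_(i <- r | P i) F i x) a.
Proof.
move=> Fa; elim: r => [|i r IH].
  by under eq_fun do rewrite big_nil; exact: analytic_at_cst.
under eq_fun do rewrite big_cons.
case: (boolP (P i)) => Pi //=; apply: analytic_atM => //; exact: Fa.
Qed.

Lemma analytic_at_partial f b a : analytic_at f a ->
  analytic_at ('D_(delta_mx 0 b) f) a.
Proof.
move=> /analytic_atP[s [c [C fP]]]; have [s0 _ _] := fP.
have s2 : 0 < s / 2 by lra. have s2s : s / 2 < s by lra.
have [_ /(_ b) h] := pser_diff fP s2 s2s.
by apply/analytic_atP; do 3!eexists; exact: h.
Qed.

Lemma deriveE_partial f x v : differentiable f x ->
  'D_v f x = \sum_b v 0 b * 'D_(delta_mx 0 b) f x.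
Proof. by move=> fx; rewrite deriveE// derive_delta. Qed.

Lemma analytic_at_derive f v a : analytic_at f a -> analytic_at ('D_v f) a.
Proof.
move=> fa; apply: (@analytic_at_near (fun x => \sum_b v 0 b * 'D_(delta_mx 0 b) f x)).
  near=> x; rewrite deriveE_partial//; near: x; exact: analytic_at_near_differentiable.
apply: analytic_at_sum => b _; apply: analytic_atM; first exact: analytic_at_cst.
exact: analytic_at_partial.
Unshelve. all: by end_near. Qed.

Lemma analytic_Ck (k : nat) (D : set 'rV[R]_n) f : analytic_on D f -> Ck k D f.
Proof.
elim: k f => [|k IH] f fD /=; (split; first by move=> x /fD /analytic_at_continuous) => //.
move=> v; split; first by move=> x /fD /analytic_at_differentiable /diff_derivable.
by apply: IH => x /fD; exact: analytic_at_derive.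
Qed.

Lemma der_comm b1 b2 (c : mi -> R) : der b1 (der b2 c) = der b2 (der b1 c).
Proof.
apply/funext => k; rewrite /der !ffunE.
have -> : madd (madd k (munit b1)) (munit b2) = madd (madd k (munit b2)) (munit b1).
  by apply/ffunP => i; rewrite !ffunE addnAC.
rewrite !mulrA; congr (_ * _); have [->|b12] := eqVneq b1 b2; first by [].
by rewrite !addn0 mulrC.
Qed.

(** Both mixed derivatives are sums of the same coefficient family by [der_comm]; each
    differentiation shrinks the radius a little. *)
Lemma derive_partial_comm f b1 b2 a : analytic_at f a ->
  'D_(delta_mx 0 b1) ('D_(delta_mx 0 b2) f) a =
  'D_(delta_mx 0 b2) ('D_(delta_mx 0 b1) f) a.
Proof.
move=> /analytic_atP[s [c [C fP]]]; have [s0 _ _] := fP.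
have s2 : 0 < s / 2 by lra. have s2s : s / 2 < s by lra.
have [_ h] := pser_diff fP s2 s2s.
have s4 : 0 < s / 4 by lra. have s42 : s / 4 < s / 2 by lra.
have [_ h1] := pser_diff (h b1) s4 s42.
have [_ h2] := pser_diff (h b2) s4 s42.
have := h2 b1; rewrite der_comm => h21; apply: (pser_uniq h21 (h1 b2)).
by move=> i; rewrite subrr normr0; lra.
Qed.

Lemma mdeg_gt0 k : k != midx0 n -> (0 < mdeg k)%N.
Proof.
apply: contraR; rewrite -leqNgt leqn0 /mdeg sum_nat_eq0 => /forallP h.
by apply/eqP/ffunP => l; rewrite ffunE; have /implyP/(_ isT)/eqP := h l.
Qed.

Section Inverse.
Variable c : mi -> R.
Hypothesis c0 : c (midx0 n) = 0.

(** Coefficients of [1 / (1 + f)] for [f] with coefficients [c], from the equation [g = 1 - f g]. As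
    [c] has no constant term, the product at [k] involves [g] only in degrees below [|k|], so fuel
    [|k| + 1] reaches the solution. *)
Fixpoint geom_fuel (m : nat) (k : mi) : R :=
  if m is m'.+1 then (k == midx0 n)%:R - mconv c (geom_fuel m') k else 0.

Definition geom_coef k := geom_fuel (mdeg k).+1 k.

Lemma eq_conv d e k : (forall j, (mdeg j < mdeg k)%N -> d j = e j) ->
  mconv c d k = mconv c e k.
Proof.
move=> de; apply: eq_bigr => i _; apply: eq_bigr => j /eqP ijk.
have [->|i0] := eqVneq i (midx0 n); first by rewrite c0 !mul0r.
by rewrite de// -ijk mdegD -[X in (X < _)%N]add0n ltn_add2r mdeg_gt0.
Qed.

Lemma geom_fuelS m k : (mdeg k < m)%N -> geom_fuel m.+1 k = geom_fuel m k.
Proof.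
elim: m k => [//|m IH] k km; rewrite [RHS]/= [LHS]/=; congr (_ - _).
by apply: eq_conv => j jk; apply: (IH j); apply: leq_trans jk _.
Qed.

Lemma geom_fuelE m k : (mdeg k < m)%N -> geom_fuel m k = geom_coef k.
Proof.
elim: m => [//|m IH]; rewrite ltnS leq_eqVlt => /orP[/eqP <-//|km].
by rewrite geom_fuelS// IH.
Qed.

Lemma geom_coefE k : geom_coef k = (k == midx0 n)%:R - mconv c geom_coef k.
Proof.
rewrite {1}/geom_coef /=; congr (_ - _); apply: eq_conv => j jk.
exact: geom_fuelE.
Qed.

(** The recursion gives [w <= 1 + w / 2] for the truncated norm [w], a finite number, so it can be
    solved for [w]. *)
Lemma wsum_geom_coef s N : 0 < s -> (forall N, wsum c s N <= 1 / 2) ->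
  wsum geom_coef s N <= 2.
Proof.
move=> s0 cs; have s0' := ltW s0.
have : wsum geom_coef s N <= 1 + 1 / 2 * wsum geom_coef s N.
  apply: (@le_trans _ _ (wsum (fun k => (k == midx0 n)%:R) s N + wsum (mconv c geom_coef) s N)).
    rewrite /wsum -big_split; apply: ler_sum => k _ /=; rewrite -mulrDl ler_wpM2r ?exprn_ge0//.
    by rewrite {1}geom_coefE ler_normB.
  apply: lerD.
    have [_ /(_ N) h _] := pser_mono (midx0 n) 0 s0; apply: le_trans h _.
    by rewrite mdeg0 expr0.
  apply: le_trans (wsum_conv _ _ _ s0') _; rewrite ler_wpM2r ?wsum_ge0//.
lra.
Qed.

(** Without a constant term every weight contains at least one factor [t / s]. *)
Lemma wsum_small (s t : R) N : 0 < t -> t <= s -> wsum c t N <= t / s * wsum c s N.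
Proof.
move=> t0 ts; have s0 := lt_le_trans t0 ts.
rewrite /wsum mulr_sumr; apply: ler_sum => k _.
have [->|k0] := eqVneq k (midx0 n); first by rewrite c0 normr0 !mul0r mulr0.
rewrite mulrCA ler_wpM2l//; move/mdeg_gt0: k0.
case: (mdeg k) => // m _; rewrite !exprS mulrA divfK ?gt_eqF//.
by rewrite ler_wpM2l ?(ltW t0)// lerXn2r// nnegrE ltW.
Qed.

End Inverse.

Lemma analytic_atV f a : f a != 0 -> analytic_at f a ->
  analytic_at (fun x => (f x)^-1) a.
Proof.
move=> fa0 fan.
have : analytic_at (fun x => 1 - (f a)^-1 * f x) a.
  apply: analytic_atD; first exact: analytic_at_cst.
  by apply/analytic_atN/analytic_atM => //; exact: analytic_at_cst.
move=> /analytic_atP[s [c [C hP]]]; have [s0 cC ch] := hP.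
have C0 : 0 <= C by apply: le_trans (cC 0%N); rewrite wsum_ge0// ltW.
(* At the centre every nonempty partial sum is the constant coefficient. *)
have c0 : c (midx0 n) = 0.
  have aa : polydisc a s a by move=> i; rewrite subrr normr0 ltW.
  have := ch a aa; rewrite mulVf// subrr => ch0.
  apply: (cvg_unique (@Rhausdorff R) _ ch0).
  apply: cvg_near_cst; exists 1%N => // N /= N1; rewrite power_psumE subrr.
  rewrite (bigD1_seq (midx0 n)) ?box_uniq//=; last first.
    by rewrite (mem_boxS N1)// -[1%N]/(0.+1) -(mdeg0 n) mem_box_mdeg.
  rewrite mono0 mulr1 big1 ?addr0// => k k0.
  have := normr_mono k (_ : forall i, `|(0 : 'rV[R]_n) 0 i| <= 0).
  rewrite -(prednK (mdeg_gt0 k0)) exprS mul0r normr_le0 => /(_ _)/eqP -> //.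
    by rewrite mulr0.
  by move=> i; rewrite mxE normr0.
(* On this radius the norm is at most [C / (2 C + 1) <= 1/2]; the summand 1 keeps the denominator
   positive when [C = 0]. *)
pose t := s / (2 * C + 1).
have M0 : 0 < 2 * C + 1 by lra.
have t0 : 0 < t by rewrite divr_gt0.
have ts : t <= s by rewrite ler_pdivrMr// ler_peMr//; lra.
have ct N : wsum (fun k => - c k) t N <= 1 / 2.
  rewrite (_ : wsum _ t N = wsum c t N); last first.
    by apply: eq_bigr => k _; rewrite normrN.
  apply: le_trans (wsum_small c0 N t0 ts) _.
  have -> : t / s = (2 * C + 1)^-1 by rewrite /t mulrAC divff ?mul1r ?gt_eqF.
  rewrite ler_pdivrMl// (le_trans (cC N))//; lra.
have hN : pser (fun x => - (1 - (f a)^-1 * f x)) a t (fun k => - c k) (`|-1| * C).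
  have := pserZ (-1) (pser_shrink t0 ts hP).
  by under eq_fun do rewrite mulN1r; under [X in pser _ _ _ X _]eq_fun do rewrite mulN1r.
have c0N : (fun k => - c k) (midx0 n) = 0 by rewrite c0 oppr0.
have [g gP] := pser_exists a t0 (fun N => wsum_geom_coef c0N N t0 ct).
have prod := pserM hN gP.
(* With [h = f / f(a) - 1], the function [1 - h g] has the coefficients of [g] by the recursion,
   whence [g = 1 - h g], that is, [g] is the inverse of [f / f(a)]. *)
have cst1 := pserD (pser_cst 1 a t0) (pserZ (-1) prod).
have ccE : (fun k => 1 * (k == midx0 n)%:R +
   -1 * mconv (fun k => - c k) (geom_coef (fun k => - c k)) k) =
   geom_coef (fun k => - c k).
  by apply/funext => k; rewrite (geom_coefE c0N) mul1r mulN1r.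
rewrite ccE in cst1.
have gE x : polydisc a t x -> g x * ((f a)^-1 * f x) = 1.
  by move=> xt; have := pser_uniq gP cst1 xt; lra.
apply: (@analytic_at_near (fun x => (f a)^-1 * g x)).
  apply: filterS (near_polydisc a t0) => x /gE gx.
  have fx0 : f x != 0.
    by apply/eqP => fx; move: gx; rewrite fx !mulr0 => /esym/eqP; rewrite oner_eq0.
  by apply: (mulIf fx0); rewrite mulVf// -mulrA mulrCA.
apply: analytic_atM; first exact: analytic_at_cst.
by apply/analytic_atP; do 3!eexists; exact: gP.
Qed.

End AnalyticFunctions.

(** * Cauchy estimates for iterated Lie derivatives *)

Lemma bin_le_expn m k : ('C(m, k) <= 2 ^ m)%N.
Proof.
elim: m k => [|m IH] [|k]; rewrite ?bin0 ?bin0n ?expn_gt0// binS expnS mul2n -addnn.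
by rewrite leq_add.
Qed.

Section CauchyEstimates.
Variables (R : realType) (n : nat).
Local Notation mi := {ffun 'I_n -> nat}.

Lemma pser_sum (I : Type) (r : seq I) (f : I -> 'rV[R]_n -> R) (a : 'rV[R]_n)
    (s : R) (c : I -> mi -> R) (C : I -> R) : 0 < s ->
  (forall i, pser (f i) a s (c i) (C i)) ->
  pser (fun x => \sum_(i <- r) f i x) a s (fun k => \sum_(i <- r) c i k)
    (\sum_(i <- r) C i).
Proof.
move=> s0 fP; elim: r => [|i r IH].
  rewrite big_nil; under eq_fun do rewrite big_nil.
  have := pser_cst 0 a s0; rewrite normr0; congr pser; apply/funext => k.
  by rewrite big_nil mul0r.
rewrite big_cons; under eq_fun do rewrite big_cons.
under [X in pser _ _ _ X _]eq_fun do rewrite big_cons.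
exact: pserD.
Qed.

(** [N^N <= (2N)! / N!], which is [N!] times the central binomial coefficient, and the latter is at
    most [4^N]. *)
Lemma expn_le_fact N : (N ^ N <= 4 ^ N * N`!)%N.
Proof.
have -> : (4 ^ N = 2 ^ (N + N))%N by rewrite addnn -mul2n expnM.
apply: (@leq_trans ('C(N + N, N) * N`!)); last by rewrite leq_mul2r bin_le_expn orbT.
rewrite bin_ffact ffact_prod -[X in (_ ^ X <= _)%N](card_ord N) -prod_nat_const.
by apply: leq_prod => i _; have := ltn_ord i; lia.
Qed.

(* Cauchy's estimate: each of the [N] derivations costs [1 / N]-th of half of
   the radius. *)
Lemma iterated_Lie_pser (I : Type) (X : I -> 'I_n -> 'rV[R]_n -> R)
    (F : seq I -> 'rV[R]_n -> R) (a : 'rV[R]_n) (s A C : R)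
    (cX : I -> 'I_n -> mi -> R) (c0 : mi -> R) :
  0 < s -> 0 <= A ->
  (forall i b, pser (X i b) a s (cX i b) A) ->
  pser (F [::]) a s c0 C ->
  (forall i l x, polydisc a s x ->
     F (i :: l) x = \sum_b 'D_(delta_mx 0 b) (F l) x * X i b x) ->
  forall l, exists c,
    pser (F l) a (s / 2) c (C * (n%:R * A * 8 / s) ^+ size l * (size l)`!%:R).
Proof.
move=> s0 A0 XP F0 FS l0; have C0 : 0 <= C.
  by have [_ cC _] := F0; apply: le_trans (cC 0%N); rewrite wsum_ge0// ltW.
have [N0|Npos] := posnP (size l0).
  rewrite N0 expr0 fact0 !mulr1; rewrite (size0nil N0).
  by exists c0; apply: pser_shrink F0; lra.
set N := size l0 in Npos *.
have N1 : 0 < N%:R :> R by rewrite ltr0n.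
pose d := s / 2 / N%:R.
have d0 : 0 < d by rewrite !divr_gt0.
have dN : d * N%:R = s / 2 by rewrite /d divfK ?gt_eqF.
have rad k : (k <= N)%N -> s / 2 <= s - d * k%:R <= s.
  move=> kN; have : d * k%:R <= d * N%:R by rewrite ler_wpM2l ?(ltW d0)// ler_nat.
  have : 0 <= d * k%:R by rewrite mulr_ge0 ?(ltW d0).
  lra.
have step l : (size l <= N)%N -> exists c,
    pser (F l) a (s - d * (size l)%:R) c (C * (n%:R * A / d) ^+ size l).
  elim: l => [_|i l IH /= lN].
    by rewrite mulr0 subr0 expr0 mulr1; exists c0.
  have [c cP] := IH (ltnW lN).
  have /andP[r1 r2] := rad _ (ltnW lN); have /andP[r3 r4] := rad _ lN.
  set s1 := s - d * (size l)%:R in cP r1 r2.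
  set s2 := s - d * (size l).+1%:R in r3 r4 *.
  have s12 : s1 - s2 = d by rewrite /s1 /s2 -natr1; ring.
  have [|| _ dP] := pser_diff cP (_ : 0 < s2) (_ : s2 < s1).
  - lra.
  - lra.
  have s20 : 0 < s2 by lra.
  rewrite s12 in dP.
  have prodP b := pserM (dP b) (pser_shrink s20 r4 (XP i b)).
  have := pser_sum (index_enum 'I_n) s20 prodP.
  move=> sP; eexists; apply: (@pser_ext _ _ (fun x => \sum_b 'D_(delta_mx 0 b) (F l) x * X i b x)).
    by move=> x xs; rewrite FS//; apply: polydisc_sub xs.
  apply: pser_le sP; rewrite sumr_const card_ord -mulr_natl exprS.
  by rewrite le_eqVlt; apply/orP; left; apply/eqP; ring.
have [c cP] := step l0 (leqnn _).
exists c; have /andP[r1 r2] := rad N (leqnn _).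
apply: (@pser_le _ _ _ _ _ _ (C * (n%:R * A / d) ^+ N)); last first.
  by apply: pser_shrink cP; [lra|].
rewrite -[leRHS]mulrA ler_wpM2l//.
(* The constant 8 is 2, from using half of the radius, times 4, from [N^N <= 4^N N!]. *)
pose Z : R := n%:R * A * 2 / s.
have Z0 : 0 <= Z by rewrite divr_ge0 ?mulr_ge0 ?(ltW s0).
have -> : n%:R * A / d = Z * N%:R by rewrite /Z /d !invf_div; ring.
have -> : n%:R * A * 8 / s = Z * 4 by rewrite /Z; ring.
clearbody Z; rewrite !exprMn -[leRHS]mulrA ler_wpM2l ?exprn_ge0//.
have := expn_le_fact N; rewrite -(ler_nat R) natrM !natrX; exact.
Qed.

End CauchyEstimates.

(** * Vanishing of families closed under differentiation *)

Section ZeroLemma.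
Variable R : realType.

(** The mean value theorem for [B (x - t0)^(N+1) / (N+1) - f], whose derivative is nonnegative. *)
Lemma deriv_bound_le (f df : R -> R) (B t0 t : R) (N : nat) : t0 <= t ->
  {within `[t0, t], continuous f} -> f t0 = 0 ->
  (forall x, x \in `]t0, t[ -> is_derive x 1 f (df x)) ->
  (forall x, x \in `]t0, t[ -> df x <= B * (x - t0) ^+ N) ->
  f t <= B * (t - t0) ^+ N.+1 / N.+1%:R.
Proof.
move=> t0t fc f0 fd dfB; move: t0t; rewrite le_eqVlt => /predU1P[<-|t0t].
  by rewrite f0 subrr exprS mul0r mulr0 mul0r.
pose phi : R -> R := (B / N.+1%:R) *: ((id - cst t0 : R -> R) ^+ N.+1).
have phiE (x : R) : phi x = B / N.+1%:R * (x - t0) ^+ N.+1 by rewrite /phi !fctE.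
have phid (x : R) : is_derive x 1 phi (B * (x - t0) ^+ N).
  rewrite /phi; apply: is_derive_eq.
  rewrite !fctE subr0 /GRing.scale /= mulr1.
  by rewrite mulrA divfK ?pnatr_eq0.
pose h := phi - f.
have hd (x : R) : x \in `]t0, t[ -> is_derive x 1 h (B * (x - t0) ^+ N - df x).
  by move=> xt; apply: is_deriveB; exact: fd.
have hc : {within `[t0, t], continuous h}.
  move=> x; apply: continuousB (fc x); apply: continuous_subspaceT => {}x.
  by apply/differentiable_continuous/derivable1_diffP; have [] := phid x.
have [z zt] := MVT t0t hd hc.
rewrite /h !fctE /= !phiE f0 subrr expr0n mulr0 !subr0.
have : 0 <= (B * (z - t0) ^+ N - df z) * (t - t0).
  by rewrite mulr_ge0 ?subr_ge0 ?(ltW t0t)// dfB.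
by move=> p e; rewrite mulrAC; move: p; rewrite -e subr_ge0.
Qed.

Lemma normr_eq0_geometric (x D q : R) : 0 <= q < 1 ->
  (forall N, `|x| <= D * q ^+ N) -> x = 0.
Proof.
move=> /andP[q0 q1] xD; apply/eqP; rewrite -normr_eq0 eq_le normr_ge0 andbT.
have qc : D * q ^+ N @[N --> \oo] --> (D * 0 : R).
  by apply: cvgMr; apply: cvg_expr; rewrite ger0_norm.
rewrite mulr0 in qc; rewrite -(cvg_lim (@Rhausdorff R) qc).
by apply: limr_ge; [apply/cvg_ex; exists 0 | exact: nearW].
Qed.

Lemma fact_addn_le q N : ((q + N)`! <= 2 ^ (q + N) * (q`! * N`!))%N.
Proof.
have := bin_fact (leq_addr N q); rewrite addKn => <-.
by rewrite leq_mul2r bin_le_expn orbT.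
Qed.

(* The [N]-th Taylor remainders of a family which is closed under
   differentiation and vanishes at [t0] tend to zero. *)
Lemma closed_family_eq0 (I : finType) (u : I -> R) (f : seq I -> R -> R)
    (t0 t1 C K : R) : 0 <= C -> 0 <= K ->
  (forall l t, t0 <= t < t1 -> {within `[t0, t], continuous (f l)}) ->
  (forall l t, t0 < t < t1 -> is_derive t 1 (f l) (\sum_i u i * f (i :: l) t)) ->
  (forall l, f l t0 = 0) ->
  (forall l t, t0 <= t < t1 -> `|f l t| <= C * K ^+ size l * (size l)`!%:R) ->
  forall l t, t0 <= t < t1 -> 2 * K * (\sum_i `|u i|) * (t - t0) < 1 -> f l t = 0.
Proof.
move=> C0 K0 fc fd f0 fb; set U := \sum_i `|u i|.
have U0 : 0 <= U by apply: sumr_ge0.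
(* Bound for a word of length [q] after [N] integrations from [t0]: each prefixes one letter,
   contributes a factor [U], and together they yield [1 / N!]. *)
pose B q N : R := C * K ^+ (q + N) * (q + N)`!%:R * U ^+ N / N`!%:R.
have claim N : forall l t, t0 <= t < t1 -> `|f l t| <= B (size l) N * (t - t0) ^+ N.
  elim: N => [|N IH] l t tt.
    by rewrite /B addn0 !expr0 fact0 !mulr1 invr1 mulr1 fb.
  have /andP[t0t tt1] := tt.
  have db x : x \in `]t0, t[ -> `|\sum_i u i * f (i :: l) x| <=
      (U * B (size l).+1 N) * (x - t0) ^+ N.
    rewrite in_itv /= => /andP[x0 xt].
    rewrite (le_trans (ler_norm_sum _ _ _))// /U -mulrA mulr_suml; apply: ler_sum => i _.
    rewrite normrM ler_wpM2l//; apply: (IH (i :: l)).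
    by rewrite (ltW x0) (lt_trans xt).
  have BE : B (size l) N.+1 * (t - t0) ^+ N.+1 =
      (U * B (size l).+1 N) * (t - t0) ^+ N.+1 / N.+1%:R.
    rewrite /B addnS addSn (factS N) natrM !exprS.
    by field; rewrite nat1r !pnatr_eq0 -!lt0n fact_gt0.
  have fd' x : x \in `]t0, t[ -> is_derive x 1 (f l) (\sum_i u i * f (i :: l) x).
    by rewrite in_itv /= => /andP[x0 xt]; apply: fd; rewrite x0 (lt_trans xt).
  rewrite BE ler_norml; apply/andP; split.
    rewrite lerNl; apply: (@deriv_bound_le (fun x => - f l x)
       (fun x => - \sum_i u i * f (i :: l) x)) => //.
    - by move=> x; apply: continuousN; exact: fc.
    - by rewrite f0 oppr0.
    - by move=> x xt; apply: is_deriveN; exact: fd'.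
    - by move=> x /db; rewrite ler_norml => /andP[]; lra.
  apply: (@deriv_bound_le (f l) (fun x => \sum_i u i * f (i :: l) x)) => //.
    exact: fc.
  by move=> x /db; rewrite ler_norml => /andP[].
move=> l t tt tK; have /andP[t0t _] := tt.
(* The part of [B (size l) N] that is independent of [N], once [(q + N)!] is replaced by
   [2^(q+N) q! N!]; what remains is geometric of ratio [2 K U (t - t0)]. *)
pose D := C * K ^+ size l * 2 ^+ size l * (size l)`!%:R.
apply: (@normr_eq0_geometric _ D (2 * K * U * (t - t0))).
  by rewrite tK !mulr_ge0 ?subr_ge0.
move=> N; apply: le_trans (claim N l t tt) _.
have Nf : 0 < N`!%:R :> R by rewrite ltr0n fact_gt0.
have : (size l + N)`!%:R <= 2 ^+ (size l + N) * ((size l)`!%:R * N`!%:R) :> R.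
  by have := fact_addn_le (size l) N; rewrite -(ler_nat R) !natrM natrX.
rewrite mulrA -ler_pdivrMr// => hf.
have W0 : 0 <= C * K ^+ (size l + N) * U ^+ N * (t - t0) ^+ N.
  by rewrite !mulr_ge0 ?exprn_ge0 ?subr_ge0.
have := ler_wpM2l W0 hf.
rewrite (_ : B (size l) N * _ = C * K ^+ (size l + N) * U ^+ N * (t - t0) ^+ N *
  ((size l + N)`!%:R / N`!%:R)); last by rewrite /B; ring.
move/le_trans; apply; rewrite /D !exprMn !exprD.
by rewrite le_eqVlt; apply/orP; left; apply/eqP; ring.
Qed.

End ZeroLemma.

(** * Row-valued maps, Jacobians and the pairing *)

Section RowValued.
Variables (R : realType) (n : nat).

Lemma differentiable_row (V : normedModType R) p (F : V -> 'rV[R]_p) (x : V) :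
  (forall b, differentiable (fun z => F z 0 b) x) -> differentiable F x.
Proof.
move=> Fx; rewrite (_ : F = \sum_(b < p) (fun z => F z 0 b *: delta_mx 0 b)).
  by apply: differentiable_sum => b; exact: differentiableZl.
by apply/funext => z; rewrite fct_sumE -row_sum_delta.
Qed.

Lemma jacobian_entry p (F : 'rV[R]_n -> 'rV[R]_p) (x : 'rV[R]_n) a b :
  differentiable F x -> 'J F x a b = 'D_(delta_mx 0 a) (fun z => F z 0 b) x.
Proof.
move=> Fx; have := derive_mx (@diff_derivable _ _ _ F x (delta_mx 0 a) Fx).
by rewrite deriveEjacobian// -rowE => /rowP/(_ b); rewrite !mxE.
Qed.

Lemma mulmx_jacobian p (F : 'rV[R]_n -> 'rV[R]_p) (x v : 'rV[R]_n) :
  differentiable F x -> v *m 'J F x = 'd F x v.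
Proof. by move=> Fx; rewrite -deriveEjacobian// deriveE. Qed.

Lemma jacobian_comp p q (F : 'rV[R]_n -> 'rV[R]_p) (G : 'rV[R]_p -> 'rV[R]_q)
    (x : 'rV[R]_n) :
  differentiable F x -> differentiable G (F x) ->
  'J (G \o F) x = 'J F x *m 'J G (F x).
Proof.
move=> Fx GFx; apply/row_matrixP => a; rewrite !rowE mulmxA.
rewrite -deriveEjacobian; last exact: differentiable_comp.
rewrite deriveE; last exact: differentiable_comp.
rewrite diff_comp//= -deriveE// deriveEjacobian// -deriveE//.
by rewrite deriveEjacobian.
Qed.

Lemma jacobian_comp_eq p q (F : 'rV[R]_n -> 'rV[R]_p) (G : 'rV[R]_p -> 'rV[R]_q)
    (x : 'rV[R]_n) (y : 'rV[R]_p) : F x = y ->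
  differentiable F x -> differentiable G y ->
  'J (G \o F) x = 'J F x *m 'J G y.
Proof. by move=> <-; exact: jacobian_comp. Qed.

Lemma near_eq_jacobian p (F G : 'rV[R]_n -> 'rV[R]_p) (x : 'rV[R]_n) :
  (\forall z \near x, F z = G z) -> differentiable F x -> differentiable G x ->
  'J F x = 'J G x.
Proof.
move=> FG Fx Gx; apply/matrixP => a b.
apply: etrans (jacobian_entry a b Fx) _; apply: etrans _ (esym (jacobian_entry a b Gx)).
by apply: near_eq_derive; apply: filterS FG => z ->.
Qed.

Lemma jacobian_near_id (F : 'rV[R]_n -> 'rV[R]_n) (y : 'rV[R]_n) :
  (\forall z \near y, F z = z) -> 'J F y = 1%:M.
Proof.
move=> Fid; have idy : differentiable (id : 'rV[R]_n -> 'rV[R]_n) y by exact: ex_diff.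
have Fy : differentiable F y.
  by apply: near_eq_differentiable idy; apply: filterS Fid => z ->.
apply/matrixP => a b; apply: etrans (jacobian_entry a b Fy) _.
rewrite (@near_eq_derive _ _ _ _ (fun y : 'rV[R]_n => y 0 b)); last first.
  by apply: filterS Fid => z ->.
have := derive_mx (@diff_derivable _ _ _ id y (delta_mx 0 a) idy).
by rewrite derive_id => /rowP/(_ b); rewrite !mxE eqxx /= => <-; rewrite eq_sym.
Qed.

Lemma pairing_trmx p (w : 'rV[R]_p) (v : 'rV[R]_n) (J : 'M[R]_(n, p)) :
  pairing (w *m J^T) v = pairing w (v *m J).
Proof.
rewrite /pairing; under eq_bigr do rewrite mxE mulr_suml.
rewrite exchange_big; apply: eq_bigr => b _; rewrite mxE mulr_sumr.
by apply: eq_bigr => a _; rewrite mxE -mulrA [J _ _ * _]mulrC.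
Qed.

Lemma pairingC (u v : 'rV[R]_n) : pairing u v = pairing v u.
Proof. by apply: eq_bigr => a _; rewrite mulrC. Qed.

Lemma pairingE (u v : 'rV[R]_n) : pairing u v = (u *m v^T) 0 0.
Proof. by rewrite !mxE; apply: eq_bigr => a _; rewrite !mxE. Qed.

Lemma pairing_suml k (c : 'I_k -> R) (u : 'I_k -> 'rV[R]_n) v :
  pairing (\sum_i c i *: u i) v = \sum_i c i * pairing (u i) v.
Proof.
rewrite pairingE mulmx_suml summxE; apply: eq_bigr => i _.
by rewrite -scalemxAl mxE pairingE.
Qed.

Lemma pairing_eq (u v : 'rV[R]_n) : (forall w, pairing u w = pairing v w) -> u = v.
Proof.
have E (u' : 'rV[R]_n) a : pairing u' (delta_mx 0 a) = u' 0 a.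
  rewrite /pairing (bigD1 a)//= !mxE !eqxx mulr1 big1 ?addr0// => b ba.
  by rewrite !mxE (negbTE ba) andbF mulr0.
by move=> uv; apply/rowP => a; rewrite -!E.
Qed.

End RowValued.

(* Locked, as conversion would otherwise unfold ['J] when it compares the
   changes between two different pairs of charts. *)
HB.lock Definition cchange (R : realType) n T (A : atlas R n T)
  (i j : chart_idx A) (x : T) : 'M[R]_n := coord_change A i j x.

Lemma coord_changeE (R : realType) n T (A : atlas R n T) :
  coord_change A = @cchange R n T A.
Proof. by rewrite cchange.unlock. Qed.

(** * Changes of charts, differentials and Lie derivatives on the manifold *)

Section ChartCalculus.
Variables (R : realType) (n : nat) (M : topologicalType) (A : atlas R n M).
Hypothesis hA : analytic_manifold A.
Implicit Types (i j k : chart_idx A) (x z : M) (y v : 'rV[R]_n) (W : set M)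
  (f g : M -> R) (X Y : M -> 'rV[R]_n).

Lemma chart_at_dom x : chart_dom (chart_at A x) x.
Proof. by case: hA. Qed.

Lemma open_chart_dom i : open (chart_dom i).
Proof. by case: hA => _ _ _ /(_ i)[]. Qed.

Lemma chart_mapK i x : chart_dom i x -> chart_inv i (chart_map i x) = x.
Proof. by case: hA => _ _ _ /(_ i)[_ _ + _ _ _]; exact. Qed.

Lemma chart_map_continuous i x : chart_dom i x -> {for x, continuous (chart_map i)}.
Proof.
move=> ix; case: hA => _ _ _ /(_ i)[oD _ _ + _] _; rewrite continuous_open_subspace//.
by apply; rewrite inE.
Qed.

Lemma chart_inv_continuous i x : chart_dom i x ->
  {for chart_map i x, continuous (chart_inv i)}.
Proof.
move=> ix; case: hA => _ _ _ /(_ i)[_ oI _ _ +] _; rewrite continuous_open_subspace//.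
by apply; rewrite inE; exists x.
Qed.

Lemma chart_img_inv i W y : chart_img i W y ->
  [/\ chart_dom i (chart_inv i y), W (chart_inv i y) &
      chart_map i (chart_inv i y) = y].
Proof. by move=> [x [ix Wx] <-]; rewrite chart_mapK. Qed.

Lemma near_chart i W x : open W -> W x -> chart_dom i x ->
  \forall y \near chart_map i x, chart_img i W y.
Proof.
move=> oW Wx ix.
have oI : open (chart_img i setT) by case: hA => _ _ _ /(_ i)[].
have Ix : chart_img i setT (chart_map i x) by exists x.
have h1 : \forall y \near chart_map i x, chart_img i setT y by exact: open_nbhs_nbhs.
have h2 : \forall y \near chart_map i x, W (chart_inv i y).
  apply: (chart_inv_continuous ix); rewrite chart_mapK//.
  exact: open_nbhs_nbhs.
by apply: filterS2 h1 h2 => y /chart_img_inv[iy _ yE] Wy; exists (chart_inv i y).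
Qed.

Lemma near_chart_map i W x : open W -> W x -> chart_dom i x ->
  \forall z \near x, chart_dom i z /\ W z.
Proof.
move=> oW Wx ix; have oI : open (chart_dom i `&` W).
  by apply: openI => //; exact: open_chart_dom.
by apply: open_nbhs_nbhs; split.
Qed.

Lemma near_transition i j x : chart_dom i x -> chart_dom j x ->
  \forall y \near chart_map i x,
    chart_inv j (transition i j y) = chart_inv i y.
Proof.
move=> ix jx; have := near_chart (open_chart_dom j) jx ix.
by apply: filterS => y /chart_img_inv[_ jy _]; rewrite /transition /= chart_mapK.
Qed.

Lemma transition_map i j x : chart_dom i x ->
  transition i j (chart_map i x) = chart_map j x.
Proof. by move=> ix; rewrite /transition /= chart_mapK. Qed.

Lemma transition_analytic i j x b : chart_dom i x -> chart_dom j x ->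
  analytic_at (fun y => transition i j y 0 b) (chart_map i x).
Proof. by move=> ix jx; case: hA => _ _ _ _ /(_ i j 0 b); apply; exists x. Qed.

Lemma transition_diff i j x : chart_dom i x -> chart_dom j x ->
  differentiable (transition i j) (chart_map i x).
Proof.
move=> ix jx; apply: differentiable_row => b.
exact/analytic_at_differentiable/transition_analytic.
Qed.

Definition cgrad i f (y : 'rV[R]_n) : 'rV[R]_n :=
  \row_a 'D_(delta_mx 0 a) (f \o chart_inv i) y.

Lemma differentialE f x :
  differential A f x = cgrad (chart_at A x) f (chart_map (chart_at A x) x).
Proof. by []. Qed.

Lemma diff_cgrad i f y v : differentiable (f \o chart_inv i) y ->
  'd (f \o chart_inv i) y v = pairing (cgrad i f y) v.
Proof.
move=> fy; rewrite derive_delta// /pairing; apply: eq_bigr => a _.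
by rewrite mxE mulrC.
Qed.

Lemma near_transition_eq i j f x : chart_dom i x -> chart_dom j x ->
  \forall y \near chart_map i x,
    (f \o chart_inv j \o transition i j) y = (f \o chart_inv i) y.
Proof.
move=> ix jx; have := near_transition ix jx.
by apply: filterS => y /= ->.
Qed.

Lemma cgrad_change i j f x : chart_dom i x -> chart_dom j x ->
  differentiable (f \o chart_inv j) (chart_map j x) ->
  cgrad i f (chart_map i x) = cgrad j f (chart_map j x) *m (cchange i j x)^T.
Proof.
rewrite cchange.unlock => ix jx fj; apply/rowP => a; rewrite mxE.
rewrite -(near_eq_derive _ (near_transition_eq f ix jx)).
have tx := transition_diff ix jx.
have fj' : differentiable (f \o chart_inv j) (transition i j (chart_map i x)).
  by rewrite transition_map.
rewrite deriveE; last exact: differentiable_comp.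
rewrite diff_comp//= diff_cgrad// transition_map// pairingE -mulmx_jacobian//.
by rewrite trmx_mul mulmxA trmx_delta -colE mxE.
Qed.

Lemma cchange_id i x : chart_dom i x -> cchange i i x = 1%:M.
Proof.
rewrite cchange.unlock => ix; apply: jacobian_near_id.
by apply: filterS (near_chart openT I ix) => y /chart_img_inv[_ _ yE]; rewrite /transition /= yE.
Qed.

Lemma cchange_comp i j k x :
  chart_dom i x -> chart_dom j x -> chart_dom k x ->
  cchange i j x *m cchange j k x = cchange i k x.
Proof.
rewrite cchange.unlock; move=> ix jx kx; have ij := transition_diff ix jx.
have jk := transition_diff jx kx.
have tij := transition_map j ix.
apply: etrans (esym (jacobian_comp_eq tij ij jk)) _.
apply: near_eq_jacobian; last exact: transition_diff.
  apply: filterS (near_transition ix jx) => y yE.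
  by rewrite /= {1}/transition /= yE.
by apply: differentiable_comp => //; rewrite tij.
Qed.

Lemma cchangeK i j x : chart_dom i x -> chart_dom j x ->
  cchange i j x *m cchange j i x = 1%:M.
Proof. by move=> ix jx; rewrite cchange_comp// cchange_id. Qed.

Lemma cchange_unit i j x : chart_dom i x -> chart_dom j x ->
  cchange i j x \in unitmx.
Proof. by move=> ix jx; have /mulmx1_unit[] := cchangeK ix jx. Qed.

Lemma vec_in_map i X x : chart_dom i x ->
  vec_in i X (chart_map i x) = X x *m cchange (chart_at A x) i x.
Proof. by move=> ix; rewrite /vec_in chart_mapK// coord_changeE. Qed.

Lemma vec_in_at X x : vec_in (chart_at A x) X (chart_map (chart_at A x) x) = X x.
Proof.
by have h := chart_at_dom x; rewrite vec_in_map// cchange_id// mulmx1.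
Qed.

Lemma vec_in_change i j X x : chart_dom i x -> chart_dom j x ->
  vec_in j X (chart_map j x) = vec_in i X (chart_map i x) *m cchange i j x.
Proof.
move=> ix jx; rewrite !vec_in_map// -mulmxA cchange_comp//.
exact: chart_at_dom.
Qed.

Definition analytic_fun_at f x := forall i, chart_dom i x ->
  analytic_at (f \o chart_inv i) (chart_map i x).

Definition analytic_field_at X x := forall i, chart_dom i x -> forall b,
  analytic_at (fun y => vec_in i X y 0 b) (chart_map i x).

Lemma analytic_funP W f : analytic_fun A W f <-> forall x, W x -> analytic_fun_at f x.
Proof.
split=> [fW x Wx i ix|fW i _ [x [ix Wx] <-]]; last exact: fW.
by apply: fW; exists x.
Qed.

Lemma analytic_fieldP W X : analytic_field A W X <-> forall x, W x -> analytic_field_at X x.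
Proof.
split=> [XW x Wx i ix b|XW i c b _ [x [ix Wx] <-]]; last by rewrite ord1; exact: XW.
by apply: (XW i 0 b); exists x.
Qed.

Lemma analytic_fun_at_diff f i x : chart_dom i x -> analytic_fun_at f x ->
  differentiable (f \o chart_inv i) (chart_map i x).
Proof. by move=> ix /(_ i ix); exact: analytic_at_differentiable. Qed.

Lemma Lie_chart i X f x : chart_dom i x -> analytic_fun_at f x ->
  Lie A X f x = pairing (cgrad i f (chart_map i x)) (vec_in i X (chart_map i x)).
Proof.
move=> ix fx; have cx := chart_at_dom x.
rewrite /Lie differentialE (cgrad_change cx ix); last exact: analytic_fun_at_diff.
by rewrite pairing_trmx -vec_in_map.
Qed.

Lemma Lie_chartE i X f x : chart_dom i x -> analytic_fun_at f x ->
  Lie A X f x = \sum_b 'D_(delta_mx 0 b) (f \o chart_inv i) (chart_map i x) *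
     vec_in i X (chart_map i x) 0 b.
Proof.
move=> ix fx; rewrite (Lie_chart _ ix)// /pairing; apply: eq_bigr => b _.
by rewrite mxE.
Qed.

Lemma analytic_fun_at_Lie W X f x : open W -> W x ->
  (forall z, W z -> analytic_fun_at f z) -> analytic_field_at X x ->
  analytic_fun_at (Lie A X f) x.
Proof.
move=> oW Wx fW Xx i ix.
apply: (@analytic_at_near _ _ (fun y => \sum_b 'D_(delta_mx 0 b) (f \o chart_inv i) y *
     vec_in i X y 0 b)).
  apply: filterS (near_chart oW Wx ix) => y /chart_img_inv[iy Wy yE] /=.
  by rewrite (Lie_chartE _ iy) ?yE//; exact: fW.
apply: analytic_at_sum => b _; apply: analytic_atM; last exact: Xx.
by apply: analytic_at_partial; exact: fW.
Qed.

Lemma analytic_fun_at_continuous f x : analytic_fun_at f x -> {for x, continuous f}.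
Proof.
move=> fx; have cx := chart_at_dom x.
have h : {for x, continuous (f \o chart_inv (chart_at A x) \o chart_map (chart_at A x))}.
  apply: continuous_comp; first exact: chart_map_continuous.
  exact: analytic_at_continuous (fx _ cx).
move: h; rewrite /prop_for /continuous_at /= chart_mapK//; apply: cvg_trans.
apply: near_eq_cvg; apply: filterS (near_chart_map openT I cx) => z [zx _] /=.
by rewrite chart_mapK.
Qed.

(** Continuity keeps the curve near time [t] in the preferred chart of [g t], where [f \o g] factors
    through the coordinates and the usual chain rule applies. *)
Lemma is_derive_along (g : R -> M) (t : R) v f : {for t, continuous g} ->
  has_velocity A g t v -> analytic_fun_at f (g t) ->
  is_derive t 1 (f \o g) (pairing (differential A f (g t)) v).
Proof.
move=> gt [dg gv] fg; set i := chart_at A (g t) in dg gv.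
have ig : chart_dom i (g t) := chart_at_dom (g t).
have fi : differentiable (f \o chart_inv i) ((chart_map i \o g) t).
  exact: analytic_fun_at_diff.
have dg' : differentiable (chart_map i \o g) t by exact/derivable1_diffP.
have E : \forall s \near t, (f \o chart_inv i \o (chart_map i \o g)) s = (f \o g) s.
  have h : \forall s \near t, chart_dom i (g s).
    exact: (gt _ (open_nbhs_nbhs (conj (open_chart_dom i) ig))).
  by apply: filterS h => s /= si; rewrite chart_mapK.
apply: (@near_eq_is_derive _ _ _ (f \o chart_inv i \o (chart_map i \o g)) _ _ _ _ E).
apply: DeriveDef.
  by apply/derivable1_diffP; exact: differentiable_comp.
rewrite deriveE; last exact: differentiable_comp.
by rewrite diff_comp//= diff_cgrad// -deriveE// gv.
Qed.

End ChartCalculus.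

(** * Indistinguishability and agreement of the observation functions *)

Section Separation.
Variables (R : realType) (n m : nat) (M : topologicalType) (A : atlas R n M).
Variable S : affine_system R n M 'I_m.
Hypothesis hA : analytic_manifold A.
Hypothesis hS : control_system A S.
Local Notation V := (word_fun A S).

Lemma sum_option (T : finType) (F : option T -> R) :
  \sum_i F i = F None + \sum_j F (Some j).
Proof.
rewrite (bigD1 None)//=; congr (_ + _); rewrite (reindex_omap Some id)//=.
  by apply: eq_bigl => j; rewrite eqxx.
by case.
Qed.

Lemma sys_field_analytic i x : analytic_field_at A (sys_field S i) x.
Proof. by have [/(_ i)[/analytic_fieldP/(_ x I)]] := hS. Qed.

Lemma word_fun_analytic w x : analytic_fun_at A (V w) x.
Proof.
case: w => l j; elim: l x => [|i l IH] x.
  by have [_ /(_ j)/analytic_funP] := hS; apply.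
apply: (@analytic_fun_at_Lie _ _ _ _ hA setT) => //; first exact: openT.
exact: sys_field_analytic.
Qed.

Lemma pser_uniform (T : finType) (f : T -> 'rV[R]_n -> R) (a : 'rV[R]_n) (e : R) :
  0 < e -> (forall t, analytic_at (f t) a) ->
  exists s B, [/\ 0 < s, s <= e, 0 <= B & forall t, exists c, pser (f t) a s c B].
Proof.
move=> e0 fa.
have /choice[p pP] : forall t, exists p : R * R, exists c, pser (f t) a p.1 c p.2.
  by move=> t; have /analytic_atP[s [c [C fP]]] := fa t; exists (s, C), c.
have p0 t : 0 < (p t).1 by have [c []] := pP t.
exists (\big[Num.min/e]_t (p t).1), (\sum_t `|(p t).2|); split.
- by elim/big_ind : _ => // x y x0 y0; rewrite lt_min x0.
- exact: bigmin_le_id.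
- exact: sumr_ge0.
move=> t; have [c cP] := pP t; exists c.
apply: (@pser_le _ _ _ _ _ _ (p t).2).
  by rewrite (le_trans (ler_norm _))// (bigD1 t)//= lerDl sumr_ge0.
apply: pser_shrink cP; last exact: bigmin_le.
by elim/big_ind : _ => // x y x0 y0; rewrite lt_min x0.
Qed.

(* One radius serves all the functions of the observation space. *)
Lemma word_fun_pser (i : chart_idx A) x : chart_dom i x -> exists s C K, [/\ 0 < s, 0 <= C, 0 <= K,
  polydisc (chart_map i x) s `<=` chart_img i setT &
  forall w, exists c, pser (V w \o chart_inv i) (chart_map i x) s c
    (C * K ^+ size w.1 * (size w.1)`!%:R)].
Proof.
move=> ix; set a := chart_map i x.
have [e e0 eI] := nbhs_polydisc (near_chart hA openT I ix).
have [s1 [A1 [s10 s1e A10 hX]]] := @pser_uniform _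
  (fun (t : option 'I_m * 'I_n) y => vec_in i (sys_field S t.1) y 0 t.2) a e e0
  (fun t => sys_field_analytic t.1 ix t.2).
have [s [C [s0 ss1 C0 hV]]] := @pser_uniform _
  (fun j : 'I_m => V ([::], j) \o chart_inv i) a s1 s10
  (fun j => word_fun_analytic ([::], j) ix).
have /choice[cX XP] := hX.
exists (s / 2), C, (n%:R * A1 * 8 / s); split => //.
- by rewrite divr_gt0.
- by rewrite divr_ge0 ?mulr_ge0 ?(ltW s0).
- by apply: subset_trans eI; apply: polydisc_sub; lra.
case=> l j /=; have [c0 c0P] := hV j.
apply: (@iterated_Lie_pser _ _ _ (fun o b y => vec_in i (sys_field S o) y 0 b)
  (fun l => V (l, j) \o chart_inv i) a s A1 C (fun o b => cX (o, b)) c0) => //.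
  by move=> o b; apply: pser_shrink (XP (o, b)).
move=> o l' y ys; have /eI[z [iz _] <-] : polydisc a e y.
  by apply: polydisc_sub ys; lra.
have := Lie_chartE hA (sys_field S o) iz (@word_fun_analytic (l', j) z).
by rewrite /= chart_mapK.
Qed.

Lemma continuous_within_interior (T : topologicalType) (g : R -> T) (tau t : R) :
  {within `[0, tau[, continuous g} -> 0 < t < tau -> {for t, continuous g}.
Proof.
move=> gc tt; have : {within `]0, tau[, continuous g}.
  by apply: continuous_subspaceW gc => z /=; rewrite !in_itv /= => /andP[/ltW -> ->].
rewrite continuous_open_subspace; last exact: interval_open.
by apply; rewrite inE /= in_itv.
Qed.

Lemma word_fun_along u x tau (g : R -> M) w : trajectory A S u x tau g ->
  {within `[0, tau[, continuous (V w \o g)}.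
Proof.
move=> [_ gc _] t.
apply: (@continuous_comp (subspace `[0, tau[) M R g (V w)); first exact: gc.
exact/analytic_fun_at_continuous/word_fun_analytic.
Qed.

(** The drift counts as a letter with constant input 1, so that differentiating along a trajectory
    prefixes a letter and the family of all words is closed under it. *)
Lemma word_fun_derive (u : R -> 'rV[R]_m) x tau (g : R -> M) t l j :
  trajectory A S u x tau g -> 0 < t < tau -> (\forall r \near t, u r = u t) ->
  is_derive t 1 (V (l, j) \o g)
    (\sum_(i : option 'I_m) (if i is Some k then u t 0 k else 1) * V (i :: l, j) (g t)).
Proof.
move=> [_ gc gv] tt ut.
have := is_derive_along hA (continuous_within_interior gc tt) (gv t tt ut)
  (@word_fun_analytic (l, j) (g t)).
set d := pairing _ _; set e := \sum_i _; suff -> : d = e by [].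
rewrite /d /e sum_option mul1r pairingC pairingE mulmxDl mulmx_suml mxE summxE.
rewrite -pairingE pairingC; congr (_ + _); apply: eq_bigr => k _.
by rewrite -scalemxAl mxE -pairingE pairingC.
Qed.

Definition agree (y1 y2 : M) := forall w, V w y1 = V w y2.

(** One-sided in time, as a trajectory is only continuous within its interval and [t] may be 0. *)
Lemma near_right_in_chart tau (g : R -> M) t (s : R) :
  {within `[0, tau[, continuous g} -> 0 <= t < tau -> 0 < s ->
  exists2 t1, t < t1 <= tau & forall r, t <= r < t1 ->
    chart_dom (chart_at A (g t)) (g r) /\
    polydisc (chart_map (chart_at A (g t)) (g t)) s (chart_map (chart_at A (g t)) (g r)).
Proof.
move=> gc /andP[t0 ttau] s0; set i := chart_at A (g t).
have ig : chart_dom i (g t) := chart_at_dom hA (g t).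
pose P z := chart_dom i z /\ polydisc (chart_map i (g t)) s (chart_map i z).
have nP : \forall z \near g t, P z.
  apply: filterI; first exact: open_nbhs_nbhs (conj (open_chart_dom hA i) ig).
  apply: (chart_map_continuous hA ig); exact: near_polydisc.
have tin : `[0, tau[%classic t by rewrite /= in_itv /= t0.
have : \forall r \near t, `[0, tau[%classic r -> P (g r).
  have := gc t _ nP; rewrite /nbhs /= /nbhs_subspace; case: ifPn => [_|]; last by rewrite notin_setE.
  by [].
move=> /nbhs_ballP[e /= e0 eP]; exists (Num.min (t + e) tau).
  by rewrite lt_min ge_min lexx orbT ttau andbT ltrDl e0.
move=> r /andP[tr]; rewrite lt_min => /andP[rt rtau]; apply: eP.
  by rewrite /ball /= ler0_norm ?subr_le0//; lra.
by rewrite /= in_itv /= rtau (le_trans t0 tr).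
Qed.

(** While the control is constant, the differences of the [V_w] along the two trajectories form a
    closed family vanishing at [t]. The constants of the two base points are added to obtain one
    bound valid for both curves. *)
Lemma agree_step (u : R -> 'rV[R]_m) x1 x2 tau (g1 g2 : R -> M) t t' :
  trajectory A S u x1 tau g1 -> trajectory A S u x2 tau g2 ->
  0 <= t < tau -> t < t' -> (forall r, t <= r < t' -> u r = u t) ->
  agree (g1 t) (g2 t) ->
  exists2 t1, t < t1 & forall r, t <= r < t1 -> r < tau -> agree (g1 r) (g2 r).
Proof.
move=> T1 T2 ttau tt' ut tagree; have /andP[t0 tltau] := ttau.
have [s1 [C1 [K1 [s10 C10 K10 I1 P1]]]] := word_fun_pser (chart_at_dom hA (g1 t)).
have [s2 [C2 [K2 [s20 C20 K20 I2 P2]]]] := word_fun_pser (chart_at_dom hA (g2 t)).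
have [_ gc1 _] := T1; have [_ gc2 _] := T2.
have [r1 /andP[tr1 r1tau] B1] := near_right_in_chart gc1 ttau s10.
have [r2 /andP[tr2 r2tau] B2] := near_right_in_chart gc2 ttau s20.
pose t1 := Num.min t' (Num.min r1 r2).
have tt1 : t < t1 by rewrite !lt_min tt' tr1.
have t1P r : r < t1 -> [/\ r < t', r < r1, r < r2 & r < tau].
  rewrite !lt_min => /and3P[rt' rr1 rr2]; split => //; exact: lt_le_trans r1tau.
pose K := K1 + K2; pose C := C1 + C2.
pose c (i : option 'I_m) := if i is Some k then u t 0 k else 1.
pose U := \sum_i `|c i|.
pose f j (l : seq (option 'I_m)) (r : R) := V (l, j) (g1 r) - V (l, j) (g2 r).
have U0 : 0 <= U by apply: sumr_ge0.
have KU0 : 0 < 2 * K * U + 1 by rewrite ltr_wpDl// !mulr_ge0// addr_ge0.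
(* The requirement of [closed_family_eq0] is a time below [1 / (2 K U)]; the added 1 keeps the
   inverse meaningful when [K U = 0]. *)
exists (Num.min t1 (t + (2 * K * U + 1)^-1)); first by rewrite lt_min tt1 ltrDl invr_gt0.
move=> r /andP[tr]; rewrite lt_min => /andP[rt1 rK] _ [l j].
apply/eqP; rewrite -subr_eq0; apply/eqP.
apply: (@closed_family_eq0 _ _ c (f j) t t1 C K).
- exact: addr_ge0.
- exact: addr_ge0.
- move=> l' r' /andP[tr' r't1]; have [_ _ _ r'tau] := t1P _ r't1.
  have sub : `[t, r']%classic `<=` `[0, tau[%classic.
    move=> z /=; rewrite !in_itv /= => /andP[tz zr'].
    by rewrite (le_trans t0 tz) (le_lt_trans zr').
  have c1 := continuous_subspaceW sub (@word_fun_along _ _ _ _ (l', j) T1).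
  have c2 := continuous_subspaceW sub (@word_fun_along _ _ _ _ (l', j) T2).
  move=> z; apply: (@continuousB R R (subspace `[t, r'])
    (V (l', j) \o g1) (V (l', j) \o g2)); [exact: c1|exact: c2].
- move=> l' r' /andP[tr' r't1]; have [r't' _ _ r'tau] := t1P _ r't1.
  have r'in : 0 < r' < tau by rewrite (le_lt_trans t0 tr') r'tau.
  have ur' : u r' = u t by apply: ut; rewrite (ltW tr').
  have near_u : \forall z \near r', u z = u r'.
    near=> z; rewrite ur'; apply: ut; apply/andP; split.
      by apply: ltW; near: z; exact: lt_nbhsr.
    by near: z; exact: lt_nbhsl.
  rewrite (_ : \sum_i _ = \sum_i c i * V (i :: l', j) (g1 r') -
                          \sum_i c i * V (i :: l', j) (g2 r')); last first.
    by rewrite -sumrB; apply: eq_bigr => i _; rewrite mulrBr.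
  have d1 := word_fun_derive l' j T1 r'in near_u.
  have d2 := word_fun_derive l' j T2 r'in near_u.
  rewrite ur' in d1 d2.
  exact: (is_deriveB d1 d2).
- by move=> l'; rewrite /f tagree subrr.
- move=> l' r' /andP[tr' r't1]; have [_ r'r1 r'r2 _] := t1P _ r't1.
  have bound (i : chart_idx A) s' C' K' z : 0 <= C' -> 0 <= K' -> K' <= K -> chart_dom i z ->
      (exists c, pser (V (l', j) \o chart_inv i) (chart_map i z) s' c
         (C' * K' ^+ size l' * (size l')`!%:R)) ->
      forall z', chart_dom i z' -> polydisc (chart_map i z) s' (chart_map i z') ->
      `|V (l', j) z'| <= C' * (K ^+ size l' * (size l')`!%:R).
    move=> C'0 K'0 K'K iz [cc ccP] z' iz' /(pser_bound ccP); rewrite /= chart_mapK//.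
    move/le_trans; apply; rewrite -mulrA ler_wpM2l// ler_wpM2r//.
    by rewrite lerXn2r// nnegrE// (le_trans K'0).
  have [i1 p1] := B1 r' (introT andP (conj tr' r'r1)).
  have [i2 p2] := B2 r' (introT andP (conj tr' r'r2)).
  rewrite -mulrA mulrDl (le_trans (ler_normB _ _))//; apply: lerD.
    apply: bound (P1 (l', j)) _ i1 p1 => //; first by rewrite lerDl.
    exact: chart_at_dom.
  apply: bound (P2 (l', j)) _ i2 p2 => //; first by rewrite lerDr.
  exact: chart_at_dom.
- by rewrite tr.
have : r - t < (2 * K * U + 1)^-1 by lra.
rewrite -div1r ltr_pdivlMr// mulrC -/U => h; apply: le_lt_trans h.
by rewrite ler_wpM2r ?subr_ge0// lerDl.
Unshelve. all: by end_near. Qed.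

Lemma agree_closed (u : R -> 'rV[R]_m) x1 x2 tau (g1 g2 : R -> M) t :
  trajectory A S u x1 tau g1 -> trajectory A S u x2 tau g2 ->
  0 < t < tau -> (forall r, 0 <= r < t -> agree (g1 r) (g2 r)) ->
  agree (g1 t) (g2 t).
Proof.
move=> T1 T2 tt tagree w; apply/eqP; rewrite -subr_eq0; apply/negPn/negP => h0.
have c1 := continuous_within_interior (@word_fun_along _ _ _ _ w T1) tt.
have c2 := continuous_within_interior (@word_fun_along _ _ _ _ w T2) tt.
have /andP[t0 _] := tt.
have hc : {for t, continuous (fun r => V w (g1 r) - V w (g2 r))}.
  by apply: continuousB; [exact: c1|exact: c2].
have : \forall r \near t, V w (g1 r) - V w (g2 r) != 0.
  by apply: (@cvgr_neq0 _ _ _ _ _ (fun r => V w (g1 r) - V w (g2 r)) _ hc).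
move=> /nbhs_ballP[e /= e0 eP].
pose r := Num.max 0 (t - e / 2).
have rt : 0 <= r < t by rewrite /r le_max lexx /= gt_max t0 /=; lra.
have /eP : ball t e r.
  rewrite /ball /= ger0_norm ?subr_ge0; last by have /andP[_ /ltW] := rt.
  have : t - e / 2 <= r by rewrite /r le_max lexx orbT.
  by lra.
by rewrite /= (tagree r rt w) subrr eqxx.
Qed.

(** Let [b] be the infimum of the times of disagreement. Agreement holds at [b] by continuity, and
    the control is constant on some interval to the right of [b], so [agree_step] pushes agreement
    beyond [b]. *)
Lemma agree_indistinguishable U x1 x2 : agree x1 x2 -> indistinguishable A U S x1 x2.
Proof.
move=> agr u [_ [s [s0 s_incr s_infty sP]]] tau g1 g2 T1 T2 t tt j.
have [g10 _ _] := T1; have [g20 _ _] := T2.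
suff H : forall t, 0 <= t < tau -> agree (g1 t) (g2 t) by exact: (H t tt ([::], j)).
move=> {j}{}t {}tt; apply: contrapT => nagr.
pose B := [set r | 0 <= r < tau /\ ~ agree (g1 r) (g2 r)].
have Bt : B t by [].
have lbB : lbound B 0 by move=> r [/andP[]].
pose b := inf B.
have hlb : has_lbound B by exists 0.
have b0 : 0 <= b by apply: lb_le_inf => //; exists t.
have bt : b <= t by exact: ge_inf.
have btau : 0 <= b < tau by rewrite b0 /= (le_lt_trans bt)//; case/andP: tt.
have below r : 0 <= r < b -> agree (g1 r) (g2 r).
  move=> /andP[r0 rb]; apply: contrapT => nr.
  have : b <= r.
    apply: ge_inf => //; split => //; rewrite r0 (lt_trans rb)//.
    by case/andP: btau.
  by rewrite leNgt rb.
have bagr : agree (g1 b) (g2 b).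
  have [b00|bpos] := eqVneq b 0; first by rewrite b00 g10 g20.
  apply: (agree_closed T1 T2 _ below).
  by rewrite lt_neqAle eq_sym bpos b0; case/andP: btau.
(* The switching times start at [0 <= b] and are unbounded; the induction locates the last one not
   exceeding [b]. *)
have [k /andP[sk ks]] : exists k, s k <= b < s k.+1.
  have [N bN] : exists N, b < s N.
    have /cvgryPgt/(_ b)[N _ /(_ N)] := s_infty; move/(_ (leqnn N)) => h.
    by exists N.
  elim: N bN => [|N IH]; first by rewrite s0 ltNge b0.
  by move=> bN; have [/IH//|h] := ltP b (s N); exists N; rewrite h.
have ub r : b <= r < s k.+1 -> u r = u b.
  move=> /andP[br rs]; rewrite (sP k r) ?(sP k b) ?sk//.
  by rewrite (le_trans sk br).
have [t1 bt1 t1P] := agree_step T1 T2 btau ks ub bagr.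
have : t1 <= b.
  apply: lb_le_inf; first by exists t.
  move=> r [/andP[r0 rtau] nr]; rewrite leNgt; apply/negP => rt1.
  have [rb|br] := ltP r b; first by apply/nr/below; rewrite r0.
  by apply: nr; apply: t1P => //; rewrite br.
by rewrite leNgt bt1.
Qed.

Lemma observable_separates U : observable A U S -> forall x1 x2, agree x1 x2 -> x1 = x2.
Proof. by move=> obs x1 x2 /(@agree_indistinguishable U); exact: obs. Qed.

End Separation.

(** * Euler polygons along a field annihilated by all differentials *)

Section EulerPolygons.
Variables (R : realType) (n : nat).

Lemma polydisc_compact (a : 'rV[R]_n) (s : R) : compact (polydisc a s).
Proof.
have -> : polydisc a s = [set v : 'rV[R]_n | forall i, `[a 0 i - s, a 0 i + s]%classic (v 0 i)].
  rewrite eqEsubset; split=> v vs i; have := vs i; rewrite /= in_itv /=.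
    by rewrite ler_norml => /andP[h1 h2]; apply/andP; split; lra.
  by move=> /andP[h1 h2]; rewrite ler_norml; apply/andP; split; lra.
by apply: (@rV_compact _ _ (fun i => `[a 0 i - s, a 0 i + s]%classic)) => i;
  exact: segment_compact.
Qed.

Lemma cluster_le (T : topologicalType) (Y : nat -> T) (y : T) (f : T -> R) (d : R) :
  cluster (Y @ \oo) y -> {for y, continuous f} ->
  (\forall N \near \oo, d <= f (Y N)) -> d <= f y.
Proof.
move=> cy fc dY; rewrite leNgt; apply/negP => fyd.
have h : nbhs y [set z | f z < d].
  by apply: (@cvgr_lt _ _ _ _ _ _ fc).
have [z [/= dz]] := cy [set z | d <= f z] _ dY h.
by rewrite ltNge dz.
Qed.

Variables (T : Type) (H : T -> 'rV[R]_n -> R) (y0 : 'rV[R]_n) (s : R).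
Variables (k : 'rV[R]_n -> 'rV[R]_n) (kappa q : R) (b : 'I_n).
Hypothesis s0 : 0 < s.
Hypothesis kappa0 : 0 < kappa.
Hypothesis q0 : 0 < q.
Hypothesis Hc : forall t y, polydisc y0 s y -> {for y, continuous (H t)}.
Hypothesis HC : forall t, exists2 C, 0 <= C & forall y h, polydisc y0 s y -> `|h| <= s ->
  `|H t (y + h) - H t y - \sum_a h 0 a * 'D_(delta_mx 0 a) (H t) y| <= C * `|h| ^+ 2.
Hypothesis kH : forall t y, polydisc y0 s y ->
  \sum_a k y 0 a * 'D_(delta_mx 0 a) (H t) y = 0.
Hypothesis k_bounded : forall y, polydisc y0 s y -> `|k y| <= kappa.
Hypothesis k_coord : forall y, polydisc y0 s y -> q <= k y 0 b.

(** A time during which a polygon of speed at most [kappa] stays within distance [s] of [y0]; it is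
    cut into [N + 1] equal steps. *)
Let tau := s / kappa.
Let eps N := tau / N.+1%:R.
Let euler N l := iter l (fun y => y + eps N *: k y) y0.

Let tau0 : 0 < tau. Proof. exact: divr_gt0. Qed.
Let eps0 N : 0 < eps N. Proof. by rewrite divr_gt0 ?ltr0n. Qed.
Let epsE N : N.+1%:R * eps N = tau. Proof. by rewrite mulrC divfK ?pnatr_eq0. Qed.

Lemma euler_bound N l : (l <= N.+1)%N -> `|euler N l - y0| <= l%:R * (eps N * kappa) /\
  polydisc y0 s (euler N l).
Proof.
have sub l' : (l' <= N.+1)%N -> l'%:R * (eps N * kappa) <= s.
  move=> lN; have -> : s = N.+1%:R * (eps N * kappa).
    by rewrite mulrA epsE /tau divfK ?gt_eqF.
  have ek : 0 <= eps N * kappa by apply: mulr_ge0; apply: ltW.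
  by apply: ler_wpM2r => //; rewrite ler_nat.
have pd l' y : (l' <= N.+1)%N -> `|y - y0| <= l'%:R * (eps N * kappa) -> polydisc y0 s y.
  move=> lN yl i; apply: le_trans (sub _ lN); apply: le_trans yl.
  by apply: le_trans (normr_coord _ i); rewrite !mxE.
elim: l => [_|l IH lN].
  have h : `|euler N 0 - y0| <= 0%:R * (eps N * kappa) by rewrite /= subrr normr0 mul0r.
  by split=> //; exact: pd h.
have [h1 h2] := IH (ltnW lN).
have h : `|euler N l.+1 - y0| <= l.+1%:R * (eps N * kappa).
  rewrite /euler iterS -/(euler N l) addrAC (le_trans (ler_normD _ _))//.
  rewrite -natr1 mulrDl mul1r lerD// normrZ gtr0_norm//.
  by rewrite ler_wpM2l ?(ltW (eps0 N))// k_bounded.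
by split=> //; exact: pd h.
Qed.

Lemma euler_coord N l : (l <= N.+1)%N -> l%:R * (eps N * q) <= euler N l 0 b - y0 0 b.
Proof.
elim: l => [_|l IH lN]; first by rewrite /= subrr mul0r.
rewrite /euler iterS -/(euler N l) !mxE -natr1 mulrDl mul1r addrAC lerD ?IH ?(ltnW lN)//.
rewrite ler_wpM2l ?(ltW (eps0 N))// k_coord//.
by have [] := euler_bound (ltnW lN).
Qed.

(** The first-order term of each step vanishes by [kH], so a step changes [H t] by at most
    [C (eps kappa)^2], and [N + 1] steps of length [tau / (N + 1)] by a multiple of
    [1 / (N + 1)]. *)
Lemma euler_drift t : exists2 D, 0 <= D & forall N,
  `|H t (euler N N.+1) - H t y0| <= D / N.+1%:R.
Proof.
have [C C0 CP] := HC t; exists (C * (tau * kappa) ^+ 2).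
  by rewrite mulr_ge0// exprn_ge0// mulr_ge0 ?ltW.
move=> N; have epsN := eps0 N.
have step l : (l <= N.+1)%N -> `|H t (euler N l) - H t y0| <= l%:R * (C * (eps N * kappa) ^+ 2).
  elim: l => [_|l IH lN]; first by rewrite /= subrr normr0 mul0r.
  have [_ pl] := euler_bound (ltnW lN).
  have hk : `|eps N *: k (euler N l)| <= eps N * kappa.
    by rewrite normrZ gtr0_norm// ler_wpM2l ?(ltW epsN)// k_bounded.
  have hs : `|eps N *: k (euler N l)| <= s.
    apply: le_trans hk _; rewrite -[leRHS](divfK (lt0r_neq0 kappa0)) -/tau.
    by rewrite ler_wpM2r ?(ltW kappa0)// ler_pdivrMr ?ltr0n// ler_peMr ?(ltW tau0)// ler1n.
  have := CP _ _ pl hs.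
  rewrite (_ : \sum_a _ = 0) ?subr0; last first.
    apply: (@etrans _ _ (eps N * \sum_a k (euler N l) 0 a * 'D_(delta_mx 0 a) (H t) (euler N l))).
      by rewrite mulr_sumr; apply: eq_bigr => a _; rewrite mxE mulrA.
    by rewrite kH// mulr0.
  rewrite /euler iterS -/(euler N l) => h.
  rewrite -(subrK (H t (euler N l)) (H t (_ + _))) -addrA (le_trans (ler_normD _ _))//.
  rewrite -natr1 mulrDl mul1r [leLHS]addrC; apply: lerD; first exact: IH (ltnW lN).
  apply: le_trans h _.
  apply: ler_wpM2l => //; apply: lerXn2r => //; rewrite nnegrE//.
  by apply: mulr_ge0; exact: ltW.
apply: le_trans (step _ (leqnn _)) _.
rewrite -(epsE N) le_eqVlt; apply/orP; left; apply/eqP.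
have N0 : N.+1%:R != 0 :> R by rewrite pnatr_eq0.
move: (N.+1%:R) N0 => z z0; by field.
Qed.

(** Compactness of the polydisc gives a cluster point of the endpoints. It differs from [y0], since
    coordinate [b] has grown by at least [tau q] for every [N], while the drift of each [H t] tends
    to zero. *)
Lemma exists_isochrone : exists2 y, polydisc y0 s y & y <> y0 /\ forall t, H t y = H t y0.
Proof.
pose Y N := euler N N.+1.
have YP N : polydisc y0 s (Y N) by have [] := euler_bound (leqnn N.+1).
have YF : (Y @ \oo) (polydisc y0 s) by exists 0%N => // N _; exact: YP.
have [y [ys cy]] := polydisc_compact (fmap_proper_filter Y _) YF.
exists y => //; split.
  have : tau * q <= y 0 b - y0 0 b.
    apply: (cluster_le cy (f := fun z : 'rV[R]_n => z 0 b - y0 0 b)).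
      by apply: continuousB; [exact: coord_continuous|exact: cst_continuous].
    apply: nearW => N; apply: le_trans (euler_coord (leqnn N.+1)).
    by rewrite mulrA epsE.
  by move=> /[swap] ->; rewrite subrr leNgt mulr_gt0.
move=> t; apply/eqP; rewrite -subr_eq0 -normr_le0 -oppr_ge0 leNgt.
apply/negP => neg.
have [D D0 DP] := euler_drift t.
pose e := `|H t y - H t y0| / 2.
have e0 : 0 < e by rewrite /e; lra.
have : - e <= - `|H t y - H t y0|.
  apply: (cluster_le cy (f := fun z => - `|H t z - H t y0|)).
    apply: continuousN; apply: (@continuous_comp _ _ _ (fun z => H t z - H t y0) (fun r : R => `|r|)).
      by apply: continuousB; [exact: Hc|exact: cst_continuous].
    exact: norm_continuous.
  have : (D * N.+1%:R^-1) @[N --> \oo] --> (D * 0 : R).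
    by apply: cvgMr; exact: cvg_harmonic.
  rewrite mulr0 => /cvgrPdist_le/(_ e e0); apply: filterS => N.
  rewrite sub0r normrN => h; rewrite lerN2; apply: le_trans (DP N) _.
  exact: le_trans (ler_norm _) h.
rewrite /e; lra.
Qed.

End EulerPolygons.

(** * Linear spans *)

Section Lspan.
Variables (R : realType) (V : lmodType R).
Implicit Types P Q : set V.

Lemma lspan_incl P : P `<=` lspan P.
Proof.
by move=> v Pv; exists 1%N, (fun=> 1), (fun=> v); split => //; rewrite big_ord1 scale1r.
Qed.

Lemma lspan0 P : lspan P 0.
Proof. by exists 0%N, (fun=> 0), (fun=> 0); split; [case|rewrite big_ord0]. Qed.

Lemma lspan_comb P a u v : lspan P u -> lspan P v -> lspan P (a *: u + v).
Proof.
move=> [k [c [e [eP ->]]]] [l [d [f [fP ->]]]].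
exists (k + l)%N, (fun i => match fintype.split i with inl i1 => a * c i1 | inr i2 => d i2 end),
  (fun i => match fintype.split i with inl i1 => e i1 | inr i2 => f i2 end).
split; first by move=> i; case: (fintype.split i).
rewrite big_split_ord /= scaler_sumr; congr (_ + _); apply: eq_bigr => i _.
  by rewrite -/(unsplit (inl i)) (unsplitK (inl i)) scalerA.
by rewrite -/(unsplit (inr i)) (unsplitK (inr i)).
Qed.

Lemma lspan_sum P k (c : 'I_k -> R) (u : 'I_k -> V) :
  (forall i, lspan P (u i)) -> lspan P (\sum_(i < k) c i *: u i).
Proof.
move=> uP; elim/big_ind : _ => [||i _]; first exact: lspan0.
  by move=> x y Px Py; rewrite -[x]scale1r; exact: lspan_comb.
by rewrite -[_ *: _]addr0; apply: lspan_comb; [exact: uP|exact: lspan0].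
Qed.

Lemma lspan_sub P Q : P `<=` lspan Q -> lspan P `<=` lspan Q.
Proof. by move=> PQ v [k [c [u [uP ->]]]]; apply: lspan_sum => i; apply/PQ. Qed.

End Lspan.

(** * Matrices with analytic entries *)

Section AnalyticMatrices.
Variables (R : realType) (n : nat).

Definition analytic_mx_at p q (F : 'rV[R]_n -> 'M[R]_(p, q)) (a : 'rV[R]_n) :=
  forall i j, analytic_at (fun y => F y i j) a.

Lemma analytic_mx_cst p q (C : 'M[R]_(p, q)) a : analytic_mx_at (fun=> C) a.
Proof. by move=> i j; exact: analytic_at_cst. Qed.

Lemma analytic_mxB p q (F G : 'rV[R]_n -> 'M[R]_(p, q)) a :
  analytic_mx_at F a -> analytic_mx_at G a -> analytic_mx_at (fun y => F y - G y) a.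
Proof.
move=> Fa Ga i j; under eq_fun do rewrite !mxE.
by apply: analytic_atD; last exact: analytic_atN.
Qed.

Lemma analytic_mxM p q r (F : 'rV[R]_n -> 'M[R]_(p, q)) (G : 'rV[R]_n -> 'M[R]_(q, r)) a :
  analytic_mx_at F a -> analytic_mx_at G a -> analytic_mx_at (fun y => F y *m G y) a.
Proof.
move=> Fa Ga i j; under eq_fun do rewrite mxE.
by apply: analytic_at_sum => k _; exact: analytic_atM.
Qed.

Lemma analytic_mxT p q (F : 'rV[R]_n -> 'M[R]_(p, q)) a :
  analytic_mx_at F a -> analytic_mx_at (fun y => (F y)^T) a.
Proof. by move=> Fa i j; under eq_fun do rewrite mxE. Qed.

Lemma analytic_det p (F : 'rV[R]_n -> 'M[R]_p) a :
  analytic_mx_at F a -> analytic_at (fun y => \det (F y)) a.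
Proof.
move=> Fa; rewrite /determinant; apply: analytic_at_sum => s _.
by apply: analytic_atM (analytic_at_cst _ _) _; apply: analytic_at_prod.
Qed.

Lemma near_unitmx p (F : 'rV[R]_n -> 'M[R]_p) a : analytic_mx_at F a ->
  F a \in unitmx -> \forall y \near a, F y \in unitmx.
Proof.
move=> Fa; rewrite unitmxE unitfE => da.
have dc := analytic_at_continuous (analytic_det Fa).
have h : \forall y \near a, \det (F y) != 0.
  by apply: (@cvgr_neq0 _ _ _ _ _ (fun y => \det (F y)) _ dc).
by apply: filterS h => y; rewrite unitmxE unitfE.
Qed.

Lemma analytic_invmx p (F : 'rV[R]_n -> 'M[R]_p) a : analytic_mx_at F a ->
  F a \in unitmx -> analytic_mx_at (fun y => invmx (F y)) a.
Proof.
move=> Fa Fu i j.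
apply: (@analytic_at_near _ _ (fun y => (\det (F y))^-1 * cofactor (F y) j i)).
  by apply: filterS (near_unitmx Fa Fu) => y Fy; rewrite /invmx Fy !mxE.
apply: analytic_atM.
  by apply: analytic_atV; [rewrite -unitfE -unitmxE|exact: analytic_det].
apply: analytic_atM; first exact: analytic_at_cst.
by apply: analytic_det => k l; under eq_fun do rewrite !mxE; exact: Fa.
Qed.

End AnalyticMatrices.

(** * The differentials of the observation functions span the cotangent spaces *)

Section FullCodistribution.
Variables (R : realType) (n m : nat) (M : topologicalType) (A : atlas R n M).
Variable S : affine_system R n M 'I_m.
Hypothesis hA : analytic_manifold A.
Hypothesis hS : control_system A S.
Local Notation V := (word_fun A S).

Lemma cgrad_lin k (c : 'I_k -> R) (f : 'I_k -> M -> R) (i : chart_idx A) (y : 'rV[R]_n) :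
  (forall l, differentiable (f l \o chart_inv i) y) ->
  cgrad i (\sum_l c l *: f l) y = \sum_l c l *: cgrad i (f l) y.
Proof.
move=> fy; apply/rowP => a; rewrite mxE summxE.
have -> : (\sum_l c l *: f l) \o chart_inv i = \sum_l (c l *: (f l \o chart_inv i)).
  by apply/funext => z; rewrite /= !fct_sumE.
rewrite derive_sum; last by move=> l; apply/derivableZ/diff_derivable.
apply: eq_bigr => l _; rewrite deriveZ; last exact: diff_derivable.
by rewrite !mxE.
Qed.

(** Linearity of the differential replaces the observation space by its generators, for which
    analyticity is known. *)
Lemma codistributionE x : observation_codistribution A S x =
  lspan (range (fun w => differential A (V w) x)).
Proof.
have cx := chart_at_dom hA x.
rewrite eqEsubset; split; apply: lspan_sub.
  move=> _ [_ [k [c [f [fP ->]]]] <-]; rewrite differentialE cgrad_lin; last first.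
    move=> l; have [w _ <-] := fP l.
    apply: (analytic_fun_at_diff cx).
    exact: word_fun_analytic.
  apply: lspan_sum => l; have [w _ <-] := fP l.
  by apply: lspan_incl; exists w.
move=> _ [w _ <-]; apply: lspan_incl; exists (V w) => //.
by apply: lspan_incl; exists w.
Qed.

Lemma cgrad_analytic w x (i : chart_idx A) : chart_dom i x ->
  analytic_mx_at (cgrad i (V w)) (chart_map i x).
Proof.
move=> ix a b; under eq_fun do rewrite mxE.
by apply: analytic_at_partial; exact: (@word_fun_analytic _ _ _ _ _ _ hA hS w x).
Qed.

Hypothesis sep : forall x1 x2, agree A S x1 x2 -> x1 = x2.
Hypothesis cdim : constant_observation_dim A S.

Lemma differentials_separate x v :
  (forall w, pairing (differential A (V w) x) v = 0) -> v = 0.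
Proof.
have [r hdim] := cdim; move=> vV; apply: contrapT => v_neq0.
have [b vb] : exists b, v 0 b != 0.
  apply: contrapT => h; apply: v_neq0; apply/rowP => b; rewrite mxE.
  by apply/eqP/negPn/negP => vb; apply: h; exists b.
(* Normalised so that coordinate [b] equals 1; for the extension [k] it then stays above 1/2 nearby,
   which is the lower speed [q] of [exists_isochrone]. *)
pose v0 := (v 0 b)^-1 *: v.
have v0b : v0 0 b = 1 by rewrite mxE mulVf.
have v0V w : pairing (differential A (V w) x) v0 = 0.
  by rewrite pairingC pairingE -scalemxAl mxE -pairingE pairingC vV mulr0.
clearbody v0 => {v vV v_neq0 vb}.
set i := chart_at A x; have ix : chart_dom i x := chart_at_dom hA x.
set y0 := chart_map i x.
have [B [Bfree BE]] := hdim x.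
(* A basis of the codistribution at [x] is written through finitely many words, with fixed
   coefficients, so that the same expressions [Bm] make sense at nearby points. *)
have /choice[p pE] : forall j, exists p : {k : nat & (('I_k -> R) * ('I_k -> word 'I_m))%type},
    row j B = \sum_l (projT2 p).1 l *: differential A (V ((projT2 p).2 l)) x.
  move=> j.
  have : observation_codistribution A S x (row j B) by rewrite BE /=; exact: row_sub.
  rewrite codistributionE => -[k [c [u [uP ->]]]].
  have /choice[w wP] : forall l, exists w, differential A (V w) x = u l.
    by move=> l; have [w _ <-] := uP l; exists w.
  by exists (existT _ k (c, w)); apply: eq_bigr => l _; rewrite wP.
pose c j := (projT2 (p j)).1; pose w j := (projT2 (p j)).2.
have {}pE j : row j B = \sum_l c j l *: differential A (V (w j l)) x := pE j.
pose Bm y := \matrix_(j < r) \sum_l c j l *: cgrad i (V (w j l)) y.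
have Bm0 : Bm y0 = B by apply/row_matrixP => j; rewrite rowK pE.
have Bma : analytic_mx_at Bm y0.
  move=> j a; under eq_fun do rewrite mxE summxE.
  apply: analytic_at_sum => l _; under eq_fun do rewrite mxE.
  apply: analytic_atM; first exact: analytic_at_cst.
  exact: cgrad_analytic ix _ _.
have /row_freeP[Q BQ] := Bfree.
pose Dm y := Bm y *m Q.
have Dma : analytic_mx_at Dm y0 by apply: analytic_mxM => //; exact: analytic_mx_cst.
have Dm0 : Dm y0 \in unitmx by rewrite /Dm Bm0 BQ unitmx1.
(* The oblique projection of the constant vector [v0] onto the vectors annihilated by the rows of
   [Bm y]. The right inverse [Q] of [B] makes [Bm y *m Q] invertible near [y0], and at [y0] the
   correction vanishes. *)
pose k y := v0 - v0 *m (Bm y)^T *m (invmx (Dm y))^T *m Q^T.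
have ka : analytic_mx_at k y0.
  apply: analytic_mxB; first exact: analytic_mx_cst.
  apply: analytic_mxM; last exact: analytic_mx_cst.
  apply: analytic_mxM; last exact/analytic_mxT/analytic_invmx.
  by apply: analytic_mxM; [exact: analytic_mx_cst|exact: analytic_mxT].
have k0 : k y0 = v0.
  rewrite /k Bm0 (_ : v0 *m B^T = 0) ?mul0mx ?subr0//; apply/rowP => j; rewrite mxE [RHS]mxE.
  have h : pairing (row j B) v0 = 0.
    by rewrite pE pairing_suml big1// => l _; rewrite v0V mulr0.
  by rewrite -[RHS]h; apply: eq_bigr => a _; rewrite !mxE mulrC.
have kB y : Dm y \in unitmx -> k y *m (Bm y)^T = 0.
  move=> Dy; rewrite mulmxBl -!mulmxA -trmx_mul -/(Dm y) -trmx_mul mulmxV//.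
  by rewrite trmx1 mulmx1 subrr.
(* Constancy of the dimension enters here: the [r] rows of [Bm y] are still independent, hence span
   the whole codistribution, and [k y] is annihilated by every [dV_w] and not only by the chosen
   combinations. *)
have kspan y w' : chart_img i setT y -> Dm y \in unitmx ->
    pairing (k y) (cgrad i (V w') y) = 0.
  move=> /(chart_img_inv hA)[iy _ yE] Dy.
  set z := chart_inv i y in iy yE *; have cz := chart_at_dom hA z.
  pose J := cchange i (chart_at A z) z.
  have gE w2 : cgrad i (V w2) y = differential A (V w2) z *m J^T.
    rewrite -yE differentialE; apply: (cgrad_change hA) => //.
    apply: (analytic_fun_at_diff cz); exact: word_fun_analytic.
  pose B' := \matrix_(j < r) \sum_l c j l *: differential A (V (w j l)) z.
  have BmE : Bm y = B' *m J^T.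
    apply/row_matrixP => j; rewrite row_mul !rowK mulmx_suml.
    by apply: eq_bigr => l _; rewrite gE scalemxAl.
  have Ju : row_free J^T by rewrite row_free_unit unitmx_tr; exact: cchange_unit.
  have Bmfree : row_free (Bm y).
    by apply/row_freeP; exists (Q *m invmx (Dm y)); rewrite mulmxA mulmxV.
  have rB' : \rank B' = r by rewrite -(mxrankMfree B' Ju) -BmE; exact/eqP.
  have [Bz [/eqP Bzfree BzE]] := hdim z.
  have B'Bz : (B' <= Bz)%MS.
    apply/row_subP => j; rewrite rowK.
    have : observation_codistribution A S z (\sum_l c j l *: differential A (V (w j l)) z).
      by rewrite codistributionE; apply: lspan_sum => l; apply: lspan_incl; exists (w j l).
    by rewrite BzE.
  have BzB' : (Bz <= B')%MS.
    have := mxrank_leqif_eq B'Bz; rewrite rB' Bzfree => -[_].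
    by rewrite eqxx => /esym/andP[].
  have dBz : (differential A (V w') z <= Bz)%MS.
    have : observation_codistribution A S z (differential A (V w') z).
      by rewrite codistributionE; apply: lspan_incl; exists w'.
    by rewrite BzE.
  have /submxP[E dE] := submx_trans dBz BzB'.
  rewrite gE dE -mulmxA -BmE pairingE trmx_mul mulmxA kB//.
  by rewrite mul0mx mxE.
have [s [C [Kc [s0 C0 K0 sI VP]]]] := word_fun_pser hA hS ix.
have norm_near : \forall y \near y0, `|k y| <= `|v0| + 1.
  have kc a : {for y0, continuous (fun y => k y 0 a)}.
    exact: analytic_at_continuous (ka 0 a).
  have h a : \forall y \near y0, `|k y 0 a| <= `|v0| + 1.
    have := @cvgr_norm_le _ _ _ _ _ (fun y => k y 0 a) _ (kc a) (`|v0| + 1).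
    by apply; rewrite k0 (le_lt_trans (normr_coord _ _))// ltrDl.
  have : \forall y \near y0, forall a, `|k y 0 a| <= `|v0| + 1.
    exact: (@filter_forall _ _ (fun a => [set y | `|k y 0 a| <= `|v0| + 1]) _ _ h).
  by apply: filterS => y ky; apply: normr_row_le => //; rewrite addr_ge0.
have coord_near : \forall y \near y0, 1 / 2 <= k y 0 b.
  have kc := analytic_at_continuous (ka 0 b).
  have := @cvgr_ge _ _ _ _ (fun y => k y 0 b) _ kc (1 / 2).
  by apply; rewrite k0 v0b; lra.
have [s1 s10 s1P] := nbhs_polydisc (filterI (near_unitmx Dma Dm0) (filterI norm_near coord_near)).
(* The bound [s / 2] leaves room for the increments [h] in the remainder estimate, the derivatives
   being controlled on half of the radius. *)
pose rho := Num.min s1 (s / 2).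
have rho0 : 0 < rho by rewrite lt_min s10 divr_gt0.
have rho1 : rho <= s1 by rewrite ge_min lexx.
have rho2 : rho <= s / 2 by rewrite ge_min lexx orbT.
have rhoI : polydisc y0 rho `<=` chart_img i setT.
  by apply: subset_trans sI; apply: polydisc_sub; lra.
have s2 : 0 < s / 2 by lra. have s2s : s / 2 < s by lra.
pose H w' (y : 'rV[R]_n) := (V w' \o chart_inv i) y.
have Hcont w' y : polydisc y0 rho y -> {for y, continuous (H w')}.
  move=> yr; have [cc ccP] := VP w'; have [+ _] := pser_diff ccP s2 s2s.
  move=> /(_ y (polydisc_sub rho2 yr)); exact: differentiable_continuous.
have HC w' : exists2 C, 0 <= C & forall y h, polydisc y0 rho y -> `|h| <= rho ->
    `|H w' (y + h) - H w' y - \sum_a h 0 a * 'D_(delta_mx 0 a) (H w') y| <= C * `|h| ^+ 2.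
  have [cc ccP] := VP w'; have [_ dP] := pser_diff ccP s2 s2s.
  eexists; last first.
    move=> y h yr hr; apply: (pser_remainder ccP s2 s2s dP).
      exact: polydisc_sub yr.
    by apply: le_trans hr _; lra.
  by rewrite divr_ge0 ?sqr_ge0// !mulr_ge0 ?exprn_ge0.
have Hk w' y : polydisc y0 rho y -> \sum_a k y 0 a * 'D_(delta_mx 0 a) (H w') y = 0.
  move=> yr; have [Dy _] := s1P _ (polydisc_sub rho1 yr).
  apply: etrans (kspan y w' (rhoI _ yr) Dy); apply: eq_bigr => a _.
  by congr (_ * _); rewrite [RHS]mxE.
have kbound y : polydisc y0 rho y -> `|k y| <= `|v0| + 1.
  by move=> yr; have [_ []] := s1P _ (polydisc_sub rho1 yr).
have kcoord y : polydisc y0 rho y -> 1 / 2 <= k y 0 b.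
  by move=> yr; have [_ []] := s1P _ (polydisc_sub rho1 yr).
have v1 : 0 < `|v0| + 1 by rewrite ltr_wpDl.
have h2 : 0 < 1 / 2 :> R by lra.
have [y yrho [yy0 Hy]] := exists_isochrone rho0 v1 h2 Hcont HC Hk kbound kcoord.
have [iy _ yE] := chart_img_inv hA (rhoI _ yrho).
apply: yy0; rewrite -yE; congr chart_map; apply: sep => w'.
by have := Hy w'; rewrite /H /= chart_mapK.
Qed.

End FullCodistribution.

(** * Locality of the connection and its expression in a chart *)

Section Connection.
Variables (R : realType) (n : nat) (M : topologicalType) (A : atlas R n M).
Hypothesis hA : analytic_manifold A.
Implicit Types (i j : chart_idx A) (x z : M) (W : set M) (f : M -> R)
  (X Y : M -> 'rV[R]_n).

Lemma cchange_analyticl i j x : chart_dom i x -> chart_dom j x ->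
  analytic_mx_at (fun y => cchange i j (chart_inv i y)) (chart_map i x).
Proof.
move=> ix jx a b.
apply: (@analytic_at_near _ _ ('D_(delta_mx 0 a) (fun y => transition i j y 0 b))).
  apply: filterS (near_chart hA (open_chart_dom hA j) jx ix) => y /(chart_img_inv hA)[iy jy yE].
  rewrite -coord_changeE /coord_change yE; apply/esym/jacobian_entry.
  by have := transition_diff hA iy jy; rewrite yE.
by apply: analytic_at_partial; exact: transition_analytic.
Qed.

Lemma cchange_inv i j x : chart_dom i x -> chart_dom j x ->
  cchange i j x = invmx (cchange j i x).
Proof.
move=> ix jx; have u := cchange_unit hA jx ix.
by rewrite -[LHS](mulmxK u) cchangeK// mul1mx.
Qed.

(** The Jacobian from [i] to [j] is a derivative of the transition map in the coordinates of [i]; in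
    those of [j] it is the inverse of the opposite Jacobian. *)
Lemma cchange_analyticr i j x : chart_dom i x -> chart_dom j x ->
  analytic_mx_at (fun y => cchange i j (chart_inv j y)) (chart_map j x).
Proof.
move=> ix jx a b.
apply: (@analytic_at_near _ _ (fun y => invmx (cchange j i (chart_inv j y)) a b)).
  apply: filterS (near_chart hA (open_chart_dom hA i) ix jx) => y /(chart_img_inv hA)[jy iy yE].
  by rewrite (cchange_inv iy jy).
apply: analytic_invmx; first exact: cchange_analyticl.
by rewrite chart_mapK//; exact: cchange_unit.
Qed.

Lemma frame_vec_in i j a z : chart_dom i z -> chart_dom j z ->
  vec_in j (frame i a) (chart_map j z) = delta_mx 0 a *m cchange i j z.
Proof.
move=> iz jz; have cz := chart_at_dom hA z.
by rewrite vec_in_map// /frame coord_changeE -mulmxA cchange_comp.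
Qed.

Lemma frame_analytic i a x : chart_dom i x -> analytic_field_at A (frame i a) x.
Proof.
move=> ix j jx b.
apply: (@analytic_at_near _ _ (fun y => (delta_mx 0 a *m cchange i j (chart_inv j y) : 'rV__) 0 b)).
  apply: filterS (near_chart hA (open_chart_dom hA i) ix jx) => y /(chart_img_inv hA)[jy iy yE].
  have e := frame_vec_in a iy jy; rewrite yE in e.
  by rewrite e.
have h : analytic_mx_at (fun y => (delta_mx 0 a : 'rV__) *m cchange i j (chart_inv j y)) (chart_map j x).
  by apply: analytic_mxM; [exact: analytic_mx_cst|exact: cchange_analyticr].
exact: (h 0 b).
Qed.

Definition component i X a : M -> R := fun z => vec_in i X (chart_map i z) 0 a.

Lemma component_analytic i X a x : chart_dom i x -> analytic_field_at A X x ->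
  analytic_fun_at A (component i X a) x.
Proof.
move=> ix Xx j jx.
apply: (@analytic_at_near _ _ (fun y => (vec_in j X y *m cchange j i (chart_inv j y)) 0 a)).
  apply: filterS (near_chart hA (open_chart_dom hA i) ix jx) => y /(chart_img_inv hA)[jy iy yE].
  have e := vec_in_change hA X jy iy; rewrite yE in e.
  by rewrite /component /= e.
apply: analytic_mxM; last exact: cchange_analyticl.
by move=> b c; rewrite ord1; exact: Xx.
Qed.

Lemma frame_expansion i X z : chart_dom i z ->
  X z = \sum_a component i X a z *: frame i a z.
Proof.
move=> iz; have cz := chart_at_dom hA z.
under eq_bigr do rewrite /frame coord_changeE scalemxAl.
rewrite -mulmx_suml -row_sum_delta vec_in_map// -mulmxA cchangeK// ?mulmx1//.
Qed.

Lemma analytic_fieldD W X Y : analytic_field A W X -> analytic_field A W Y ->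
  analytic_field A W (X + Y).
Proof.
move=> XW YW i c a y yW; under eq_fun do rewrite /vec_in mulmxDl mxE.
by apply: analytic_atD; [exact: XW|exact: YW].
Qed.

Lemma analytic_fieldZ W f X : analytic_fun A W f -> analytic_field A W X ->
  analytic_field A W (fun z => f z *: X z).
Proof.
move=> fW XW i c a y yW; under eq_fun do rewrite /vec_in -scalemxAl mxE.
by apply: analytic_atM; [exact: fW|exact: XW].
Qed.

Lemma analytic_field0 W : analytic_field A W 0.
Proof.
move=> i c a y yW; under eq_fun do rewrite /vec_in mul0mx mxE.
exact: analytic_at_cst.
Qed.

Lemma analytic_field_bigsum W (I : Type) (r : seq I) (F : I -> M -> 'rV[R]_n) :
  (forall t, analytic_field A W (F t)) -> analytic_field A W (\sum_(t <- r) F t).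
Proof.
move=> FW; elim/big_ind : _ => //; first exact: analytic_field0.
by move=> X Y; exact: analytic_fieldD.
Qed.

(** On an open [W] it is an analytic function with zero derivative. Multiplied by it, two fields
    agreeing on [W] become equal everywhere, which yields the locality of [nabla] from its
    axioms. *)
Definition indicator W : M -> R := fun z => if `[< W z >] then 1 else 0.

Lemma indicator_near W i x : open W -> W x -> chart_dom i x ->
  \forall y \near chart_map i x, 1 = (indicator W \o chart_inv i) y.
Proof.
move=> oW Wx ix; apply: filterS (near_chart hA oW Wx ix) => y /(chart_img_inv hA)[_ Wy _].
by rewrite /indicator /= asboolT.
Qed.

Lemma indicator_analytic W : open W -> analytic_fun A W (indicator W).
Proof.
move=> oW i _ [x [ix Wx] <-].
by apply: analytic_at_near (indicator_near oW Wx ix) (analytic_at_cst _ _).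
Qed.

Lemma Lie_indicator W X x : open W -> W x -> Lie A X (indicator W) x = 0.
Proof.
move=> oW Wx; have cx := chart_at_dom hA x.
rewrite (Lie_chartE hA _ cx); last by move/analytic_funP : (indicator_analytic oW); exact.
rewrite big1// => b _; rewrite -(near_eq_derive _ (indicator_near oW Wx cx)).
by rewrite derive_cst mul0r.
Qed.

Variable nabla : (M -> 'rV[R]_n) -> (M -> 'rV[R]_n) -> M -> 'rV[R]_n.
Hypothesis hN : affine_connection A nabla.

Lemma nabla_analytic W X Y : open W -> analytic_field A W X -> analytic_field A W Y ->
  analytic_field A W (nabla X Y).
Proof.
move=> oW XW YW; have oneW : analytic_fun A W (indicator W) := indicator_analytic oW.
by have [] := hN oW XW XW YW YW oneW.
Qed.

Lemma nablaDl W X X' Y x : open W -> W x -> analytic_field A W X ->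
  analytic_field A W X' -> analytic_field A W Y ->
  nabla (X + X') Y x = nabla X Y x + nabla X' Y x.
Proof.
move=> oW Wx XW XW' YW.
by have [_ h _ _ _] := hN oW XW XW' YW YW (indicator_analytic oW); exact: h.
Qed.

Lemma nablaDr W X Y Y' x : open W -> W x -> analytic_field A W X ->
  analytic_field A W Y -> analytic_field A W Y' ->
  nabla X (Y + Y') x = nabla X Y x + nabla X Y' x.
Proof.
move=> oW Wx XW YW YW'.
by have [_ _ _ h _] := hN oW XW XW YW YW' (indicator_analytic oW); exact: h.
Qed.

Lemma nablaZl W f X Y x : open W -> W x -> analytic_field A W X ->
  analytic_field A W Y -> analytic_fun A W f ->
  nabla (fun z => f z *: X z) Y x = f x *: nabla X Y x.
Proof.
by move=> oW Wx XW YW fW; have [_ _ h _ _] := hN oW XW XW YW YW fW; exact: h.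
Qed.

Lemma nablaZr W f X Y x : open W -> W x -> analytic_field A W X ->
  analytic_field A W Y -> analytic_fun A W f ->
  nabla X (fun z => f z *: Y z) x = Lie A X f x *: Y x + f x *: nabla X Y x.
Proof.
by move=> oW Wx XW YW fW; have [_ _ _ _ h] := hN oW XW XW YW YW fW; exact: h.
Qed.

Lemma indicator_fieldE W X X' : (forall z, W z -> X z = X' z) ->
  (fun z => indicator W z *: X z) = (fun z => indicator W z *: X' z).
Proof.
move=> XX; apply/funext => z; rewrite /indicator.
by case: asboolP => [/XX ->//|_]; rewrite !scale0r.
Qed.

Lemma indicator1 W x : W x -> indicator W x = 1.
Proof. by move=> Wx; rewrite /indicator asboolT. Qed.

Lemma nabla_locall W X X' Y x : open W -> W x -> analytic_field A W X ->
  analytic_field A W X' -> analytic_field A W Y -> (forall z, W z -> X z = X' z) ->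
  nabla X Y x = nabla X' Y x.
Proof.
move=> oW Wx XW XW' YW XX; have iW := indicator_analytic oW.
rewrite -[LHS]scale1r -(indicator1 Wx) -(nablaZl oW Wx)// (indicator_fieldE XX).
by rewrite (nablaZl oW Wx)// indicator1// scale1r.
Qed.

Lemma nabla_localr W X Y Y' x : open W -> W x -> analytic_field A W X ->
  analytic_field A W Y -> analytic_field A W Y' -> (forall z, W z -> Y z = Y' z) ->
  nabla X Y x = nabla X Y' x.
Proof.
move=> oW Wx XW YW YW' YY; have iW := indicator_analytic oW.
have E Z : analytic_field A W Z -> nabla X Z x = nabla X (fun z => indicator W z *: Z z) x.
  by move=> ZW; rewrite (nablaZr oW Wx)// Lie_indicator// scale0r add0r indicator1// scale1r.
by rewrite E// [RHS]E// (indicator_fieldE YY).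
Qed.

Lemma nabla_suml W (I : Type) (r : seq I) (f : I -> M -> R) (F : I -> M -> 'rV[R]_n) Y x :
  open W -> W x -> (forall t, analytic_fun A W (f t)) ->
  (forall t, analytic_field A W (F t)) -> analytic_field A W Y ->
  nabla (\sum_(t <- r) (fun z => f t z *: F t z)) Y x =
  \sum_(t <- r) f t x *: nabla (F t) Y x.
Proof.
move=> oW Wx fW FW YW; elim: r => [|t r IH].
  rewrite !big_nil.
  have := nablaDl oW Wx (@analytic_field0 W) (@analytic_field0 W) YW.
  by rewrite addr0 => /eqP; rewrite -{1}[nabla 0 Y x]addr0 (inj_eq (addrI _)) => /eqP <-.
have tW t' : analytic_field A W (fun z => f t' z *: F t' z) by exact: analytic_fieldZ.
rewrite !big_cons (nablaDl oW Wx)//; last exact: analytic_field_bigsum.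
by rewrite IH (nablaZl oW Wx).
Qed.

Lemma nabla_sumr W (I : Type) (r : seq I) (f : I -> M -> R) (F : I -> M -> 'rV[R]_n) X x :
  open W -> W x -> (forall t, analytic_fun A W (f t)) ->
  (forall t, analytic_field A W (F t)) -> analytic_field A W X ->
  nabla X (\sum_(t <- r) (fun z => f t z *: F t z)) x =
  \sum_(t <- r) (Lie A X (f t) x *: F t x + f t x *: nabla X (F t) x).
Proof.
move=> oW Wx fW FW XW; elim: r => [|t r IH].
  rewrite !big_nil.
  have := nablaDr oW Wx XW (@analytic_field0 W) (@analytic_field0 W).
  by rewrite addr0 => /eqP; rewrite -{1}[nabla X 0 x]addr0 (inj_eq (addrI _)) => /eqP <-.
have tW t' : analytic_field A W (fun z => f t' z *: F t' z) by exact: analytic_fieldZ.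
rewrite !big_cons (nablaDr oW Wx)//; last exact: analytic_field_bigsum.
by rewrite IH (nablaZr oW Wx).
Qed.

(** The Christoffel symbols of an arbitrary chart, as the row indexed by the upper index; in the
    preferred chart they are [christoffel]. *)
Definition Gam i x (a b : 'I_n) : 'rV[R]_n :=
  vec_in i (nabla (frame i a) (frame i b)) (chart_map i x).

(** On the open domain of the chart both fields are combinations of the coordinate fields with
    analytic coefficients; locality allows this replacement, and the Leibniz rule does the rest. *)
Lemma nabla_chart i X Y x c :
  (forall z, chart_dom i z -> analytic_field_at A X z) ->
  (forall z, chart_dom i z -> analytic_field_at A Y z) -> chart_dom i x ->
  let y := chart_map i x in
  vec_in i (nabla X Y) y 0 c =
  \sum_a vec_in i X y 0 a * 'D_(delta_mx 0 a) (fun y => vec_in i Y y 0 c) y +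
  \sum_a \sum_b vec_in i X y 0 a * vec_in i Y y 0 b * Gam i x a b 0 c.
Proof.
move=> Xi Yi ix y; pose W : set M := chart_dom i.
have oW : open W := open_chart_dom hA i.
have XW : analytic_field A W X by apply/(analytic_fieldP A).
have YW : analytic_field A W Y by apply/(analytic_fieldP A).
have FW a : analytic_field A W (frame i a).
  by apply/(analytic_fieldP A) => z; exact: frame_analytic.
have cW Z a : analytic_field A W Z -> analytic_fun A W (component i Z a).
  move=> /(analytic_fieldP A) ZW; apply/(analytic_funP A) => z Wz.
  by apply: component_analytic => //; exact: ZW.
have sumE Z : analytic_field A W Z ->
    analytic_field A W (\sum_a (fun z => component i Z a z *: frame i a z)) /\
    forall z, W z -> Z z = (\sum_a (fun z => component i Z a z *: frame i a z)) z.
  move=> ZW; split.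
    by apply: analytic_field_bigsum => a; apply: analytic_fieldZ => //; exact: cW.
  by move=> z Wz; rewrite (frame_expansion _ Wz) fct_sumE.
have [XS XE] := sumE X XW; have [YS YE] := sumE Y YW.
have E : nabla X Y x = \sum_b (Lie A X (component i Y b) x *: frame i b x +
   component i Y b x *: \sum_a component i X a x *: nabla (frame i a) (frame i b) x).
  rewrite (nabla_localr oW ix XW YW YS YE) (nabla_sumr _ oW ix)//; last by move=> t; exact: cW.
  apply: eq_bigr => b _; congr (_ + _ *: _).
  rewrite (nabla_locall oW ix XW XS (FW b) XE) (nabla_suml _ oW ix)// => t; exact: cW.
have frameE b : frame i b x *m cchange (chart_at A x) i x = delta_mx 0 b.
  by rewrite -vec_in_map// frame_vec_in// cchange_id// mulmx1.
rewrite /y vec_in_map// E mulmx_suml summxE.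
under eq_bigr do rewrite mulmxDl mxE -!scalemxAl mulmx_suml frameE.
rewrite big_split /=; congr (_ + _).
  rewrite (bigD1 c)//= !mxE !eqxx mulr1 [X in _ + X]big1 ?addr0; last first.
    by move=> b /negbTE bc; rewrite !mxE eq_sym bc andbF mulr0.
  have cY := component_analytic (i := i) c ix (Yi x ix).
  apply: etrans (Lie_chartE hA X ix cY) _.
  apply: eq_bigr => a _.
  apply: etrans (mulrC _ _) _.
  apply: (congr1 (fun t => vec_in i X (chart_map i x) 0 a * t)).
  apply: near_eq_derive; apply: filterS (near_chart hA openT I ix) => z.
  by move=> /(chart_img_inv hA)[_ _ zE]; rewrite /component /= zE.
rewrite exchange_big; apply: eq_bigr => b _ /=.
rewrite mxE summxE mulr_sumr; apply: eq_bigr => a _.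
rewrite -scalemxAl mxE /Gam (vec_in_map hA (nabla _ _) ix).
by rewrite mulrA [component i Y b x * _]mulrC.
Qed.

End Connection.

(** * Bases extracted from spanning sets *)

Section LspanBasis.
Variables (R : realType) (n : nat).

(** Independent rows are added one at a time: if all of [P] lay in the span of [r < n] rows, the
    identity matrix would have rank at most [r]. *)
Lemma lspan_basis (P : set 'rV[R]_n) : lspan P = setT ->
  exists u : 'I_n -> 'rV[R]_n, (forall k, P (u k)) /\ (\matrix_k u k) \in unitmx.
Proof.
move=> PT.
suff H r : (r <= n)%N -> exists u : 'I_r -> 'rV[R]_n,
    (forall k, P (u k)) /\ row_free (\matrix_k u k).
  by have [u [uP uf]] := H n (leqnn n); exists u; rewrite -row_free_unit.
elim: r => [_|r IH rn].
  exists (fun=> 0); split; first by case.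
  by rewrite /row_free flatmx0 mxrank0.
have [u [uP uf]] := IH (ltnW rn); set B := \matrix_k u k in uf.
have [p [Pp pB]] : exists p, P p /\ ~~ (p <= B)%MS.
  apply: contrapT => h.
  have allB (v : 'rV[R]_n) : (v <= B)%MS.
    have : lspan P v by rewrite PT.
    move=> [k [c [e [eP ->]]]]; apply: summx_sub => l _; apply: scalemx_sub.
    by apply/negPn/negP => eB; apply: h; exists (e l).
  have : (1%:M <= B)%MS by apply/row_subP => l; exact: allB.
  move=> /mxrankS; rewrite mxrank1 (eqP uf) => /leq_trans/(_ (leqnn _)).
  by rewrite leqNgt rn.
exists (fun k => if unlift ord0 k is Some j then u j else p); split.
  by move=> k; case: unliftP.
rewrite /row_free eqn_leq rank_leq_row /=.
set C := \matrix_k _.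
have BC : (B <= C)%MS.
  apply/row_subP => j; rewrite rowK (_ : u j = row (lift ord0 j) C) ?row_sub//.
  by rewrite rowK liftK.
have pC : (p <= C)%MS.
  by rewrite (_ : p = row ord0 C) ?row_sub// rowK unlift_none.
have : (B < C)%MS.
  by rewrite ltmxE BC /=; apply: contra pB; exact: submx_trans.
by move/rank_ltmx; rewrite (eqP uf).
Qed.

Lemma unitmx_pairing_eq0 (u : 'I_n -> 'rV[R]_n) (v : 'rV[R]_n) :
  (\matrix_k u k) \in unitmx -> (forall k, pairing (u k) v = 0) -> v = 0.
Proof.
move=> uu uv; have : \matrix_k u k *m v^T = 0.
  apply/matrixP => k a; rewrite ord1 mxE [RHS]mxE -[RHS](uv k).
  by apply: eq_bigr => b _; rewrite !mxE.
move=> /(congr1 (mulmx (invmx (\matrix_k u k)))).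
by rewrite mulKmx// mulmx0 => /(congr1 trmx); rewrite trmxK trmx0.
Qed.

End LspanBasis.

(** * Construction of the metric from the compatibility condition *)

Section GradientMetric.
Variables (R : realType) (n m : nat) (M : topologicalType) (A : atlas R n M).
Variable S : affine_system R n M 'I_m.
Variable nabla : (M -> 'rV[R]_n) -> (M -> 'rV[R]_n) -> M -> 'rV[R]_n.
Hypothesis hA : analytic_manifold A.
Hypothesis hS : control_system A S.
Hypothesis hN : affine_connection A nabla.
Hypothesis hC : compatible A S nabla.
Hypothesis hF : full_rank S nabla.
Hypothesis hD : forall x v, (forall w, pairing (differential A (word_fun A S w) x) v = 0) -> v = 0.
Local Notation V := (word_fun A S).
Local Notation Rf := (word_field S nabla).

Lemma vec_inD (i : chart_idx A) X Y y : vec_in i (X + Y) y = vec_in i X y + vec_in i Y y.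
Proof. by rewrite /vec_in mulmxDl. Qed.

Lemma symmetric_product_analytic X Y : analytic_field A setT X -> analytic_field A setT Y ->
  analytic_field A setT (symmetric_product nabla X Y).
Proof.
by move=> XT YT; apply: analytic_fieldD; apply: (nabla_analytic hA hN) => //; exact: openT.
Qed.

Lemma sys_field_analyticT i : analytic_field A setT (sys_field S i).
Proof. by apply/(analytic_fieldP A) => x _; exact: sys_field_analytic. Qed.

Lemma word_field_analytic w : analytic_field A setT (Rf w).
Proof.
case: w => l j; elim: l => [|i l IH]; first exact: sys_field_analyticT.
by apply: symmetric_product_analytic => //; exact: sys_field_analyticT.
Qed.

Lemma symmetric_product_chart (i : chart_idx A) X Y x c :
  analytic_field A setT X -> analytic_field A setT Y -> chart_dom i x ->
  let y := chart_map i x in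
  vec_in i (symmetric_product nabla X Y) y 0 c =
  \sum_a vec_in i X y 0 a * 'D_(delta_mx 0 a) (fun y => vec_in i Y y 0 c) y +
  \sum_a vec_in i Y y 0 a * 'D_(delta_mx 0 a) (fun y => vec_in i X y 0 c) y +
  \sum_a \sum_b vec_in i X y 0 a * vec_in i Y y 0 b *
     (Gam nabla i x a b 0 c + Gam nabla i x b a 0 c).
Proof.
move=> /(analytic_fieldP A) XT /(analytic_fieldP A) YT ix y.
have Xi z : chart_dom i z -> analytic_field_at A X z by move=> _; exact: XT.
have Yi z : chart_dom i z -> analytic_field_at A Y z by move=> _; exact: YT.
rewrite /symmetric_product vec_inD mxE.
apply: etrans (congr2 (fun s t : R => s + t) (nabla_chart hA hN c Xi Yi ix)
  (nabla_chart hA hN c Yi Xi ix)) _.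
rewrite addrACA; apply: (congr1 (fun t : R => _ + t)).
rewrite [X in _ + X]exchange_big -big_split; apply: eq_bigr => a _ /=.
rewrite -big_split; apply: eq_bigr => b _ /=; rewrite mulrDr; apply: (congr1 (fun t : R => _ + t)).
by apply: (congr1 (fun t : R => t * _)); exact: mulrC.
Qed.

Lemma word_field_basis x : exists ws : 'I_n -> word 'I_m,
  (\matrix_k Rf (ws k) x) \in unitmx.
Proof.
have RE : lspan (range (fun w => Rf w x)) = [set: 'rV[R]_n].
  rewrite eqEsubset; split=> // v _; have : lspan [set X x | X in symmetric_span S nabla] v.
    by rewrite (hF x).
  apply: lspan_sub => _ [_ [k [c [u [uP ->]]]] <-].
  rewrite fct_sumE; apply: lspan_sum => l; have [w _ <-] := uP l.
  by apply: lspan_incl; exists w.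
have [u [uP uu]] := lspan_basis RE.
have /choice[ws wsE] : forall k, exists w, Rf w x = u k.
  by move=> k; have [w _ <-] := uP k; exists w.
by exists ws; rewrite (_ : \matrix_k _ = \matrix_k u k)//; apply/row_matrixP => k; rewrite !rowK.
Qed.

Lemma compatible_swap w w' x :
  pairing (differential A (V w') x) (Rf w x) = pairing (differential A (V w) x) (Rf w' x).
Proof. by have [h _] := hC; have := congr1 (fun f : M -> R => f x) (h w w'). Qed.

(** A basis of values [R_w] determines the matrix [P^-1 Q]. For any other word the two covectors are
    compared on that basis, and condition (a) is applied twice: it moves the pairing onto the
    covectors of the basis words, where linearity in [R_w] is available. *)
Lemma gradient_metric_exists x : exists G : 'M[R]_n, forall w, differential A (V w) x = Rf w x *m G.
Proof.
have [ws wsu] := word_field_basis x.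
set P := \matrix_k Rf (ws k) x in wsu.
pose Q := \matrix_k differential A (V (ws k)) x.
exists (invmx P *m Q) => w; rewrite mulmxA; set e := Rf w x *m invmx P.
apply/eqP; rewrite -subr_eq0; apply/eqP/(unitmx_pairing_eq0 wsu) => l.
have eR : Rf w x = \sum_k e 0 k *: Rf (ws k) x.
  rewrite -[LHS](mulmxKV wsu) -/e mulmx_sum_row; apply: eq_bigr => k _.
  by rewrite rowK.
have eQ : e *m Q = \sum_k e 0 k *: differential A (V (ws k)) x.
  by rewrite mulmx_sum_row; apply: eq_bigr => k _; rewrite rowK.
rewrite pairingC pairingE mulmxBl mxE -pairingE [X in _ + X]mxE -pairingE.
rewrite compatible_swap// -/V pairingC eR pairing_suml eQ pairing_suml.
apply/eqP; rewrite subr_eq0; apply/eqP; apply: eq_bigr => k _.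
by rewrite pairingC compatible_swap.
Qed.

Definition gradient_metric : M -> 'M[R]_n := projT1 (choice gradient_metric_exists).

Lemma gradient_metricE x w : differential A (V w) x = Rf w x *m gradient_metric x.
Proof. exact: (projT2 (choice gradient_metric_exists)). Qed.

(** Condition (a) is the symmetry of the Gram matrix in a basis of values [R_w]. *)
Lemma gradient_metric_sym x : (gradient_metric x)^T = gradient_metric x.
Proof.
have [ws wsu] := word_field_basis x.
set P := \matrix_k Rf (ws k) x in wsu.
have PG : P *m (gradient_metric x)^T *m P^T = P *m gradient_metric x *m P^T.
  apply/matrixP => k l.
  have E (H : 'M[R]_n) k' l' : (P *m H *m P^T) k' l' = pairing (Rf (ws k') x *m H) (Rf (ws l') x).
    have rP : Rf (ws k') x *m H = row k' (P *m H) by rewrite row_mul rowK.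
    rewrite rP mxE; apply: eq_bigr => a _.
    by rewrite [row _ _ _ _]mxE [P^T _ _]mxE [P _ _]mxE.
  rewrite !E pairing_trmx pairingC -!gradient_metricE.
  by rewrite compatible_swap.
have PTu : P^T \in unitmx by rewrite unitmx_tr.
by move/(can_inj (mulmxK PTu))/(can_inj (mulKmx wsu)) : PG.
Qed.

(** By symmetry a vector in the kernel is annihilated by every [dV_w = R_w G], hence is zero by
    [hD]: this is where observability makes the form nondegenerate. *)
Lemma gradient_metric_unit x : gradient_metric x \in unitmx.
Proof.
rewrite -row_free_unit -kermx_eq0; apply/rowV0P => v /sub_kermxP vG.
apply: (hD (x := x)) => w; rewrite gradient_metricE -[gradient_metric x]trmxK pairing_trmx gradient_metric_sym vG.
by rewrite pairingE trmx0 mulmx0 mxE.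
Qed.

Lemma form_in_map (i : chart_idx A) (G : M -> 'M[R]_n) x : chart_dom i x ->
  form_in i G (chart_map i x) =
  cchange i (chart_at A x) x *m G x *m (cchange i (chart_at A x) x)^T.
Proof. by move=> ix; rewrite /form_in chart_mapK// coord_changeE. Qed.

Lemma covec_flat (i : chart_idx A) (G : M -> 'M[R]_n) X x : chart_dom i x ->
  covec_in i (flat G X) (chart_map i x) = vec_in i X (chart_map i x) *m form_in i G (chart_map i x).
Proof.
move=> ix; rewrite form_in_map// !mulmxA -vec_in_change//; last exact: chart_at_dom.
by rewrite vec_in_at// /covec_in chart_mapK// coord_changeE.
Qed.

Lemma cgrad_form (G : M -> 'M[R]_n) (i : chart_idx A) w x :
  (forall z w, differential A (V w) z = Rf w z *m G z) -> chart_dom i x ->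
  cgrad i (V w) (chart_map i x) = vec_in i (Rf w) (chart_map i x) *m form_in i G (chart_map i x).
Proof.
move=> GE ix; have cx := chart_at_dom hA x.
rewrite (cgrad_change hA ix cx); last first.
  by apply: (analytic_fun_at_diff cx); exact: word_fun_analytic.
rewrite -differentialE GE form_in_map// !mulmxA -vec_in_change// vec_in_at//.
Qed.

Lemma chart_basis (i : chart_idx A) x : chart_dom i x -> exists ws : 'I_n -> word 'I_m,
  (\matrix_k vec_in i (Rf (ws k)) (chart_map i x)) \in unitmx.
Proof.
move=> ix; have cx := chart_at_dom hA x; have [ws wsu] := word_field_basis x; exists ws.
have -> : \matrix_k vec_in i (Rf (ws k)) (chart_map i x) =
    \matrix_k Rf (ws k) x *m cchange (chart_at A x) i x.
  by apply/row_matrixP => k; rewrite row_mul !rowK vec_in_map.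
by rewrite unitmx_mul wsu cchange_unit.
Qed.

(** The words of a basis at [x] still give a basis nearby, so that in the chart the form is [P^-1 Q]
    with analytic [P] and [Q]. *)
Lemma form_metric_analytic (i : chart_idx A) x : chart_dom i x ->
  analytic_mx_at (form_in i gradient_metric) (chart_map i x).
Proof.
move=> ix; have [ws Pu] := chart_basis ix.
pose P y := \matrix_k vec_in i (Rf (ws k)) y.
pose Q y := \matrix_k cgrad i (V (ws k)) y.
have Pa : analytic_mx_at P (chart_map i x).
  move=> k b; under eq_fun do rewrite mxE.
  by move/(analytic_fieldP A) : (word_field_analytic (ws k)) => /(_ x I i ix b).
have Qa : analytic_mx_at Q (chart_map i x).
  by move=> k b; under eq_fun do rewrite mxE; exact: (cgrad_analytic hA hS _ ix).
have inv_a : analytic_mx_at (fun y => invmx (P y) *m Q y) (chart_map i x).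
  by apply: analytic_mxM => //; exact: analytic_invmx.
move=> a b; apply: analytic_at_near (inv_a a b).
apply: filterS2 (near_unitmx Pa Pu) (near_chart hA openT I ix) => y yu /(chart_img_inv hA)[iy _ yE].
rewrite (_ : Q y = P y *m form_in i gradient_metric y) ?mulKmx//.
apply/row_matrixP => k; rewrite row_mul !rowK.
by have := cgrad_form (ws k) gradient_metricE iy; rewrite yE.
Qed.

Lemma gradient_metric_pseudo_riemannian : pseudo_riemannian A gradient_metric.
Proof.
split; [exact: gradient_metric_sym|exact: gradient_metric_unit|].
by move=> i a b _ [x [ix _] <-]; exact: form_metric_analytic.
Qed.

Lemma sys_field_gradient j : sys_field S (Some j) = gradient A gradient_metric (sys_output S j).
Proof.
apply/funext => x; rewrite /gradient -[sys_output S j]/(V ([::], j)) gradient_metricE.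
by rewrite mulmxK// gradient_metric_unit.
Qed.

End GradientMetric.

(** Here [dX b c] and [dg b c d] stand for the derivatives along coordinate [b] of [X^c] and [g_cd],
    and [K] for the symmetrised Christoffel symbols. The first sum is the Lie derivative along [Y]
    of the covector [g X], the second is [g] applied to the symmetric product of [Y] and [X]; on the
    right stands the curl of [g Y] corrected by what becomes [torsion_term]. *)
Lemma christoffel_identity (R : comNzRingType) (n : nat) (X Y : 'I_n -> R)
    (dX dY g : 'I_n -> 'I_n -> R) (dg K : 'I_n -> 'I_n -> 'I_n -> R) (d : 'I_n) :
  (forall a b, g a b = g b a) ->
  \sum_b ((\sum_c (dX b c * g c d + X c * dg b c d)) * Y b + (\sum_c X c * g c b) * dY d b) -
  \sum_c g d c * (\sum_a Y a * dX a c + \sum_a X a * dY a c +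
                  \sum_a \sum_b Y a * X b * K a b c) =
  \sum_a X a * (\sum_c (dY d c * g c a + Y c * dg d c a) -
                \sum_c (dY a c * g c d + Y c * dg a c d) -
                \sum_b Y b * (\sum_c g d c * K b a c + dg d b a - dg a b d - dg b a d)).
Proof.
move=> gC.
transitivity (\sum_a \sum_b (Y b * X a * dg b a d + X a * g b a * dY d b
    - X a * g b d * dY a b - \sum_c g d c * (Y b * X a * K b a c))).
  have -> : \sum_c g d c * (\sum_a Y a * dX a c + \sum_a X a * dY a c +
                  \sum_a \sum_b Y a * X b * K a b c) =
    \sum_a \sum_b (Y b * dX b a * g a d + X a * g b d * dY a b +
      \sum_c g d c * (Y b * X a * K b a c)).
    transitivity (\sum_c g d c * (\sum_a Y a * dX a c) + \sum_c g d c * (\sum_a X a * dY a c) +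
       \sum_c g d c * \sum_a \sum_b Y a * X b * K a b c).
      by rewrite -!big_split; apply: eq_bigr => c _ /=; rewrite !mulrDr.
    have -> : \sum_c g d c * (\sum_a Y a * dX a c) = \sum_a \sum_b Y b * dX b a * g a d.
      by apply: eq_bigr => c _; rewrite mulr_sumr; apply: eq_bigr => a _; rewrite gC mulrC.
    have -> : \sum_c g d c * (\sum_a X a * dY a c) = \sum_a \sum_b X a * g b d * dY a b.
      rewrite exchange_big; apply: eq_bigr => c _ /=; rewrite mulr_sumr.
      by apply: eq_bigr => a _; rewrite gC; ring.
    have -> : \sum_c g d c * (\sum_a \sum_b Y a * X b * K a b c) =
        \sum_a \sum_b \sum_c g d c * (Y b * X a * K b a c).
      transitivity (\sum_c \sum_a \sum_b g d c * (Y a * X b * K a b c)).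
        by apply: eq_bigr => c _; rewrite mulr_sumr; apply: eq_bigr => a _; rewrite mulr_sumr.
      rewrite exchange_big [RHS]exchange_big; apply: eq_bigr => a _ /=.
      by rewrite exchange_big.
    by rewrite -!big_split; apply: eq_bigr => a _ /=; rewrite -!big_split.
  have -> : \sum_b ((\sum_c (dX b c * g c d + X c * dg b c d)) * Y b + (\sum_c X c * g c b) * dY d b)
     = \sum_a \sum_b (Y b * dX b a * g a d + Y b * X a * dg b a d + X a * g b a * dY d b).
    rewrite exchange_big; apply: eq_bigr => b _ /=; rewrite !mulr_suml -big_split.
    by apply: eq_bigr => c _ /=; rewrite (gC b c); ring.
  rewrite -sumrB; apply: eq_bigr => a _; rewrite -sumrB; apply: eq_bigr => b _.
  by move: (\sum_c _) => s; ring.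
apply: eq_bigr => a _; rewrite -!sumrB mulr_sumr; apply: eq_bigr => b _.
have -> : \sum_c g d c * (Y b * X a * K b a c) = Y b * X a * \sum_c g d c * K b a c.
  by rewrite mulr_sumr; apply: eq_bigr => c _; ring.
by move: (\sum_c _) => s; ring.
Qed.

(** * Metric compatibility of the connection and closedness of the drift *)

Section ClosedDrift.
Variables (R : realType) (n m : nat) (M : topologicalType) (A : atlas R n M).
Variable S : affine_system R n M 'I_m.
Variable nabla : (M -> 'rV[R]_n) -> (M -> 'rV[R]_n) -> M -> 'rV[R]_n.
Hypothesis hA : analytic_manifold A.
Hypothesis hS : control_system A S.
Hypothesis hN : affine_connection A nabla.
Hypothesis hC : compatible A S nabla.
Hypothesis hF : full_rank S nabla.
Local Notation V := (word_fun A S).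
Local Notation Rf := (word_field S nabla).
Variable G : M -> 'M[R]_n.
Hypothesis Gsym : forall x, (G x)^T = G x.
Hypothesis GE : forall x w, differential A (V w) x = Rf w x *m G x.
Hypothesis Gan : forall (i : chart_idx A) x, chart_dom i x ->
  analytic_mx_at (form_in i G) (chart_map i x).
Variables (i : chart_idx A) (x : M).
Hypothesis ix : chart_dom i x.
Let y : 'rV[R]_n := chart_map i x.
Local Notation D a f := ('D_(delta_mx 0 a) f y).

Lemma derive_sum_mul k (f h : 'I_k -> 'rV[R]_n -> R) (z : 'rV[R]_n) a :
  (forall c, analytic_at (f c) z) -> (forall c, analytic_at (h c) z) ->
  'D_(delta_mx 0 a) (fun y => \sum_c f c y * h c y) z =
  \sum_c ('D_(delta_mx 0 a) (f c) z * h c z + f c z * 'D_(delta_mx 0 a) (h c) z).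
Proof.
move=> fa ha.
have -> : (fun y => \sum_c f c y * h c y) = \sum_c (f c * h c).
  by apply/funext => t; rewrite fct_sumE.
have fd c v : derivable (f c) z v by apply/diff_derivable/analytic_at_differentiable.
have hd c v : derivable (h c) z v by apply/diff_derivable/analytic_at_differentiable.
rewrite derive_sum; last by move=> c; exact: derivableM.
apply: eq_bigr => c _; apply: etrans (deriveM (fd c _) (hd c _)) _; apply: etrans (addrC _ _) _.
by apply: (congr1 (fun t => t + _)); exact: mulrC.
Qed.

Let g (a b : 'I_n) : 'rV[R]_n -> R := fun z => form_in i G z a b.
Let X w (a : 'I_n) : 'rV[R]_n -> R := fun z => vec_in i (Rf w) z 0 a.
Let theta w (b : 'I_n) : 'rV[R]_n -> R := 'D_(delta_mx 0 b) (V w \o chart_inv i).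

Let gC a b : g a b = g b a.
Proof.
apply/funext => z; rewrite /g /form_in; set J := coord_change _ _ _ _; set z' := chart_inv i z.
have E : (J *m G z' *m J^T)^T = J *m G z' *m J^T by rewrite !trmx_mul trmxK Gsym mulmxA.
by rewrite -[in LHS]E mxE.
Qed.

Let ga a b : analytic_at (g a b) y. Proof. exact: Gan. Qed.

Let Xa w a : analytic_at (X w a) y.
Proof.
by move/(analytic_fieldP A) : (word_field_analytic hA hS hN w) => /(_ x I i ix a).
Qed.

Let Va w : analytic_at (V w \o chart_inv i) y.
Proof. exact: (word_fun_analytic hA hS w ix). Qed.

Let theta_near w b : \forall z \near y, \sum_c X w c z * g c b z = theta w b z.
Proof.
apply: filterS (near_chart hA openT I ix) => z /(chart_img_inv hA)[iz _ zE].
have := cgrad_form hA hS w GE iz; rewrite zE => /rowP/(_ b).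
by rewrite mxE [RHS]mxE => e; exact: esym e.
Qed.

Let theta_val w b : theta w b y = \sum_c X w c y * g c b y.
Proof. by rewrite (nbhs_singleton (theta_near w b)). Qed.

Let theta_derive w a b :
  D a (theta w b) = \sum_c (D a (X w c) * g c b y + X w c y * D a (g c b)).
Proof.
apply: etrans (esym (near_eq_derive _ (theta_near w b))) _.
by apply: derive_sum_mul => c.
Qed.

Let theta_closed w a b : D a (theta w b) = D b (theta w a).
Proof. exact: derive_partial_comm. Qed.

Let K a b c : R := Gam nabla i x a b 0 c + Gam nabla i x b a 0 c.

(** The symmetrised Christoffel symbols of [nabla] with lowered index, minus twice the Levi-Civita
    symbols of the first kind of [G]. It vanishes exactly when the symmetric part of [nabla] is that
    of the Levi-Civita connection. *)
Definition torsion_term d a b : R :=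
  \sum_c g d c y * K b a c + D d (g b a) - D a (g b d) - D b (g a d).

(** The hypothesis on [Y] covers the fields [R_w], by condition (b), as well as the drift. It says
    that [G] maps the symmetric product of [Y] and [R_w] to the differential of [L_Y V_w];
    [christoffel_identity] turns this into the claim contracted with [R_w], and the [R_w] span. *)
Lemma flat_curl Y : analytic_field A setT Y ->
  (forall w w'', Lie A (symmetric_product nabla Y (Rf w)) (V w'') x =
                 Lie A (Rf w'') (Lie A Y (V w)) x) ->
  forall d a, D d (fun z => covec_in i (flat G Y) z 0 a) - D a (fun z => covec_in i (flat G Y) z 0 d) =
    \sum_b vec_in i Y y 0 b * torsion_term d a b.
Proof.
move=> YT hY d0 a0.
pose Yc (a : 'I_n) : 'rV[R]_n -> R := fun z => vec_in i Y z 0 a.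
have Ya a : analytic_at (Yc a) y by move/(analytic_fieldP A) : YT => /(_ x I i ix a).
have omegaE d a : D d (fun z => covec_in i (flat G Y) z 0 a) =
    \sum_c (D d (Yc c) * g c a y + Yc c y * D d (g c a)).
  rewrite -(derive_sum_mul d Ya (fun c => ga c a)); apply: near_eq_derive.
  apply: filterS (near_chart hA openT I ix) => z /(chart_img_inv hA)[iz _ zE].
  by have := covec_flat hA G Y iz; rewrite zE => ->; rewrite mxE.
have [ws wsu] := chart_basis hA hF ix.
have Lie_near w : \forall z \near y,
    \sum_b theta w b z * Yc b z = (Lie A Y (V w) \o chart_inv i) z.
  apply: filterS (near_chart hA openT I ix) => z /(chart_img_inv hA)[iz _ zE].
  have := Lie_chartE hA Y iz (@word_fun_analytic _ _ _ _ _ _ hA hS w (chart_inv i z)).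
  by rewrite zE.
(* The equality of functions in [hY], tested on a basis of values [R_w''], becomes an equality of
   covectors. *)
have step1 w d : \sum_c g d c y * vec_in i (symmetric_product nabla Y (Rf w)) y 0 c =
    \sum_b (D d (theta w b) * Yc b y + theta w b y * D d (Yc b)).
  have thetaa b : analytic_at (theta w b) y by exact: analytic_at_partial.
  rewrite -(derive_sum_mul d thetaa Ya).
  have : \row_d' (\sum_c g d' c y * vec_in i (symmetric_product nabla Y (Rf w)) y 0 c -
      D d' (fun z => \sum_b theta w b z * Yc b z)) = 0 :> 'rV[R]_n.
    apply: (unitmx_pairing_eq0 wsu) => k; set w'' := ws k.
    have := hY w w''.
    rewrite (Lie_chart hA _ ix (@word_fun_analytic _ _ _ _ _ _ hA hS w'' x)).
    have LYa : analytic_fun_at A (Lie A Y (V w)) x.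
      apply: (analytic_fun_at_Lie hA openT I) => [z _|]; first exact: word_fun_analytic.
      by move/(analytic_fieldP A) : YT; apply.
    rewrite (Lie_chartE hA _ ix LYa) (cgrad_form hA hS w'' GE ix).
    move=> E; rewrite /pairing; under eq_bigr do rewrite [X in _ * X]mxE mulrBr.
    rewrite sumrB; apply/eqP; rewrite subr_eq0; apply/eqP.
    transitivity (pairing (vec_in i (Rf w'') y *m form_in i G y)
        (vec_in i (symmetric_product nabla Y (Rf w)) y)).
      rewrite /pairing; under [RHS]eq_bigr do rewrite mxE mulr_suml.
      rewrite [RHS]exchange_big; apply: eq_bigr => d' _; rewrite mulr_sumr.
      by apply: eq_bigr => c _; rewrite mulrA.
    apply: etrans E _; apply: eq_bigr => d' _; apply: etrans (mulrC _ _) _.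
    apply: (congr1 (fun t => _ * t)).
    exact: esym (near_eq_derive _ (Lie_near w)).
  move=> /rowP/(_ d); rewrite [LHS]mxE [RHS]mxE => /eqP; rewrite subr_eq0 => /eqP.
  exact.
pose diffv : 'rV[R]_n := \row_a (D d0 (fun z => covec_in i (flat G Y) z 0 a) -
    D a (fun z => covec_in i (flat G Y) z 0 d0) - \sum_b vec_in i Y y 0 b * torsion_term d0 a b).
suff : diffv = 0 by move=> /rowP/(_ a0); rewrite [LHS]mxE [RHS]mxE => /eqP; rewrite subr_eq0 => /eqP.
apply: (unitmx_pairing_eq0 wsu) => k; set w := ws k.
have := step1 w d0.
under eq_bigr do rewrite (symmetric_product_chart hA hN _ YT (word_field_analytic hA hS hN w) ix).
(* Closedness of [dV_w] exchanges the two indices, so that the derivative of [theta] is taken along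
   [Y], as [christoffel_identity] expects. *)
under [in RHS]eq_bigr do rewrite theta_closed theta_derive theta_val.
move=> /esym/eqP; rewrite -subr_eq0 => /eqP E.
have ggC a b : g a b y = g b a y by rewrite gC.
have := christoffel_identity (fun c => X w c y) (fun c => Yc c y) (fun a c => D a (X w c))
  (fun a c => D a (Yc c)) (fun a b c => D a (g b c)) K d0 ggC.
move=> I0; apply: etrans (etrans (esym I0) E).
apply: eq_bigr => a _; apply: (congr1 (fun t => X w a y * t)).
rewrite [LHS]mxE (omegaE d0 a) (omegaE a d0).
by [].
Qed.

(** For [Y = R_w] the lowered field is [dV_w], whose curl vanishes; the contractions of
    [torsion_term] with a basis are therefore zero. *)
Lemma torsion_term_eq0 d a b : torsion_term d a b = 0.
Proof.
have [ws wsu] := chart_basis hA hF ix.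
suff E0 : \row_c torsion_term d a c = 0 by move/rowP/(_ b) : E0; rewrite !mxE.
apply: (unitmx_pairing_eq0 wsu) => k; set w := ws k.
have hY w1 w2 : Lie A (symmetric_product nabla (Rf w) (Rf w1)) (V w2) x =
    Lie A (Rf w2) (Lie A (Rf w) (V w1)) x.
  by have [_ h] := hC; have := congr1 (fun f : M -> R => f x) (h w w1 w2).
have := flat_curl (word_field_analytic hA hS hN w) hY d a.
have omega_near c : \forall z \near y, covec_in i (flat G (Rf w)) z 0 c = theta w c z.
  apply: filterS2 (near_chart hA openT I ix) (theta_near w c) => z /(chart_img_inv hA)[iz _ zE] <-.
  by have := covec_flat hA G (Rf w) iz; rewrite zE => ->; rewrite mxE.
have E1 := near_eq_derive (delta_mx 0 d) (omega_near a).
have E2 := near_eq_derive (delta_mx 0 a) (omega_near d).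
move=> h; have {}h : 0 = \sum_b vec_in i (Rf w) y 0 b * torsion_term d a b.
  apply: etrans h; apply/esym/eqP; rewrite subr_eq0; apply/eqP.
  by apply: etrans E1 _; apply: etrans _ (esym E2); exact: theta_closed.
apply: etrans _ (esym h); apply: eq_bigr => c _.
by apply: (congr1 (fun t => _ * t)); rewrite mxE.
Qed.

(** Prefixing the letter [None] gives both the symmetric product of [g_0] with [R_w] and the
    derivative of [V_w] along [g_0], so the hypothesis of [flat_curl] for the drift is an instance
    of condition (a). *)
Lemma drift_closed a b :
  D a (fun z => covec_in i (flat G (sys_field S None)) z 0 b) =
  D b (fun z => covec_in i (flat G (sys_field S None)) z 0 a).
Proof.
have hY w w2 : Lie A (symmetric_product nabla (sys_field S None) (Rf w)) (V w2) x =
    Lie A (Rf w2) (Lie A (sys_field S None) (V w)) x.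
  have [h _] := hC; case: w => l j.
  by have := congr1 (fun f : M -> R => f x) (h (None :: l, j) w2).
have := flat_curl (sys_field_analyticT hS None) hY a b.
rewrite big1 => [/eqP|c _]; last by rewrite torsion_term_eq0 mulr0.
by rewrite subr_eq0 => /eqP.
Qed.

End ClosedDrift.

(** * Differentials of functions in bundle coordinates *)

Section BundleCharts.
Variables (R : realType) (n : nat).

Lemma Lie_diff p (T : Type) (A : atlas R p T) (Z : T -> 'rV[R]_p) (F : T -> R) z :
  let i := chart_at A z in
  differentiable (F \o chart_inv i) (chart_map i z) ->
  Lie A Z F z = 'd (F \o chart_inv i) (chart_map i z) (Z z).
Proof.
move=> i Fz; rewrite derive_delta// /Lie pairingC /pairing; apply: eq_bigr => a _.
by rewrite mxE.
Qed.

Lemma Lie_mul p (T : Type) (A : atlas R p T) (Z : T -> 'rV[R]_p) (F K : T -> R) z :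
  let i := chart_at A z in
  differentiable (F \o chart_inv i) (chart_map i z) ->
  differentiable (K \o chart_inv i) (chart_map i z) ->
  chart_inv i (chart_map i z) = z ->
  Lie A Z (fun z => F z * K z) z = F z * Lie A Z K z + K z * Lie A Z F z.
Proof.
move=> i Fz Kz iz; rewrite !Lie_diff//; last exact: differentiableM.
have -> : (fun z => F z * K z) \o chart_inv i = (F \o chart_inv i) * (K \o chart_inv i) by [].
apply: etrans (congr1 (fun h : 'rV[R]_p -> R => h (Z z)) (diffM Fz Kz)) _.
by rewrite !fctE /= iz.
Qed.

Lemma Lie_cst p (T : Type) (A : atlas R p T) (Z : T -> 'rV[R]_p) (e : R) z :
  Lie A Z (fun=> e) z = 0.
Proof.
rewrite Lie_diff; last exact: differentiable_cst.
by rewrite (_ : (fun=> e) \o _ = cst e)// diff_cst.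
Qed.

Lemma near_lsubmx (y : 'rV[R]_(n + n)) (P : set 'rV[R]_n) :
  (\forall t \near lsubmx y, P t) -> \forall y' \near y, P (lsubmx y').
Proof. by move=> h; have := differentiable_continuous (@differentiable_lsubmx _ 1 n n y); apply. Qed.

Lemma diff_lsubmx_comp (f : 'rV[R]_n -> R) (y : 'rV[R]_(n + n)) :
  differentiable f (lsubmx y) ->
  differentiable (f \o lsubmx) y /\
  forall w, 'd (f \o lsubmx) y w = 'd f (lsubmx y) (lsubmx w).
Proof.
move=> fy; have ly := @differentiable_lsubmx _ 1 n n y.
split=> [|w]; first exact: differentiable_comp.
have dl : 'd lsubmx y = lsubmx :> ('rV[R]_(n + n) -> 'rV[R]_n).
  exact/diff_lin/continuous_lsubmx.
by rewrite diff_comp//= dl.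
Qed.

(** Functions linear in the fibre; in bundle coordinates both [V^c] on the tangent bundle and [V^X]
    on the cotangent bundle have this form. *)
Lemma diff_fibre_pairing (F : 'I_n -> 'rV[R]_n -> R) (y : 'rV[R]_(n + n)) :
  (forall c, differentiable (F c) (lsubmx y)) ->
  let K := fun y' : 'rV[R]_(n + n) => \sum_c rsubmx y' 0 c * F c (lsubmx y') in
  differentiable K y /\
  forall w, 'd K y w =
    \sum_c (rsubmx y 0 c * 'd (F c) (lsubmx y) (lsubmx w) + rsubmx w 0 c * F c (lsubmx y)).
Proof.
move=> Fy K.
pose r c : 'rV[R]_(n + n) -> R := fun y' => rsubmx y' 0 c.
have rd c : differentiable (r c) y /\ forall w, 'd (r c) y w = r c w.
  have -> : r c = (fun y' : 'rV[R]_(n + n) => y' 0 (rshift n c)).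
    by apply/funext => t; rewrite /r mxE.
  have yd := @differentiable_coord _ 1 (n + n) y 0 (rshift n c).
  split=> // w.
  have @f : {linear 'rV[R]_(n + n) -> R}.
    by exists (fun N : 'rV[R]_(n + n) => N 0 (rshift n c)); do 2![eexists]; do ?[constructor];
     rewrite ?mxE// => ? *; rewrite ?mxE//; move=> ?; rewrite !mxE.
  have -> : (fun y' : 'rV[R]_(n + n) => y' 0 (rshift n c)) = f by [].
  by rewrite diff_lin//; exact: coord_continuous.
have pd c : differentiable (r c * (F c \o lsubmx)) y /\ forall w,
    'd (r c * (F c \o lsubmx)) y w =
     r c y * 'd (F c) (lsubmx y) (lsubmx w) + r c w * F c (lsubmx y).
  have [r1 r2] := rd c; have [f1 f2] := diff_lsubmx_comp (Fy c).
  split=> [|w]; first exact: differentiableM.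
  apply: etrans (congr1 (fun h : 'rV[R]_(n + n) -> R => h w) (diffM r1 f1)) _.
  apply: etrans (congr2 (fun s t : R => r c y * s + F c (lsubmx y) * t) (f2 w) (r2 w)) _.
  by apply: (congr1 (fun t => _ + t)); exact: mulrC.
have KE : K = \sum_c (r c * (F c \o lsubmx)).
  by apply/funext => t; rewrite /K fct_sumE.
split; first by rewrite KE; apply: differentiable_sum => c; have [] := pd c.
move=> w; rewrite KE -deriveE; last by apply: differentiable_sum => c; have [] := pd c.
rewrite derive_sum; last by move=> c; apply: diff_derivable; have [] := pd c.
apply: eq_bigr => c _; have [p1 p2] := pd c.
by apply: etrans (deriveE _ p1) _; rewrite p2.
Qed.

End BundleCharts.

(** * Complete and vertical lifts on the tangent bundle *)

Section Lifts.
Variables (R : realType) (n m : nat) (M : topologicalType) (A : atlas R n M).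
Hypothesis hA : analytic_manifold A.
Local Notation At := (tangent_atlas A).
Local Notation Ac := (cotangent_atlas A).
Implicit Types (f : M -> R) (X Y : M -> 'rV[R]_n).

Lemma tangent_chart_map x v :
  chart_map (chart_at At (x, v)) (x, v) = row_mx (chart_map (chart_at A x) x) v.
Proof.
have cx := chart_at_dom hA x.
by rewrite /= coord_changeE cchange_id// mulmx1.
Qed.

Lemma cotangent_chart_map x v :
  chart_map (chart_at Ac (x, v)) (x, v) = row_mx (chart_map (chart_at A x) x) v.
Proof.
have cx := chart_at_dom hA x.
by rewrite /= coord_changeE cchange_id// trmx1 mulmx1.
Qed.

Lemma tangent_chart_mapK x v :
  chart_inv (chart_at At (x, v)) (chart_map (chart_at At (x, v)) (x, v)) = (x, v).
Proof.
have cx := chart_at_dom hA x.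
by rewrite tangent_chart_map /= row_mxKl row_mxKr chart_mapK// coord_changeE cchange_id// mulmx1.
Qed.

Lemma vlift_diff f x (v : 'rV[R]_n) : analytic_fun_at A f x ->
  let i := chart_at A x in let y := row_mx (chart_map i x) v in
  differentiable ((f \o chart_inv i) \o lsubmx) y /\
  forall w, 'd ((f \o chart_inv i) \o lsubmx) y w = pairing (differential A f x) (lsubmx w).
Proof.
move=> fx i y; have cx := chart_at_dom hA x.
have fd : differentiable (f \o chart_inv i) (lsubmx y).
  by rewrite row_mxKl; exact: (analytic_fun_at_diff cx fx).
have [d1 d2] := diff_lsubmx_comp fd; split=> // w.
by rewrite d2 row_mxKl diff_cgrad//; rewrite row_mxKl in fd.
Qed.

Lemma Lie_tangent_vlift (Z : M * 'rV[R]_n -> 'rV[R]_(n + n)) f x v :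
  analytic_fun_at A f x ->
  Lie At Z (fun_vlift f) (x, v) = pairing (differential A f x) (lsubmx (Z (x, v))).
Proof.
move=> fx; have [d1 d2] := vlift_diff v fx.
by rewrite Lie_diff tangent_chart_map; [exact: d2|exact: d1].
Qed.

Lemma Lie_cotangent_vlift (Z : M * 'rV[R]_n -> 'rV[R]_(n + n)) f x v :
  analytic_fun_at A f x ->
  Lie Ac Z (fun_vlift f) (x, v) = pairing (differential A f x) (lsubmx (Z (x, v))).
Proof.
move=> fx; have [d1 d2] := vlift_diff v fx.
by rewrite Lie_diff cotangent_chart_map; [exact: d2|exact: d1].
Qed.

Lemma near_chart_lsubmx (i : chart_idx A) x (v : 'rV[R]_n) : chart_dom i x ->
  \forall y \near row_mx (chart_map i x) v, chart_img i setT (lsubmx y).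
Proof.
move=> ix; apply: (near_lsubmx (P := chart_img i setT)).
by rewrite row_mxKl; exact: (near_chart hA openT I ix).
Qed.

Lemma clift_diff f x v : (forall z, analytic_fun_at A f z) ->
  let i := chart_at At (x, v) in
  differentiable (fun_clift A f \o chart_inv i) (chart_map i (x, v)).
Proof.
move=> fa i; have cx := chart_at_dom hA x.
pose F b : 'rV[R]_n -> R := 'D_(delta_mx 0 b) (f \o chart_inv (chart_at A x)).
have Fd c : differentiable (F c) (lsubmx (chart_map i (x, v))).
  rewrite tangent_chart_map row_mxKl.
  by apply/analytic_at_differentiable/analytic_at_partial; exact: fa.
have [+ _] := diff_fibre_pairing Fd.
set K := (fun _ => _) => Kd.
apply: near_eq_differentiable Kd.
have := near_chart_lsubmx v cx; rewrite -[row_mx _ _]tangent_chart_map; apply: filterS => y /(chart_img_inv hA)[iy _ yE].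
set x' := chart_inv (chart_at A x) (lsubmx y) in iy yE.
have cx' := chart_at_dom hA x'.
rewrite /K /= /fun_clift /= -/x' coord_changeE.
rewrite -pairing_trmx.
have := cgrad_change hA iy cx' (analytic_fun_at_diff cx' (fa x')).
rewrite -differentialE yE => <-.
by rewrite /pairing; apply: eq_bigr => b _; rewrite mulrC; apply: (congr1 (fun t => t * _)); rewrite mxE.
Qed.

Lemma tangent_vec_in (Z : M * 'rV[R]_n -> 'rV[R]_(n + n)) x v :
  @vec_in _ _ _ At (chart_at A x) Z (row_mx (chart_map (chart_at A x) x) v) = Z (x, v).
Proof.
have cx := chart_at_dom hA x; set i := chart_at A x in cx *.
have invE : @chart_inv _ _ _ At i (row_mx (chart_map i x) v) = (x, v).
  by have := tangent_chart_mapK x v; rewrite (tangent_chart_map x v).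
rewrite /vec_in invE /coord_change /= jacobian_near_id ?mulmx1//.
have mapE : row_mx (chart_map i x) (v *m coord_change A (chart_at A x) i x) = row_mx (chart_map i x) v.
  by rewrite coord_changeE cchange_id// mulmx1.
rewrite mapE.
apply: filterS (near_chart_lsubmx v cx) => y /(chart_img_inv hA)[iy _ yE].
rewrite /transition /= coord_changeE -mulmxA cchangeK//; last exact: chart_at_dom.
by rewrite mulmx1 yE hsubmxK.
Qed.

(** Where [f^c] is nonzero one divides. If [df] is nonzero at [x] but vanishes on [v], the vectors
    [v + t u] with [df(u)] nonzero and [t] small approach [v], and the continuity of [Z] gives the
    value there. *)
Lemma fibre_extension (Z : M * 'rV[R]_n -> 'rV[R]_(n + n)) f x (c : R) :
  analytic_field At setT Z -> analytic_fun_at A f x ->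
  (forall v, fun_clift A f (x, v) * (Lie At Z (fun_vlift f) (x, v) - c) = 0) ->
  (differential A f x = 0 -> c = 0) ->
  forall v, Lie At Z (fun_vlift f) (x, v) = c.
Proof.
move=> Za fa H c0 v; have cx := chart_at_dom hA x; set i := chart_at A x in cx.
have [df0|df_neq0] := eqVneq (differential A f x) 0.
  by rewrite Lie_tangent_vlift// df0 pairingE mul0mx mxE c0.
have {}H v' : pairing (differential A f x) v' != 0 -> Lie At Z (fun_vlift f) (x, v') = c.
  move=> v'0; have /eqP := H v'; rewrite mulf_eq0 /fun_clift /= (negbTE v'0) /=.
  by rewrite subr_eq0 => /eqP.
have [v_eq0|/H//] := eqVneq (pairing (differential A f x) v) 0.
have [u u0] : exists u, pairing (differential A f x) u != 0.
  apply: contrapT => h; move/eqP: df_neq0; apply; apply: pairing_eq => w.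
  rewrite [RHS]pairingE mul0mx mxE; apply/eqP/negPn/negP => w0; apply: h.
  by exists w.
(* The derivative of [f^v] along [Z] with [df] frozen at [x], so that along the fibre only the
   analytic components of [Z] vary. *)
pose psi (y : 'rV[R]_(n + n)) : R :=
  \sum_a differential A f x 0 a * @vec_in _ _ _ At i Z y 0 (lshift n a).
pose line (t : R) : 'rV[R]_(n + n) := row_mx (chart_map i x) v + t *: row_mx 0 u.
have lineE t : line t = row_mx (chart_map i x) (v + t *: u).
  by rewrite /line scale_row_mx scaler0 add_row_mx addr0.
have psiE t : psi (line t) = Lie At Z (fun_vlift f) (x, v + t *: u).
  rewrite lineE /psi tangent_vec_in Lie_tangent_vlift//; apply: eq_bigr => a _.
  by apply: (congr1 (fun t => _ * t)); rewrite [RHS]mxE.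
have psia : {for line 0, continuous psi}.
  apply: analytic_at_continuous; apply: analytic_at_sum => a _.
  apply: analytic_atM; first exact: analytic_at_cst.
  apply: Za; exists (x, v); first by split.
  by rewrite lineE scale0r addr0 /= coord_changeE cchange_id// mulmx1.
have linec : {for 0, continuous line}.
  apply: continuousD; first exact: cst_continuous.
  exact: scalel_continuous.
have pc : {for 0, continuous (psi \o line)} by exact: (continuous_comp linec psia).
have : psi (line 0) = c.
  apply/eqP; rewrite -subr_eq0; apply/negPn/negP => neq.
  have pcB : {for 0, continuous (fun t => (psi \o line) t - c)}.
    by apply: continuousB pc _; exact: cst_continuous.
  have nz : \forall t \near (0 : R), (psi \o line) t - c != 0.
    by apply: (@cvgr_neq0 _ _ _ _ _ (fun t => (psi \o line) t - c) _ pcB).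
  move/nbhs_ballP : nz => [e /= e0 eP].
  have : ball (0 : R) e (e / 2) by rewrite /ball /= sub0r normrN gtr0_norm; lra.
  move=> /eP; rewrite /= psiE H ?subrr ?eqxx//.
  rewrite pairingC pairingE mulmxDl mxE -pairingE pairingC v_eq0 add0r.
  rewrite -scalemxAl mxE -pairingE pairingC mulf_neq0//; lra.
by rewrite psiE scale0r addr0.
Qed.

Lemma analytic_smooth f : (forall z, analytic_fun_at A f z) -> smooth_fun A setT f.
Proof. by move=> fa i k; apply: analytic_Ck => _ [z [iz _] <-]; exact: fa. Qed.

Lemma analytic_fun_at_sqr f z : analytic_fun_at A f z ->
  analytic_fun_at A (fun z => f z * f z) z.
Proof. by move=> fz i iz; exact: (analytic_atM (fz i iz) (fz i iz)). Qed.

Lemma Lie_base_mul X (f g : M -> R) x : analytic_fun_at A f x -> analytic_fun_at A g x ->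
  Lie A X (fun z => f z * g z) x = f x * Lie A X g x + g x * Lie A X f x.
Proof.
move=> fx gx; have cx := chart_at_dom hA x.
by apply: Lie_mul; [exact: (analytic_fun_at_diff cx fx)|exact: (analytic_fun_at_diff cx gx)|
  exact: chart_mapK].
Qed.

Lemma clift_mul (f g : M -> R) x v : analytic_fun_at A f x -> analytic_fun_at A g x ->
  fun_clift A (fun z => f z * g z) (x, v) = f x * fun_clift A g (x, v) + g x * fun_clift A f (x, v).
Proof. exact: (@Lie_base_mul (fun=> v)). Qed.

Lemma fun_clift_cst e : fun_clift A (fun=> e) = fun=> 0.
Proof. by apply/funext => -[x v]; exact: (@Lie_cst _ _ _ A (fun=> v) e x). Qed.

(* [Z] is determined on [f^v] by its values on [(f^2)^c = 2 f^v f^c]. *)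
Lemma Lie_clift_sqr (Z : M * 'rV[R]_n -> 'rV[R]_(n + n)) f x v :
  (forall z, analytic_fun_at A f z) ->
  Lie At Z (fun_clift A (fun z => f z * f z)) (x, v) =
  2 * (f x * Lie At Z (fun_clift A f) (x, v) +
       fun_clift A f (x, v) * Lie At Z (fun_vlift f) (x, v)).
Proof.
move=> fa.
have -> : fun_clift A (fun z => f z * f z) =
    (fun z => (fun=> 2) z * (fun_vlift f z * fun_clift A f z)).
  by apply/funext => -[x' v']; rewrite clift_mul// /fun_vlift; ring.
have vd : differentiable (fun_vlift f \o chart_inv (chart_at At (x, v)))
    (chart_map (chart_at At (x, v)) (x, v)).
  by rewrite tangent_chart_map; have [] := vlift_diff v (fa x).
have cd := clift_diff x v fa.
rewrite (Lie_mul (F := fun=> 2) Z).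
- by rewrite Lie_cst mulr0 addr0 Lie_mul//; exact: tangent_chart_mapK.
- exact: differentiable_cst.
- exact: differentiableM.
- exact: tangent_chart_mapK.
Qed.

(** Evaluating the lift on [f^2] and subtracting the value on [f] leaves [f^c] times the difference
    of the two sides, the situation of [fibre_extension]. The vertical case below is the same with
    value 0. *)
Lemma complete_lift_vlift X Z f : is_complete_lift A X Z ->
  (forall z, analytic_field_at A X z) -> (forall z, analytic_fun_at A f z) ->
  Lie At Z (fun_vlift f) = fun_vlift (Lie A X f).
Proof.
move=> [Za ZP] Xa fa; apply/funext => -[x v].
have La z : analytic_fun_at A (Lie A X f) z.
  by apply: (analytic_fun_at_Lie hA openT I) => [z' _|]; [exact: fa|exact: Xa].
have fc z := ZP setT f openT (analytic_smooth fa) z I.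
have ffa z := analytic_fun_at_sqr (fa z).
have ffc z := ZP setT _ openT (analytic_smooth ffa) z I.
apply: fibre_extension => // [v'|df0]; last first.
  by rewrite /fun_vlift /Lie /= df0 pairingE mul0mx mxE.
have := ffc (x, v'); rewrite Lie_clift_sqr// fc.
have -> : Lie A X (fun z => f z * f z) = (fun z => (fun=> 2) z * (f z * Lie A X f z)).
  by apply/funext => z; rewrite Lie_base_mul//; ring.
rewrite clift_mul; [|by move=> j _; exact: analytic_at_cst|
  by move=> j jx; exact: (analytic_atM (fa x j jx) (La x j jx))].
rewrite fun_clift_cst mulr0 addr0 clift_mul// /fun_vlift /= => h; lra.
Qed.

Lemma vertical_lift_vlift X Z f : is_vertical_lift A X Z ->
  (forall z, analytic_fun_at A f z) -> Lie At Z (fun_vlift f) = fun=> 0.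
Proof.
move=> [Za ZP] fa; apply/funext => -[x v].
have fc z := ZP setT f openT (analytic_smooth fa) z I.
have ffa z := analytic_fun_at_sqr (fa z).
have ffc z := ZP setT _ openT (analytic_smooth ffa) z I.
apply: fibre_extension => // v'.
have := ffc (x, v'); rewrite Lie_clift_sqr// fc /fun_vlift /= Lie_base_mul// => h.
by lra.
Qed.

End Lifts.

(** * Gradients for the Riemannian extension on the cotangent bundle *)

Section CotangentLifts.
Variables (R : realType) (n m : nat) (M : topologicalType) (A : atlas R n M).
Variable nabla : (M -> 'rV[R]_n) -> (M -> 'rV[R]_n) -> M -> 'rV[R]_n.
Hypothesis hA : analytic_manifold A.
Hypothesis hN : affine_connection A nabla.
Hypothesis hT : torsion_free A nabla.
Local Notation Ac := (cotangent_atlas A).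
Local Notation grad := (gradient Ac (riemannian_extension A nabla)).
Implicit Types (f : M -> R) (X Y : M -> 'rV[R]_n).

Lemma Gam_christoffel x a b c :
  christoffel A nabla x a b c = Gam nabla (chart_at A x) x a b 0 c.
Proof. by rewrite /Gam vec_in_at. Qed.

(** Coordinate fields have constant components in their own chart, so their bracket vanishes and
    torsion-freeness gives the symmetry. *)
Lemma christoffel_sym x a b c : christoffel A nabla x a b c = christoffel A nabla x b a c.
Proof.
have cx := chart_at_dom hA x; set i := chart_at A x in cx.
have FW d : analytic_field A (chart_dom i) (frame i d).
  by apply/(analytic_fieldP A) => z iz; exact: frame_analytic.
have frame_const e : \forall y \near chart_map i x, (delta_mx 0 e : 'rV[R]_n) = vec_in i (frame i e) y.
  apply: filterS (near_chart hA openT I cx) => y /(chart_img_inv hA)[iy _ yE].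
  by have := frame_vec_in hA e iy iy; rewrite yE => ->; rewrite cchange_id// mulmx1.
have D0 u e : 'D_u (vec_in i (frame i e)) (chart_map i x) = 0.
  by rewrite -(near_eq_derive u (frame_const e)) derive_cst.
have := hT (open_chart_dom hA i) (FW a) (FW b) cx.
rewrite /Lie_bracket -/i !D0 subrr => /eqP; rewrite subr_eq0 => /eqP e.
by rewrite /christoffel -/i e.
Qed.

Lemma of_field_diff X x (p : 'rV[R]_n) : analytic_field_at A X x ->
  let i := chart_at Ac (x, p) in
  differentiable (fun_of_field X \o chart_inv i) (chart_map i (x, p)) /\
  forall w, 'd (fun_of_field X \o chart_inv i) (chart_map i (x, p)) w =
    \sum_c (p 0 c * 'd (fun y => vec_in (chart_at A x) X y 0 c) (chart_map (chart_at A x) x) (lsubmx w)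
            + rsubmx w 0 c * X x 0 c).
Proof.
move=> Xx i; have cx := chart_at_dom hA x.
pose F c : 'rV[R]_n -> R := fun y => vec_in (chart_at A x) X y 0 c.
have FE : fun_of_field X \o chart_inv i = fun y => \sum_c rsubmx y 0 c * F c (lsubmx y).
  by apply/funext => y; rewrite /fun_of_field /= pairing_trmx.
rewrite FE (cotangent_chart_map hA x p).
have Fd c : differentiable (F c) (lsubmx (row_mx (chart_map (chart_at A x) x) p)).
  by rewrite row_mxKl; apply: analytic_at_differentiable; exact: Xx.
have [d1 d2] := diff_fibre_pairing Fd; split=> [|w]; first exact: d1.
apply: etrans (d2 w) _; apply: eq_bigr => c _; rewrite row_mxKl row_mxKr.
by apply: (congr1 (fun t => _ + _ * t)); rewrite /F vec_in_at.
Qed.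

Lemma Lie_of_field (Z : M * 'rV[R]_n -> 'rV[R]_(n + n)) X x p : analytic_field_at A X x ->
  Lie Ac Z (fun_of_field X) (x, p) =
  \sum_c (p 0 c * (\sum_a lsubmx (Z (x, p)) 0 a *
     'D_(delta_mx 0 a) (fun y => vec_in (chart_at A x) X y 0 c) (chart_map (chart_at A x) x))
            + rsubmx (Z (x, p)) 0 c * X x 0 c).
Proof.
move=> Xx; have cx := chart_at_dom hA x; have [d1 d2] := of_field_diff p Xx.
rewrite Lie_diff// d2; apply: eq_bigr => c _.
apply: (congr1 (fun t => p 0 c * t + _)); apply: derive_delta.
exact: analytic_at_differentiable (Xx _ cx c).
Qed.

Lemma invmx_riemannian_extension z : invmx (riemannian_extension A nabla z) =
  block_mx 0 1%:M 1%:M (- ulsubmx (riemannian_extension A nabla z)).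
Proof.
rewrite /riemannian_extension block_mxKul; set N := \matrix_(_, _) _.
set B := block_mx N _ _ _; set C := block_mx _ _ _ _.
have BC : B *m C = 1%:M.
  rewrite mulmx_block !mulmx1 !mul1mx !mul0mx mulmx0 add0r addr0 addrN addr0.
  by rewrite -scalar_mx_block.
have [Bu _] := mulmx1_unit BC.
by rewrite -[LHS]mulmx1 -BC mulKmx.
Qed.

Lemma gradE (F : M * 'rV[R]_n -> R) z (u v : 'rV[R]_n) : differential Ac F z = row_mx u v ->
  grad F z = row_mx v (u - v *m ulsubmx (riemannian_extension A nabla z)).
Proof.
move=> dF; rewrite /gradient dF invmx_riemannian_extension mul_row_block.
by rewrite mulmx0 !mulmx1 add0r mulmxN.
Qed.

Lemma differential_pairing (F : M * 'rV[R]_n -> R) z (g : 'rV[R]_(n + n)) :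
  (forall w, Lie Ac (fun=> w) F z = pairing g w) -> differential Ac F z = g.
Proof. exact: pairing_eq. Qed.

Lemma pairing_row_mx (u v : 'rV[R]_n) (w : 'rV[R]_(n + n)) :
  pairing (row_mx u v) w = pairing u (lsubmx w) + pairing v (rsubmx w).
Proof.
rewrite /pairing big_split_ord /=; congr (_ + _); apply: eq_bigr => a _.
  by rewrite row_mxEl mxE.
by rewrite row_mxEr mxE.
Qed.

Lemma grad_vlift f x p : analytic_fun_at A f x ->
  grad (fun_vlift f) (x, p) = row_mx 0 (differential A f x).
Proof.
move=> fx; rewrite (gradE (u := differential A f x) (v := 0)) ?mul0mx ?subr0//.
apply: differential_pairing => w; rewrite Lie_cotangent_vlift// pairing_row_mx.
by rewrite [X in _ + X]pairingE mul0mx mxE addr0.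
Qed.

Lemma grad_of_field X x p : analytic_field_at A X x ->
  grad (fun_of_field X) (x, p) = row_mx (X x)
    (\row_a (\sum_c p 0 c *
       'D_(delta_mx 0 a) (fun y => vec_in (chart_at A x) X y 0 c) (chart_map (chart_at A x) x))
     - X x *m ulsubmx (riemannian_extension A nabla (x, p))).
Proof.
move=> Xx; apply: gradE; apply: differential_pairing => w.
rewrite Lie_of_field// pairing_row_mx big_split /=; congr (_ + _).
  rewrite /pairing; under [RHS]eq_bigr do rewrite mxE mulr_suml.
  rewrite [RHS]exchange_big; apply: eq_bigr => c _; rewrite mulr_sumr.
  by apply: eq_bigr => a _; rewrite mulrCA mulrC.
by apply: eq_bigr => c _; rewrite mulrC.
Qed.

Lemma Lie_grad_of_field_vlift X f : (forall x, analytic_field_at A X x) ->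
  (forall x, analytic_fun_at A f x) ->
  Lie Ac (grad (fun_of_field X)) (fun_vlift f) = fun_vlift (Lie A X f).
Proof.
move=> Xa fa; apply/funext => -[x p].
by rewrite Lie_cotangent_vlift// grad_of_field// row_mxKl.
Qed.

Lemma Lie_grad_vlift_vlift f g : (forall x, analytic_fun_at A f x) ->
  (forall x, analytic_fun_at A g x) ->
  Lie Ac (grad (fun_vlift f)) (fun_vlift g) = fun=> 0.
Proof.
move=> fa ga; apply/funext => -[x p].
by rewrite Lie_cotangent_vlift// grad_vlift// row_mxKl pairingC pairingE mul0mx mxE.
Qed.

Lemma Lie_grad_vlift_of_field f Y : (forall x, analytic_fun_at A f x) ->
  (forall x, analytic_field_at A Y x) ->
  Lie Ac (grad (fun_vlift f)) (fun_of_field Y) = fun_vlift (Lie A Y f).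
Proof.
move=> fa Ya; apply/funext => -[x p].
rewrite Lie_of_field// grad_vlift// row_mxKl row_mxKr /fun_vlift /Lie /pairing /=.
apply: eq_bigr => c _; rewrite big1 ?mulr0 ?add0r// => a _.
by rewrite mxE mul0r.
Qed.

(** The counterpart on functions of the defining property of the Riemannian extension. The block
    [-2 p Gamma] enters the inverse matrix with opposite sign and, the symbols being symmetric,
    supplies the Christoffel terms of the symmetric product. *)
Lemma Lie_grad_of_field X Y : analytic_field A setT X -> analytic_field A setT Y ->
  Lie Ac (grad (fun_of_field X)) (fun_of_field Y) =
  fun_of_field (symmetric_product nabla X Y).
Proof.
move=> XT YT; apply/funext => -[x p]; have cx := chart_at_dom hA x.
have Xx : analytic_field_at A X x by move/(analytic_fieldP A) : XT; apply.
have Yx : analytic_field_at A Y x by move/(analytic_fieldP A) : YT; apply.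
set i := chart_at A x in cx.
rewrite Lie_of_field// grad_of_field// row_mxKl row_mxKr /fun_of_field /pairing /=.
pose dX a c : R := 'D_(delta_mx 0 a) (fun y => vec_in i X y 0 c) (chart_map i x).
pose dY a c : R := 'D_(delta_mx 0 a) (fun y => vec_in i Y y 0 c) (chart_map i x).
pose K a b c := Gam nabla i x a b 0 c.
(* The metric contains [2 Gamma_ab] while the symmetric product contains [Gamma_ab + Gamma_ba];
   torsion-freeness reconciles them. *)
have KC a b c : K a b c = K b a c by rewrite /K -!Gam_christoffel christoffel_sym.
have spE c : symmetric_product nabla X Y x 0 c = \sum_a X x 0 a * dY a c +
    \sum_a Y x 0 a * dX a c + \sum_a \sum_b X x 0 a * Y x 0 b * (K a b c + K b a c).
  have vE Z : vec_in i Z (chart_map i x) = Z x by rewrite /i vec_in_at.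
  by have := symmetric_product_chart hA hN c XT YT cx; rewrite /= !vE.
under [RHS]eq_bigr do rewrite spE.
have NE a b : ulsubmx (riemannian_extension A nabla (x, p)) a b = - 2 * \sum_c p 0 c * K a b c.
  rewrite /riemannian_extension block_mxKul mxE /=; congr (_ * _).
  by apply: eq_bigr => c _; rewrite Gam_christoffel.
rewrite big_split /=.
have -> : \sum_c p 0 c * (\sum_a X x 0 a * dY a c + \sum_a Y x 0 a * dX a c +
     \sum_a \sum_b X x 0 a * Y x 0 b * (K a b c + K b a c)) =
   \sum_c p 0 c * (\sum_a X x 0 a * dY a c) +
   \sum_c p 0 c * (\sum_a Y x 0 a * dX a c + \sum_a \sum_b X x 0 a * Y x 0 b * (K a b c + K b a c)).
  by rewrite -big_split; apply: eq_bigr => c _ /=; rewrite -mulrDr addrA.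
apply: (congr1 (fun t => _ + t)).
transitivity (\sum_b \sum_c (p 0 c * (Y x 0 b * dX b c) +
    p 0 c * \sum_a X x 0 a * Y x 0 b * (K a b c + K b a c))).
  apply: eq_bigr => b _; rewrite mxE [X in (X + _) * _]mxE [X in (_ + X) * _]mxE.
  rewrite [X in (_ - X) * _]mxE mulrDl big_split /=; congr (_ + _).
    rewrite mulr_suml; apply: eq_bigr => c _; rewrite -/i -/(dX b c); ring.
  rewrite mulNr mulr_suml -sumrN.
  transitivity (\sum_a \sum_c p 0 c * (X x 0 a * Y x 0 b * (K a b c + K b a c))).
    apply: eq_bigr => a _; rewrite NE.
    transitivity (2 * (X x 0 a * Y x 0 b) * \sum_c p 0 c * K a b c).
      by move: (\sum_c _) => s; ring.
    by rewrite mulr_sumr; apply: eq_bigr => c _; rewrite (KC b a c); ring.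
  by rewrite exchange_big; apply: eq_bigr => c _ /=; rewrite mulr_sumr.
rewrite exchange_big; apply: eq_bigr => c _ /=.
rewrite big_split /= mulrDr !mulr_sumr; congr (_ + _).
rewrite -mulr_sumr exchange_big /= mulr_sumr; apply: eq_bigr => b _.
by [].
Qed.

End CotangentLifts.

(** * Iterated output derivatives of the two extended systems *)

Section WordLifts.
Variables (R : realType) (n m : nat) (M : topologicalType) (A : atlas R n M).
Variable S : affine_system R n M 'I_m.
Variable nabla : (M -> 'rV[R]_n) -> (M -> 'rV[R]_n) -> M -> 'rV[R]_n.
Hypothesis hA : analytic_manifold A.
Hypothesis hS : control_system A S.
Hypothesis hN : affine_connection A nabla.
Hypothesis hT : torsion_free A nabla.
Hypothesis hC : compatible A S nabla.
Local Notation At := (tangent_atlas A).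
Local Notation Ac := (cotangent_atlas A).
Local Notation V := (word_fun A S).
Local Notation Rf := (word_field S nabla).

(* A word of the extended systems gives the complete ([Some (true, w)]) or the
   vertical ([Some (false, w)]) lift attached to a word [w] of the base system,
   or zero: each vertical field lowers the level by one. *)
Definition lift_step (i : option ('I_m + 'I_m)) (s : option (bool * word 'I_m)) :=
  if s is Some (complete, (l, j)) then
    match i with
    | None => Some (complete, (None :: l, j))
    | Some (inl k) => Some (complete, (Some k :: l, j))
    | Some (inr k) => if complete then Some (false, (Some k :: l, j)) else None
    end
  else None.

Definition lift_word (w : word ('I_m + 'I_m)) : option (bool * word 'I_m) :=
  foldr lift_step
    (match w.2 with inl j => Some (false, ([::], j)) | inr j => Some (true, ([::], j)) end) w.1.

(** Both systems share [lift_word]; they differ only in the function [F] attached to the complete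
    level, [V_w^c] for the prolongation and [V^{R_w}] for the gradient extension. *)
Definition lift_value (F : word 'I_m -> M * 'rV[R]_n -> R) (s : option (bool * word 'I_m)) :
    M * 'rV[R]_n -> R :=
  match s with
  | None => fun=> 0
  | Some (false, w) => fun_vlift (V w)
  | Some (true, w) => F w
  end.

Let Va w z : analytic_fun_at A (V w) z. Proof. exact: word_fun_analytic. Qed.

Lemma prolonged_word (Sp : affine_system R (n + n) (M * 'rV[R]_n) ('I_m + 'I_m)) w :
  is_prolonged_system A S Sp ->
  word_fun At Sp w = lift_value (fun w => fun_clift A (V w)) (lift_word w).
Proof.
move=> [drift inp vert out1 out2].
have complete k Z : is_complete_lift A (sys_field S k) Z -> forall w,
    Lie At Z (fun_clift A (V w)) = fun_clift A (Lie A (sys_field S k) (V w)) /\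
    Lie At Z (fun_vlift (V w)) = fun_vlift (Lie A (sys_field S k) (V w)).
  move=> ZP w'; split.
    apply/funext => z; have [_ h] := ZP.
    by apply: (h setT) => //; [exact: openT|exact: analytic_smooth].
  by apply: complete_lift_vlift => // z; exact: sys_field_analytic.
case: w => l o; elim: l => [|i l IH].
  case: o => j; rewrite /word_fun /=; first exact: out1.
  exact: out2.
rewrite -[LHS]/(Lie At (sys_field Sp i) (word_fun At Sp (l, o))) IH.
rewrite -[lift_word (i :: l, o)]/(lift_step i (lift_word (l, o))).
case: (lift_word (l, o)) => [[[] [l' j]]|] /=; last first.
- by apply/funext => z; exact: Lie_cst.
- case: i => [[k|k]|] /=.
  + by have [_ ->] := complete _ _ (inp k) (l', j).
  + exact: vertical_lift_vlift (vert k) _.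
  + by have [_ ->] := complete _ _ drift (l', j).
- case: i => [[k|k]|] /=.
  + by have [-> _] := complete _ _ (inp k) (l', j).
  + apply/funext => z; have [_ h] := vert k.
    by apply: (h setT) => //; [exact: openT|exact: analytic_smooth].
  + by have [-> _] := complete _ _ drift (l', j).
Qed.

Lemma gradient_extension_word w :
  word_fun Ac (gradient_extension A nabla S) w =
  lift_value (fun w => fun_of_field (Rf w)) (lift_word w).
Proof.
have Xa k z : analytic_field_at A (sys_field S k) z by exact: sys_field_analytic.
have XT k : analytic_field A setT (sys_field S k) by exact: sys_field_analyticT.
have RT w' : analytic_field A setT (Rf w') by exact: word_field_analytic.
have Ra w' z : analytic_field_at A (Rf w') z by move/(analytic_fieldP A) : (RT w'); apply.
have oa j z : analytic_fun_at A (sys_output S j) z by exact: (Va ([::], j)).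
case: w => l o; elim: l => [|i l IH]; first by case: o.
rewrite -[LHS]/(Lie Ac (sys_field (gradient_extension A nabla S) i)
   (word_fun Ac (gradient_extension A nabla S) (l, o))) IH.
rewrite -[lift_word (i :: l, o)]/(lift_step i (lift_word (l, o))).
case: (lift_word (l, o)) => [[[] [l' j]]|] /=; last first.
- by apply/funext => z; exact: Lie_cst.
- case: i => [[k|k]|] /=.
  + exact: (Lie_grad_of_field_vlift nabla hA (Xa (Some k)) (Va (l', j))).
  + exact: (Lie_grad_vlift_vlift nabla hA (oa k) (Va (l', j))).
  + exact: (Lie_grad_of_field_vlift nabla hA (Xa None) (Va (l', j))).
- case: i => [[k|k]|] /=.
  + exact: (Lie_grad_of_field hA hN hT (XT (Some k)) (RT (l', j))).
  + apply: etrans (Lie_grad_vlift_of_field nabla hA (oa k) (Ra (l', j))) _.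
    (* A vertical letter [k] turns [V^{R_w}] into the lift of the derivative of [V_k] along [R_w];
       condition (a) with the one-letter word of [k] rewrites it as the derivative of [V_w] along
       [g_k]. *)
    by congr fun_vlift; have [h _] := hC; exact: (h (l', j) ([::], k)).
  + exact: (Lie_grad_of_field hA hN hT (XT None) (RT (l', j))).
Qed.

Lemma metric_weakly_externally_equivalent (G : M -> 'M[R]_n)
    (Sp : affine_system R (n + n) (M * 'rV[R]_n) ('I_m + 'I_m)) :
  (forall x, (G x)^T = G x) -> (forall x, G x \in unitmx) ->
  (forall x w, differential A (V w) x = Rf w x *m G x) ->
  is_prolonged_system A S Sp ->
  weakly_externally_equivalent At Ac Sp (gradient_extension A nabla S).
Proof.
move=> Gsym Gu GE hP.
have E x v w : fun_clift A (V w) (x, v) = fun_of_field (Rf w) (x, v *m G x).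
  by rewrite /fun_clift /fun_of_field /= GE -{1}[G x]trmxK pairing_trmx Gsym pairingC.
have H x v w : word_fun At Sp w (x, v) =
    word_fun Ac (gradient_extension A nabla S) w (x, v *m G x).
  rewrite (prolonged_word w hP) gradient_extension_word.
  by case: (lift_word w) => [[[] w']|] //=; exact: E.
split=> [[x v]|[x p]]; first by exists (x, v *m G x) => w; exact: H.
by exists (x, p *m invmx (G x)) => w; rewrite H mulmxKV.
Qed.

End WordLifts.

Theorem theorem5p4 (R : realType) (n m : nat)
    (M : topologicalType) (A : atlas R n M) (U : set 'rV[R]_m)
    (S : affine_system R n M 'I_m)
    (nabla : (M -> 'rV[R]_n) -> (M -> 'rV[R]_n) -> M -> 'rV[R]_n)
    (Sp : affine_system R (n + n) (M * 'rV[R]_n) ('I_m + 'I_m)) :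
  analytic_manifold A ->
  open U -> U 0 ->
  control_system A S ->
  affine_connection A nabla -> torsion_free A nabla ->
  observable A U S -> constant_observation_dim A S ->
  compatible A S nabla ->
  full_rank S nabla ->
  is_prolonged_system A S Sp ->
  locally_gradient_system A S <->
  weakly_externally_equivalent (tangent_atlas A) (cotangent_atlas A)
    Sp (gradient_extension A nabla S).
Proof.
move=> hA _ _ hS hN hT hO hdim hC hF hP.
have hD := differentials_separate hA hS (observable_separates hA hS hO) hdim.
have GE := gradient_metricE hC hF; have Gsym := gradient_metric_sym hC hF.
have Gu := gradient_metric_unit hC hF hD; have Gan := form_metric_analytic hA hS hN hC hF.
split=> _; first exact: (metric_weakly_externally_equivalent hA hS hN hT hC Gsym Gu GE hP).
exists (gradient_metric hC hF); split.
- exact: gradient_metric_pseudo_riemannian.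
- move=> i _ [x [ix _] <-] a b.
  exact: (drift_closed hA hS hN hC hF Gsym GE Gan ix).
- by move=> j; exact: sys_field_gradient.
Qed.
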